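(* Let $(S^2,g,\sigma=f\mu)$ be a symplectic magnetic system. Given $\varepsilon>0$ and a positive integer $n$, there exists $m_{\varepsilon,n}>0$ such that for every $0<m<m_{\varepsilon,n}$ the projection $\pi(\gamma)$ of a prime periodic solution $\gamma$ of the magnetic flow on $\Sigma_m$ either is a simple curve on $S^2$ with length in $\left(\frac{2\pi-\varepsilon}{\max f}m,\frac{2\pi+\varepsilon}{\min f}m\right)$, or has at least $n$ self-intersections and length larger than $\frac{m}{\varepsilon}$.
   Context: $g$ is a Riemannian metric on the oriented sphere $S^2$ with area form $\mu$; $\sigma=f\mu$ is symplectic, with orientation chosen so that $f>0$. On $\pi:TS^2\to S^2$ put $\lambda_{(x,v)}(\xi)=g_x(v,d\pi\,\xi)$, $\omega_\sigma=d\lambda-\pi^*\sigma$, $E(x,v)=\frac12g_x(v,v)$, $\Sigma_m=\{E=m^2/2\}$. The magnetic flow on $\Sigma_m$ is the flow of $X^\sigma_E$, $\imath_{X^\sigma_E}\omega_\sigma=-dE$ (equivalently, curves on $S^2$ with speed $m$ and geodesic curvature $f/m$). Lengths are measured with $g$; prime means not a proper iterate of another periodic solution. *)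

(* Defs.v *)
From HB Require Import structures.
From mathcomp Require Import all_boot all_order all_algebra.
From mathcomp Require Import all_classical all_reals all_analysis.
Set Implicit Arguments.
Unset Strict Implicit.
Unset Printing Implicit Defensive.
Import Order.TTheory GRing.Theory Num.Theory.
Import numFieldNormedType.Exports.
Local Open Scope classical_set_scope.
Local Open Scope ring_scope.

(* S^2 is the unit sphere of R^3 and TS^2 = {(x, v) : |x| = 1, x.v = 0} sits in
   R^3 x R^3.  Tensors on S^2 are given by maps defined on R^3 and smooth on a
   neighbourhood of S^2; every smooth tensor on S^2 arises in this way, and
   only its values on vectors tangent to S^2 at points of S^2 matter below. *)

Section Sphere.
Variable R : realType.

Definition dot (u w : 'rV[R]_3) : R := \sum_(i < 3) u 0 i * w 0 i.

Definition sphere2 : set 'rV[R]_3 := [set x | dot x x = 1].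

Definition tangent_sphere2 (x : 'rV[R]_3) : set 'rV[R]_3 :=
  [set u | dot x u = 0].

Definition tangent_bundle : set ('rV[R]_3 * 'rV[R]_3) :=
  [set p | sphere2 p.1 /\ tangent_sphere2 p.1 p.2].

(* T_{(x,v)} TS^2: the kernel of the differentials of the two equations
   x.x = 1 and x.v = 0 which define TS^2. *)
Definition tangent_TS (p : 'rV[R]_3 * 'rV[R]_3) : set ('rV[R]_3 * 'rV[R]_3) :=
  [set xi | dot p.1 xi.1 = 0 /\ dot xi.1 p.2 + dot p.1 xi.2 = 0].

Definition iter_derive (V W : normedModType R) (F : V -> W) (vs : seq V)
    : V -> W :=
  foldr (fun (v : V) (h : V -> W) (x : V) => 'D_v h x) F vs.

(* C^oo: all iterated directional derivatives are Frechet differentiable. *)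
Definition smooth_on (V W : normedModType R) (U : set V) (F : V -> W) : Prop :=
  forall (vs : seq V) (x : V), U x -> differentiable (iter_derive F vs) x.

Definition smooth_near_sphere2 (W : normedModType R) (F : 'rV[R]_3 -> W)
    : Prop :=
  exists U : set 'rV[R]_3, [/\ open U, sphere2 `<=` U & smooth_on U F].

Definition bilin (A : 'M[R]_3) (u w : 'rV[R]_3) : R := (u *m A *m w^T) 0 0.

Definition is_riemannian (G : 'rV[R]_3 -> 'M[R]_3) : Prop :=
  [/\ smooth_near_sphere2 G,
      forall x u w : 'rV[R]_3, sphere2 x -> tangent_sphere2 x u ->
        tangent_sphere2 x w -> bilin (G x) u w = bilin (G x) w u
    & forall x u : 'rV[R]_3, sphere2 x -> tangent_sphere2 x u ->
        u != 0 -> 0 < bilin (G x) u u].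

End Sphere.

(* ms_orient selects one of the two orientations of S^2: [false] is the
   orientation for which (a, b) is positive in T_x S^2 iff det(x, a, b) > 0,
   and [true] is the opposite one.  *)
Record symplectic_magnetic_system (R : realType) := SymplecticMagneticSystem {
  ms_metric : 'rV[R]_3 -> 'M[R]_3;
  ms_orient : bool;
  ms_f : 'rV[R]_3 -> R;
  ms_metricP : is_riemannian ms_metric;
  ms_f_smooth : smooth_near_sphere2 (W := R^o) ms_f;
  ms_f_gt0 : forall x : 'rV[R]_3, sphere2 x -> 0 < ms_f x
}.

Section MagneticFlow.
Variables (R : realType) (M : symplectic_magnetic_system R).
Notation V := 'rV[R]_3.

Definition metric (x u w : V) : R := bilin (ms_metric M x) u w.

(* The Riemannian area form: its absolute value on (a, b) is the g-area of the
   parallelogram spanned by a and b (square root of their Gram determinant),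
   and its sign is given by the orientation. *)
Definition area_form (x a b : V) : R :=
  (-1) ^+ ms_orient M
  * Num.sg (\det (\matrix_(i < 3) nth 0 [:: x; a; b] i))
  * Num.sqrt (metric x a a * metric x b b - metric x a b ^+ 2).

Definition sigma (x a b : V) : R := ms_f M x * area_form x a b.

Definition lambda (p xi : V * V) : R := metric p.1 p.2 xi.1.

(* The exterior derivative of lambda on constant vector fields of R^3 x R^3.
   Its restriction to T TS^2 is the differential of the restriction of lambda
   to TS^2, and so does not depend on how the metric is extended off S^2. *)
Definition dlambda (p xi eta : V * V) : R :=
  'D_xi (fun q : V * V => lambda q eta : R^o) p
  - 'D_eta (fun q : V * V => lambda q xi : R^o) p.

Definition omega_sigma (p xi eta : V * V) : R :=
  dlambda p xi eta - sigma p.1 xi.1 eta.1.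

Definition energy (p : V * V) : R := metric p.1 p.2 p.2 / 2.

Definition energy_level (m : R) : set (V * V) :=
  [set p | tangent_bundle p /\ energy p = m ^+ 2 / 2].

(* xi is the value at p of the vector field X on TS^2 determined by
   i_X omega_sigma = - dE. *)
Definition is_hamiltonian_vector (p xi : V * V) : Prop :=
  tangent_TS p xi /\
  forall eta : V * V, tangent_TS p eta ->
    omega_sigma p xi eta = - 'D_eta (energy : V * V -> R^o) p.

Definition magnetic_solution (m : R) (gamma : R -> V * V) : Prop :=
  forall t : R, [/\ energy_level m (gamma t), derivable gamma t 1
                  & is_hamiltonian_vector (gamma t) (derive1 gamma t)].

(* A periodic solution is a solution together with a period T, which need not
   be minimal. *)
Definition periodic_solution (m : R) (gamma : R -> V * V) (T : R) : Prop :=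
  [/\ 0 < T, magnetic_solution m gamma & forall t : R, gamma (t + T) = gamma t].

(* The k-th iterate of the periodic solution (delta, S) is (delta, k S). *)
Definition prime_periodic_solution (m : R) (gamma : R -> V * V) (T : R)
    : Prop :=
  periodic_solution m gamma T /\
  ~ exists (k : nat) (delta : R -> V * V) (S : R),
      [/\ (1 < k)%N, periodic_solution m delta S, gamma = delta
        & T = k%:R * S].

Definition proj_curve (gamma : R -> V * V) (t : R) : V := (gamma t).1.

Definition curve_length (c : R -> V) (T : R) : R :=
  \int[lebesgue_measure]_(t in `[0, T])
    Num.sqrt (metric (c t) (derive1 c t) (derive1 c t)).

Definition min_f : R := inf (ms_f M @` @sphere2 R).
Definition max_f : R := sup (ms_f M @` @sphere2 R).

End MagneticFlow.

(* For T-periodic curves. *)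
Definition simple_closed_curve (R : realType) (X : Type) (c : R -> X) (T : R)
    : Prop :=
  {in `[0, T[ &, injective c}.

(* Self-intersections are unordered pairs of distinct times modulo T, so that a
   point through which the curve passes k times counts for k (k - 1) / 2. *)
Definition self_intersections (R : realType) (X : Type) (c : R -> X) (T : R)
    : set (R * R) :=
  [set st | [/\ 0 <= st.1, st.1 < st.2, st.2 < T & c st.1 = c st.2]].

(* Main.v *)
(** Rescale the velocity to [w = v / m].  The equations become [x' = m w] and
    [w' = f(x) J w + O(m)], where [J] is the rotation by a right angle in the
    tangent plane.  Over a bounded time [x] moves by [O(m)], so [w] rotates with
    frequency [f(x(0))] up to [O(m)], and at some time [tau] close to
    [2 pi / f(x(0))] it has, in a fixed frame, its initial direction again.  Let
    [d = x(tau) - x(0)].  By Gronwall's lemma, [x(t + tau) - x(t) = d + O(m |d|)].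
    If [d = 0], then [tau] is a period, primeness forces [T = tau], and a chord
    estimate shows that the curve is simple.  If [d <> 0], consecutive turns are
    almost equal circles displaced by a small nonzero vector, hence cross each
    other by the intermediate value theorem; and the drift adds up, so that the
    curve cannot close before a number of turns that grows as [m] tends to 0. *)

Require Import Defs.
From mathcomp Require Import all_boot all_order all_algebra.
From mathcomp Require Import all_classical all_reals all_analysis.
From mathcomp Require Import ring lra.
Set Implicit Arguments.
Unset Strict Implicit.
Unset Printing Implicit Defensive.
Import Order.TTheory GRing.Theory Num.Theory.
Import numFieldNormedType.Exports.
Local Open Scope classical_set_scope.
Local Open Scope card_scope.
Local Open Scope ring_scope.

(** * One-variable calculus *)

Section Calculus.
Variable R : realType.
Implicit Types (f g df dg : R -> R) (a b t x : R).

(** The obstacle is that the displacement [d] of one turn may be smaller than any power of [m], so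
    that an estimate with an absolute error could never show that consecutive turns cross. Every
    error after the first turn is therefore made proportional to |d|. This is why [tau] is the time
    at which the direction returns: both velocities are unit vectors, so the states at times 0 and
    [tau] differ, velocity included, by O(|d|). Gronwall's lemma keeps the velocities of the curve
    and of its shift in time O(|d|) apart, and integrating x' = m u gains the factor m. For d = 0
    the same estimate serves as the uniqueness theorem of the flow. The rotation estimates live in a
    time window of length [W], fixed before [m] and long enough for all the turns that are looked
    at. Constants are uniform in the trajectory by compactness of the sphere. Charts are avoided:
    within the window the curve stays O(m) close to its initial point, where two linear forms on R^3
    are good coordinates. *)

Lemma is_derive_addE f g t (a b : R) : is_derive t 1 f a -> is_derive t 1 g b ->
  is_derive t 1 (fun s => f s + g s) (a + b).
Proof. exact: is_deriveD. Qed.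

Lemma is_derive_subE f g t (a b : R) : is_derive t 1 f a -> is_derive t 1 g b ->
  is_derive t 1 (fun s => f s - g s) (a - b).
Proof. exact: is_deriveB. Qed.

Lemma is_derive_mulE f g t (a b : R) : is_derive t 1 f a -> is_derive t 1 g b ->
  is_derive t 1 (fun s => f s * g s) (a * g t + f t * b).
Proof.
move=> hf hg; have h := is_deriveM hf hg; apply: (is_derive_eq h).
by rewrite /GRing.scale /= addrC (mulrC (g t)).
Qed.

Lemma is_derive_scaleE f (k t a : R) : is_derive t 1 f a ->
  is_derive t 1 (fun s => k * f s) (k * a).
Proof. by move=> hf; apply: (is_deriveZ k hf). Qed.

Lemma is_derive_shiftE f (k t a : R) : is_derive (t + k) 1 f a ->
  is_derive t 1 (fun s => f (s + k)) a.
Proof.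
move=> hf; rewrite -[a]mulr1.
apply: (@is_derive1_comp _ f (fun s => s + k) t a 1).
exact: is_derive_shift.
Qed.

Lemma is_derive_affine (k l t : R) : is_derive t 1 (fun s => k * s + l) k.
Proof.
have h := is_derive_addE (is_derive_scaleE k (is_derive_id t (1 : R)))
  (is_derive_cst l t (1 : R)).
by apply: (is_derive_eq h); rewrite addr0 mulr1.
Qed.

Lemma is_derive_sin_affine (k l t : R) :
  is_derive t 1 (fun s => sin (k * s + l)) (k * cos (k * t + l)).
Proof.
rewrite mulrC; apply: (@is_derive1_comp _ sin (fun s => k * s + l)).
exact: is_derive_affine.
Qed.

Lemma is_derive_cos_affine (k l t : R) :
  is_derive t 1 (fun s => cos (k * s + l)) (- (k * sin (k * t + l))).
Proof.
rewrite mulrC -mulNr; apply: (@is_derive1_comp _ cos (fun s => k * s + l)).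
exact: is_derive_affine.
Qed.

Lemma is_derive_continuous f df : (forall t, is_derive t 1 f (df t)) ->
  continuous f.
Proof.
move=> hf t; apply: differentiable_continuous; apply/derivable1_diffP.
exact: ex_derive.
Qed.

Lemma mean_value f df a b : a <= b -> (forall t, is_derive t 1 f (df t)) ->
  exists2 c, a <= c <= b & f b - f a = df c * (b - a).
Proof.
move=> ab hf; have [|c] := @MVT_segment _ f df a b ab.
  by apply: continuous_subspaceT; exact: is_derive_continuous hf.
by rewrite in_itv /= => ? ?; exists c.
Qed.

Lemma derive_ge f df a b k : a <= b -> (forall t, is_derive t 1 f (df t)) ->
  (forall t, a <= t <= b -> k <= df t) -> k * (b - a) <= f b - f a.
Proof.
move=> ab hf hk; have [c cab ->] := mean_value ab hf.
by rewrite ler_wpM2r ?subr_ge0 // hk.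
Qed.

Lemma derive_le f df a b k : a <= b -> (forall t, is_derive t 1 f (df t)) ->
  (forall t, a <= t <= b -> df t <= k) -> f b - f a <= k * (b - a).
Proof.
move=> ab hf hk; have [c cab ->] := mean_value ab hf.
by rewrite ler_wpM2r ?subr_ge0 // hk.
Qed.

Lemma derive_norm_le f df a b k : a <= b -> (forall t, is_derive t 1 f (df t)) ->
  (forall t, a <= t <= b -> `|df t| <= k) -> `|f b - f a| <= k * (b - a).
Proof.
move=> ab hf hk; have [c cab ->] := mean_value ab hf.
by rewrite normrM (ger0_norm (x := b - a)) ?ler_wpM2r ?subr_ge0 // hk.
Qed.

Lemma intermediate_value f a b v : a <= b -> continuous f ->
  f a <= v <= f b -> exists2 c, a <= c <= b & f c = v.
Proof.
move=> ab cf /andP[fav fvb]; have [||c] := @IVT _ f a b v ab.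
- exact: continuous_subspaceT.
- by rewrite ge_min fav le_max fvb orbT.
- by rewrite in_itv /= => ? ?; exists c.
Qed.

Lemma gronwall f df K : (forall t, is_derive t 1 f (df t)) ->
  (forall t, 0 <= t -> df t <= K * f t) ->
  forall t, 0 <= t -> f t <= f 0 * expR (K * t).
Proof.
move=> hf hK t t0.
have hg (s : R) : is_derive s 1 (fun u : R => f u * expR (- K * u))
    (df s * expR (- K * s) + f s * (expR (- K * s) * - K)).
  apply: is_derive_mulE; apply: (@is_derive1_comp _ expR (fun u => - K * u)).
  have := is_derive_affine (- K) 0 s.
  by under eq_fun do rewrite addr0.
have := derive_le (k := 0) t0 hg; rewrite mulr0 expR0 mulr1 mul0r => H.
have {}H : f t * expR (- K * t) <= f 0.
  rewrite -subr_le0; apply: H => s /andP[s0 _].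
  have := hK s s0; have := expR_gt0 (- K * s); nra.
rewrite -(ler_pM2r (expR_gt0 (- K * t))) -mulrA mulNr expRN divff ?mulr1 //.
  by move: H; rewrite mulNr expRN.
by rewrite gt_eqF ?expR_gt0.
Qed.

Lemma sin_norm_le x : `|sin x| <= `|x|.
Proof.
wlog x0 : x / 0 <= x => [H|].
  have [/H //|/ltW x0] := leP 0 x.
  by rewrite -normrN -sinN -(normrN x) H // oppr_ge0.
have hs t : is_derive t 1 sin (cos t) by exact: is_derive_sin.
have := derive_norm_le (k := 1) x0 hs; rewrite sin0 !subr0 mul1r.
rewrite (ger0_norm x0); apply => t _.
by rewrite ler_norml cos_geN1 cos_le1.
Qed.

(** From cos x = 1 - 2 sin^2 (x / 2) and |sin (x / 2)| <= 1 / 2. *)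
Lemma cos_ge_half x : `|x| <= 1 -> 1 / 2 <= cos x.
Proof.
move=> x1; have -> : x = (x / 2) *+ 2 by rewrite -mulr_natr; field.
rewrite cos_mulr2n -(mulr_natr (cos _ ^+ 2)); have := cos2Dsin2 (x / 2).
have : `|sin (x / 2)| <= 1 / 2.
  by rewrite (le_trans (sin_norm_le _)) // normrM (ger0_norm (x := 2^-1)) ?invr_ge0 //; lra.
rewrite ler_norml => /andP[h1 h2].
have : sin (x / 2) ^+ 2 <= 1 / 4 by rewrite expr2; nra.
nra.
Qed.

Lemma sin_ge_half x : 0 <= x <= 1 -> x / 2 <= sin x.
Proof.
move=> /andP[x0 x1].
have hs t : is_derive t 1 sin (cos t) by exact: is_derive_sin.
have := derive_ge (k := 1 / 2) x0 hs; rewrite sin0 !subr0.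
move=> H; suff : 1 / 2 * x <= sin x by lra.
apply: H => t /andP[t0 tx]; apply: cos_ge_half.
by rewrite ger0_norm //; lra.
Qed.

(** The double angle formula carries [sin_ge_half] past pi / 2. The range [0, 2] is that of the
    half-angles of arcs of angle at most 4. *)
Lemma sin_ge_quarter x : 0 <= x <= 2 -> x / 4 <= sin x.
Proof.
move=> /andP[x0 x2]; have -> : sin x = cos (x / 2) * sin (x / 2) *+ 2.
  by rewrite -sin_mulr2n -mulr_natr; congr sin; field.
rewrite mulr2n.
have : x / 2 / 2 <= sin (x / 2) by apply: sin_ge_half; lra.
have : 1 / 2 <= cos (x / 2) by apply: cos_ge_half; rewrite ger0_norm; lra.
nra.
Qed.

Lemma polar_angle (c s : R) : c ^+ 2 + s ^+ 2 = 1 ->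
  exists2 a, 0 <= a <= 2 * pi & c = cos a /\ s = sin a.
Proof.
move=> cs.
have c1 : -1 <= c <= 1 by apply/andP; split; nra.
have [/andP[a0 api] ca] := acos_def c1.
have sa : s ^+ 2 = sin (acos c) ^+ 2.
  by have := cos2Dsin2 (acos c); rewrite ca; lra.
have sa0 : 0 <= sin (acos c) by rewrite sin_ge0_pi // a0.
have pi0 := pi_ge0 R.
have [s0|s0] := leP 0 s.
  exists (acos c); first lra.
  split => //; apply/eqP; rewrite -(@eqrXn2 _ 2) //.
  exact/eqP.
exists (- acos c + pi *+ 2); first by rewrite mulr2n; lra.
have [-> ->] : cos (- acos c + pi *+ 2) = cos (acos c)
    /\ sin (- acos c + pi *+ 2) = - sin (acos c).
  by rewrite (cosD (- _)) (sinD (- _)) cos2pi (sin_mulr2n pi) sinpi cosN sinN; split; ring.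
rewrite ca; split => //; apply/eqP.
rewrite -eqr_oppLR -(@eqrXn2 _ 2) //; last lra.
by rewrite sqrrN; apply/eqP.
Qed.

(** An arc of angle [w * h] run at unit speed has a chord of length 2 sin (w h / 2) / w, which is at
    least h / 4 as long as [w * h <= 4]; the velocity error costs at most [2 * k] per unit of time.
    Since 4 > pi, arcs slightly longer than half a turn are covered. *)
Lemma chord_lower_bound (F1 F2 d1 d2 : R -> R) (w al k s h : R) :
  (forall t, is_derive t 1 F1 (d1 t)) -> (forall t, is_derive t 1 F2 (d2 t)) ->
  0 < w -> 0 <= h -> w * h <= 4 ->
  (forall t, s <= t <= s + h -> `|d1 t - cos (w * t + al)| <= k) ->
  (forall t, s <= t <= s + h -> `|d2 t - sin (w * t + al)| <= k) ->
  h * (1 / 4 - 2 * k) <= `|F1 (s + h) - F1 s| + `|F2 (s + h) - F2 s|.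
Proof.
move=> hF1 hF2 w0 h0 wh hd1 hd2.
(* Project on the direction of the velocity halfway along the arc. *)
pose psi := w * s + al + w * h / 2; set c := cos psi; set e := sin psi.
have c1 : `|c| <= 1 by rewrite ler_norml cos_geN1 cos_le1.
have e1 : `|e| <= 1 by rewrite ler_norml sin_geN1 sin_le1.
(* [G] subtracts the projection of the ideal motion; its derivative is at least - 2 k on the arc. *)
pose G t := c * F1 t + e * F2 t - w^-1 * sin (w * t + (al - psi)).
have hG (t : R) : is_derive t 1 G
    (c * d1 t + e * d2 t - w^-1 * (w * cos (w * t + (al - psi)))).
  exact: (is_derive_subE (is_derive_addE (is_derive_scaleE c (hF1 t))
    (is_derive_scaleE e (hF2 t))) (is_derive_scaleE _ (is_derive_sin_affine _ _ t))).
have ss : s <= s + h by lra.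
have prodk (x y z : R) : `|x| <= 1 -> `|y - z| <= k -> x * z - k <= x * y.
  move=> x1 yz; suff : `|x * (y - z)| <= k.
    by rewrite ler_norml => /andP[? _]; lra.
  rewrite normrM; have := normr_ge0 (y - z); have := normr_ge0 x; nra.
have := derive_ge (k := - (2 * k)) ss hG.
have -> : s + h - s = h by ring.
rewrite /G => H.
have {}H : - (2 * k) * h <= c * F1 (s + h) + e * F2 (s + h) -
    w^-1 * sin (w * (s + h) + (al - psi)) -
    (c * F1 s + e * F2 s - w^-1 * sin (w * s + (al - psi))).
  apply: H => t st; rewrite mulKf ?gt_eqF // addrA cosB -/c -/e.
  have := prodk _ _ _ c1 (hd1 t st); have := prodk _ _ _ e1 (hd2 t st); lra.
have E1 : w * (s + h) + (al - psi) = w * h / 2 by rewrite /psi; field.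
have E2 : w * s + (al - psi) = - (w * h / 2) by rewrite /psi; field.
rewrite E1 E2 sinN in H.
have S : w * h / 2 / 4 <= sin (w * h / 2).
  by apply: sin_ge_quarter; apply/andP; split; nra.
have {}S : h / 8 <= w^-1 * sin (w * h / 2).
  rewrite -(ler_pM2l w0) mulVKf ?gt_eqF //; lra.
have le1 (x y : R) : `|x| <= 1 -> x * y <= `|y|.
  move=> x1; rewrite (le_trans (ler_norm _)) // normrM.
  by have := normr_ge0 y; have := normr_ge0 x; nra.
have := le1 _ (F1 (s + h) - F1 s) c1; have := le1 _ (F2 (s + h) - F2 s) e1.
lra.
Qed.

Lemma rotation_estimate (p q dp dq : R -> R) (w k W : R) :
  (forall t, is_derive t 1 p (dp t)) -> (forall t, is_derive t 1 q (dq t)) ->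
  p 0 = 1 -> q 0 = 0 ->
  (forall t, 0 <= t <= W -> `|dp t + w * q t| <= k) ->
  (forall t, 0 <= t <= W -> `|dq t - w * p t| <= k) ->
  forall t, 0 <= t <= W ->
    `|p t - cos (w * t)| <= 4 * k * W /\ `|q t - sin (w * t)| <= 4 * k * W.
Proof.
move=> hp hq p0 q0 hk1 hk2 t /andP[t0 tW].
have k0 : 0 <= k by rewrite (le_trans _ (hk1 0 _)) //; lra.
(* In the frame rotating with frequency [w], [(p, q)] has speed at most [2 k]. *)
pose c s := cos (w * s + 0); pose e s := sin (w * s + 0).
have c1 s : `|c s| <= 1 by rewrite ler_norml cos_geN1 cos_le1.
have e1 s : `|e s| <= 1 by rewrite ler_norml sin_geN1 sin_le1.
have hP (s : R) : is_derive s 1 (fun s => p s * c s + q s * e s)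
    (dp s * c s + p s * - (w * e s) + (dq s * e s + q s * (w * c s))).
  apply: is_derive_addE; apply: is_derive_mulE => //.
    exact: is_derive_cos_affine.
  exact: is_derive_sin_affine.
have hQ (s : R) : is_derive s 1 (fun s => q s * c s - p s * e s)
    (dq s * c s + q s * - (w * e s) - (dp s * e s + p s * (w * c s))).
  apply: is_derive_subE; apply: is_derive_mulE => //.
    exact: is_derive_cos_affine.
  exact: is_derive_sin_affine.
have le1 (x y z : R) : `|x| <= 1 -> `|y| <= z -> `|x * y| <= z.
  move=> x1 yz; rewrite normrM.
  by have := normr_ge0 y; have := normr_ge0 x; nra.
have P1 := derive_norm_le (k := 2 * k) t0 hP.
have Q1 := derive_norm_le (k := 2 * k) t0 hQ.
have c0 : c 0 = 1 by rewrite /c mulr0 addr0 cos0.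
have e0 : e 0 = 0 by rewrite /e mulr0 addr0 sin0.
rewrite p0 q0 c0 e0 !(mulr0, mul0r, mulr1, addr0, subr0) in P1 Q1.
have {}P1 : `|p t * c t + q t * e t - 1| <= 2 * k * W.
  apply: (le_trans (P1 _)); last nra.
  move=> s /andP[s0 st]; have sW : 0 <= s <= W by lra.
  have -> : dp s * c s + p s * - (w * e s) + (dq s * e s + q s * (w * c s)) =
    c s * (dp s + w * q s) + e s * (dq s - w * p s) by ring.
  rewrite (le_trans (ler_normD _ _)) //.
  have := le1 _ _ _ (c1 s) (hk1 s sW); have := le1 _ _ _ (e1 s) (hk2 s sW).
  lra.
have {}Q1 : `|q t * c t - p t * e t| <= 2 * k * W.
  apply: (le_trans (Q1 _)); last nra.
  move=> s /andP[s0 st]; have sW : 0 <= s <= W by lra.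
  have -> : dq s * c s + q s * - (w * e s) - (dp s * e s + p s * (w * c s)) =
    c s * (dq s - w * p s) - e s * (dp s + w * q s) by ring.
  rewrite (le_trans (ler_normB _ _)) //.
  have := le1 _ _ _ (e1 s) (hk1 s sW); have := le1 _ _ _ (c1 s) (hk2 s sW).
  lra.
have <- : c t = cos (w * t) by rewrite /c addr0.
have <- : e t = sin (w * t) by rewrite /e addr0.
have ce : c t ^+ 2 + e t ^+ 2 = 1 by exact: cos2Dsin2.
(* Rotating back mixes the two errors of size [2 * k * W], whence [4 * k * W]. *)
split.
  have -> : p t - c t = c t * (p t * c t + q t * e t - 1)
      - e t * (q t * c t - p t * e t).
    have -> : p t - c t = p t * (c t ^+ 2 + e t ^+ 2) - c t by rewrite ce mulr1.
    by ring.
  rewrite (le_trans (ler_normB _ _)) //.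
  have := le1 _ _ _ (c1 t) P1; have := le1 _ _ _ (e1 t) Q1; lra.
have -> : q t - e t = e t * (p t * c t + q t * e t - 1)
    + c t * (q t * c t - p t * e t).
  have -> : q t - e t = q t * (c t ^+ 2 + e t ^+ 2) - e t by rewrite ce mulr1.
  by ring.
rewrite (le_trans (ler_normD _ _)) //.
have := le1 _ _ _ (e1 t) P1; have := le1 _ _ _ (c1 t) Q1; lra.
Qed.

Lemma dominated_continuous (f g : R -> R) (K : R) : continuous g ->
  (forall s t, `|f s - f t| <= K * `|g s - g t|) -> continuous f.
Proof.
move=> cg fg t; apply/cvgrPdist_le => eps e0.
have K1 : 0 < `|K| + 1 by rewrite ltr_wpDl.
have /cvgrPdist_le/(_ (eps / (`|K| + 1))) := cg t.
rewrite divr_gt0 // => /(_ isT); apply: filterS => s.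
rewrite ler_pdivlMr // => H.
rewrite (le_trans (fg _ _)) // (le_trans _ H) // mulrC ler_wpM2l //.
by rewrite (le_trans (ler_norm _)) // lerDl.
Qed.

(** The retraction of the line onto [s1, s2]. It turns a time known only for parameters in [s1, s2]
    into a continuous function on all of R, as [choice] and [intermediate_value] require. *)
Definition clamp (s1 s2 s : R) : R :=
  if s <= s1 then s1 else if s <= s2 then s else s2.

Lemma clamp_lipschitz (s1 s2 s t : R) : s1 <= s2 ->
  `|clamp s1 s2 s - clamp s1 s2 t| <= 1 * `|s - t|.
Proof.
move=> s12; rewrite mul1r; wlog st : s t / s <= t => [H|].
  have [/H //|/ltW ts] := leP s t.
  by rewrite [leLHS]distrC [leRHS]distrC H.
rewrite [leLHS]distrC [leRHS]distrC !ger0_norm ?subr_ge0 // /clamp.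
  by case: (leP t s1); case: (leP s s1); case: (leP t s2); case: (leP s s2); lra.
by case: (leP t s1); case: (leP s s1); case: (leP t s2); case: (leP s s2); lra.
Qed.

(** The first curve is a graph over its first coordinate that falls at the left end and climbs at
    the right end; the second one is ahead of it by [lo] to [hi]. The first reaches the abscissa of
    the second after a delay of at least [lo / 2] (speed at most 2) and at most [h] (speed at least
    1 / 4, and [4 * hi <= h]). During this delay its ordinate changes by at least
    [c * (lo / 2) > be], downwards at one end and upwards at the other. *)
Lemma graphs_cross (a1 b1 a2 b2 da db : R -> R) (s1 s2 h c lo hi be : R) :
  (forall t, is_derive t 1 a1 (da t)) -> (forall t, is_derive t 1 b1 (db t)) ->
  continuous a2 -> continuous b2 ->
  s1 <= s2 -> 0 <= h -> 0 <= c -> 0 <= lo -> be < c * (lo / 2) ->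
  4 * hi <= h ->
  (forall t, s1 <= t <= s2 + h -> 1 / 4 <= da t) ->
  (forall t, s1 <= t <= s2 + h -> da t <= 2) ->
  (forall t, s1 <= t <= s1 + h -> db t <= - c) ->
  (forall t, s2 <= t <= s2 + h -> c <= db t) ->
  (forall t, s1 <= t <= s2 -> lo <= a2 t - a1 t <= hi) ->
  (forall t, s1 <= t <= s2 -> `|b2 t - b1 t| <= be) ->
  exists s t, [/\ s1 <= s <= s2, s <= t <= s + h, a1 t = a2 s & b1 t = b2 s].
Proof.
move=> ha hb ca2 cb2 s12 h0 c0 lo0 bec hih hda hda' hdb1 hdb2 hA hB.
have ca1 := is_derive_continuous ha; have cb1 := is_derive_continuous hb.
have exT s : s1 <= s <= s2 -> exists t, s <= t <= s + h /\ a1 t = a2 s.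
  move=> ss; have /andP[A1 A2] := hA s ss; have sh : s <= s + h by lra.
  have := derive_ge (k := 1 / 4) sh ha.
  have -> : s + h - s = h by ring.
  move=> H; have {}H : 1 / 4 * h <= a1 (s + h) - a1 s.
    by apply: H => t ?; apply: hda; lra.
  by have [|t ? ?] := intermediate_value (v := a2 s) sh ca1; [lra|exists t].
(* [th s] is the time at which the first curve has the abscissa of the second
   curve at time [s]; the difference of the ordinates changes sign. *)
pose cl s : R := clamp s1 s2 s.
have clP s : s1 <= cl s <= s2.
  by rewrite /cl /clamp; case: (leP s s1); [|case: (leP s s2)]; lra.
have cl_id s : s1 <= s <= s2 -> cl s = s.
  by rewrite /cl /clamp; case: (leP s s1); [|case: (leP s s2)]; lra.
have cl_lip s t : `|cl s - cl t| <= 1 * `|s - t| by exact: clamp_lipschitz.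
have ccl : continuous cl by apply: dominated_continuous cl_lip => t; exact: cvg_id.
have [th thP] := choice (fun s => exT (cl s) (clP s)).
have cth : continuous th.
  (* The constant 4 is the inverse of the least slope 1 / 4 of [a1]. *)
  apply: (@dominated_continuous _ (a2 \o cl) 4).
    by move=> t; apply: continuous_comp; [exact: ccl|exact: ca2].
  move=> s t; wlog st : s t / th s <= th t => [H|].
    have [/H //|/ltW ts] := leP (th s) (th t).
    by rewrite distrC (distrC ((a2 \o cl) s)) H.
  rewrite /= -(thP s).2 -(thP t).2.
  have := derive_ge (k := 1 / 4) st ha => H.
  have {}H : 1 / 4 * (th t - th s) <= a1 (th t) - a1 (th s).
    apply: H => u /andP[u1 u2].
    have [/andP[s3 s4] _] := thP s; have [/andP[t3 t4] _] := thP t.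
    by have := clP s; have := clP t => ? ?; apply: hda; lra.
  rewrite ler0_norm; last lra.
  rewrite distrC ger0_norm; lra.
pose H s := b1 (th s) - b2 (cl s).
have cH : continuous H.
  move=> t; apply: cvgB.
    by apply: continuous_comp; [exact: cth|exact: cb1].
  by apply: continuous_comp; [exact: ccl|exact: cb2].
have far s : s1 <= s <= s2 -> lo / 2 <= th s - s /\ th s <= s + h /\ s <= th s.
  move=> ss; have [] := thP s; rewrite cl_id // => /andP[t1 t2] E.
  have := derive_le (k := 2) t1 ha => D; have {}D : a1 (th s) - a1 s <= 2 * (th s - s).
    by apply: D => u ?; apply: hda'; lra.
  have /andP[] := hA s ss; rewrite -E; lra.
have H1 : H s1 <= 0.
  have ss : s1 <= s1 <= s2 by lra.
  have [f1 [f2 f3]] := far s1 ss; rewrite /H cl_id //.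
  have D := derive_le (k := - c) f3 hb.
  have {}D : b1 (th s1) - b1 s1 <= - c * (th s1 - s1) by apply: D => u ?; apply: hdb1; lra.
  have := hB s1 ss; rewrite ler_norml => /andP[]; nra.
have H2 : 0 <= H s2.
  have ss : s1 <= s2 <= s2 by lra.
  have [f1 [f2 f3]] := far s2 ss; rewrite /H cl_id //.
  have D := derive_ge (k := c) f3 hb.
  have {}D : c * (th s2 - s2) <= b1 (th s2) - b1 s2 by apply: D => u ?; apply: hdb2; lra.
  have := hB s2 ss; rewrite ler_norml => /andP[]; nra.
have [|s ss Hs] := intermediate_value (v := 0) s12 cH; first by rewrite H1 H2.
have [] := thP s; rewrite cl_id // => ts E.
exists s, (th s); split => //.
by apply/eqP; rewrite -subr_eq0 -[in X in _ - X](cl_id s) //; apply/eqP.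
Qed.

(** Near the time [phi] the velocity has the direction [al] of the displacement, so the ordinate
    across this direction has a minimum there, and two copies of such a valley shifted along the
    axis cross. [hcos] and [hsin] state that [al] and [w * phi] agree modulo 2 pi. Over angles from
    - 1 / 4 to 3 / 8 the slopes of the circle leave room for the error [2 * k <= 1 / 32];
    [64 * w * de <= 1] becomes the condition [4 * hi <= h] of [graphs_cross]. The bounds on |s -
    phi| and |t - phi| later tell the crossings of different turns apart. *)
Lemma displaced_arcs_cross (z1 z2 d1 d2 Z1 Z2 : R -> R) (w al phi k de ka : R) :
  (forall t, is_derive t 1 z1 (d1 t)) -> (forall t, is_derive t 1 z2 (d2 t)) ->
  continuous Z1 -> continuous Z2 ->
  0 < w -> 0 < de -> 64 * w * de <= 1 -> k <= 1 / 64 -> 32 * (32 * ka) <= 1 ->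
  (forall t, cos (w * t - al) = cos (w * (t - phi))) ->
  (forall t, sin (w * t - al) = sin (w * (t - phi))) ->
  (forall t, `|t - phi| <= w^-1 ->
    [/\ `|d1 t - cos (w * t)| <= k, `|d2 t - sin (w * t)| <= k,
        `|Z1 t - z1 t - de * cos al| <= ka * de
      & `|Z2 t - z2 t - de * sin al| <= ka * de]) ->
  exists s t, [/\ `|s - phi| <= w^-1 / 2, `|t - phi| <= w^-1 / 2,
    z1 t = Z1 s & z2 t = Z2 s].
Proof.
move=> hz1 hz2 cZ1 cZ2 w0 de0 wde hk hka hcos hsin hyp.
set c := cos al; set e := sin al; set v := w^-1.
have kde : 32 * (32 * (ka * de)) <= de.
  by rewrite -[leRHS]mul1r [leLHS](_ : _ = 32 * (32 * ka) * de) ?ler_pM2r //; ring.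
move: hka => _.
have v0 : 0 < v by rewrite invr_gt0.
have wv : w * v = 1 by rewrite mulfV ?gt_eqF.
have c1 : `|c| <= 1 by rewrite ler_norml cos_geN1 cos_le1.
have e1 : `|e| <= 1 by rewrite ler_norml sin_geN1 sin_le1.
have ce : c ^+ 2 + e ^+ 2 = 1 by exact: cos2Dsin2.
have le1 (x y z : R) : `|x| <= 1 -> `|y| <= z -> `|x * y| <= z.
  move=> x1 yz; rewrite normrM.
  by have := normr_ge0 y; have := normr_ge0 x; nra.
have comb (x y z u1 u2 z0 z3 : R) : `|x| <= 1 -> `|y| <= 1 -> `|u1 - z0| <= z ->
    `|u2 - z3| <= z -> `|x * u1 + y * u2 - (x * z0 + y * z3)| <= 2 * z.
  move=> x1 y1 h1 h2.
  have -> : x * u1 + y * u2 - (x * z0 + y * z3) = x * (u1 - z0) + y * (u2 - z3).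
    by ring.
  rewrite (le_trans (ler_normD _ _)) //.
  by have := le1 _ _ _ x1 h1; have := le1 _ _ _ y1 h2; lra.
have comb2 (x z : R) : `|x| <= z -> - z <= x <= z by rewrite ler_norml.
(* In axes rotated by [al] the displacement is horizontal, and so is, almost, the
   velocity near the time [phi]. *)
have [] := @graphs_cross (fun t => c * z1 t + e * z2 t)
  (fun t => - e * z1 t + c * z2 t)
  (fun t => c * Z1 t + e * Z2 t) (fun t => - e * Z1 t + c * Z2 t)
  (fun t => c * d1 t + e * d2 t) (fun t => - e * d1 t + c * d2 t)
  (phi - v / 4) (phi + v / 4) (v / 8) (1 / 32) (de / 2) (2 * de) (2 * (ka * de)).
- by move=> t; apply: cvgD; apply: cvgMr; [exact: cZ1|exact: cZ2].
- by move=> t; apply: cvgD; apply: cvgMr; [exact: cZ1|exact: cZ2].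
- lra.
- lra.
- lra.
- lra.
- lra.
- rewrite -(ler_pM2l w0); nra.
- move=> t ht.
  have tv : `|t - phi| <= v by rewrite ler_norml; lra.
  have [h1 h2 _ _] := hyp t tv.
  have := comb2 _ _ (comb c e k _ _ _ _ c1 e1 h1 h2).
  have : 1 / 2 <= cos (w * t - al).
    by rewrite hcos; apply: cos_ge_half; rewrite normrM gtr0_norm //
      -[leRHS]wv ler_pM2l.
  rewrite cosB -/c -/e; lra.
- move=> t ht.
  have tv : `|t - phi| <= v by rewrite ler_norml; lra.
  have [h1 h2 _ _] := hyp t tv.
  have := comb2 _ _ (comb c e k _ _ _ _ c1 e1 h1 h2).
  have := cos_le1 (w * t - al).
  rewrite cosB -/c -/e; lra.
- move=> t ht.
  have tv : `|t - phi| <= v by rewrite ler_norml; lra.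
  have [h1 h2 _ _] := hyp t tv; have Ne1 : `|- e| <= 1 by rewrite normrN.
  have := comb2 _ _ (comb (- e) c k _ _ _ _ Ne1 c1 h1 h2).
  have : 1 / 16 <= - sin (w * t - al).
    rewrite hsin -sinN; apply: le_trans (sin_ge_half _); first nra.
    apply/andP; split; nra.
  rewrite sinB -/c -/e; lra.
- move=> t ht.
  have tv : `|t - phi| <= v by rewrite ler_norml; lra.
  have [h1 h2 _ _] := hyp t tv; have Ne1 : `|- e| <= 1 by rewrite normrN.
  have := comb2 _ _ (comb (- e) c k _ _ _ _ Ne1 c1 h1 h2).
  have : 1 / 8 <= sin (w * t - al).
    rewrite hsin; apply: le_trans (sin_ge_half _); first nra.
    apply/andP; split; nra.
  rewrite sinB -/c -/e; lra.
- move=> t ht.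
  have tv : `|t - phi| <= v by rewrite ler_norml; lra.
  have [_ _ h1 h2] := hyp t tv.
  have := comb2 _ _ (comb c e (ka * de) _ _ _ _ c1 e1 h1 h2).
  have -> : c * (de * cos al) + e * (de * sin al) = de * (c ^+ 2 + e ^+ 2).
    by rewrite /c /e; ring.
  rewrite ce mulr1 => /andP[? ?].
  lra.
- move=> t ht.
  have tv : `|t - phi| <= v by rewrite ler_norml; lra.
  have [_ _ h1 h2] := hyp t tv; have Ne1 : `|- e| <= 1 by rewrite normrN.
  have := comb (- e) c (ka * de) _ _ _ _ Ne1 c1 h1 h2.
  have -> : - e * (de * cos al) + c * (de * sin al) = 0 by rewrite /c /e; ring.
  rewrite subr0 => H; apply: le_trans H.
  by rewrite le_eqVlt; apply/orP; left; apply/eqP; congr (`|_|); ring.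
move=> s [t [s12 st E1 E2]]; exists s, t; split.
- rewrite ler_norml; lra.
- rewrite ler_norml; lra.
- have -> : z1 t = (c ^+ 2 + e ^+ 2) * z1 t by rewrite ce mul1r.
  have -> : Z1 s = (c ^+ 2 + e ^+ 2) * Z1 s by rewrite ce mul1r.
  transitivity (c * (c * z1 t + e * z2 t) - e * (- e * z1 t + c * z2 t)).
    by ring.
  by rewrite E1 E2; ring.
- have -> : z2 t = (c ^+ 2 + e ^+ 2) * z2 t by rewrite ce mul1r.
  have -> : Z2 s = (c ^+ 2 + e ^+ 2) * Z2 s by rewrite ce mul1r.
  transitivity (e * (c * z1 t + e * z2 t) + c * (- e * z1 t + c * z2 t)).
    by ring.
  by rewrite E1 E2; ring.
Qed.

End Calculus.

(** * Vectors of R^3 with the sup norm *)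

Section Vectors.
Variable R : realType.
Notation V := 'rV[R]_3.
Implicit Types (u v : V) (c : R).

Lemma norm_coord_le v (i : 'I_3) : `|v 0 i| <= `|v|.
Proof.
rewrite [X in _ <= X]mx_normrE.
exact: (le_bigmax _ (fun ij : 'I_1 * 'I_3 => `|v ij.1 ij.2|) (0, i)).
Qed.

Lemma norm_le_coord v c : (forall i, `|v 0 i| <= c) -> `|v| <= c.
Proof.
move=> vc; rewrite [X in X <= _]mx_normrE; apply/bigmax_leP; split => [|[i j] _].
  exact: le_trans (normr_ge0 _) (vc 0).
by rewrite /= ord1.
Qed.

Lemma dotE u v : dot u v = u 0 0 * v 0 0 + u 0 1 * v 0 1 + u 0 (2%:R) * v 0 (2%:R).
Proof.
rewrite /dot !big_ord_recl big_ord0 addr0 addrA.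
by congr (_ * _ + _ * _ + _ * _); congr fun_of_matrix; apply/val_inj.
Qed.

Lemma dotC u v : dot u v = dot v u.
Proof. by apply: eq_bigr => i _; rewrite mulrC. Qed.

Lemma dotDr u v w : dot u (v + w) = dot u v + dot u w.
Proof. by rewrite -big_split; apply: eq_bigr => i _; rewrite mxE mulrDr. Qed.

Lemma dotNr u v : dot u (- v) = - dot u v.
Proof. by rewrite -sumrN; apply: eq_bigr => i _; rewrite mxE mulrN. Qed.

Lemma dotBr u v w : dot u (v - w) = dot u v - dot u w.
Proof. by rewrite dotDr dotNr. Qed.

Lemma dotZr c u v : dot u (c *: v) = c * dot u v.
Proof. by rewrite mulr_sumr; apply: eq_bigr => i _; rewrite mxE mulrCA. Qed.

Lemma dotDl u v w : dot (u + v) w = dot u w + dot v w.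
Proof. by rewrite dotC dotDr !(dotC w). Qed.

Lemma dotNl u v : dot (- u) v = - dot u v.
Proof. by rewrite dotC dotNr dotC. Qed.

Lemma dotBl u v w : dot (u - v) w = dot u w - dot v w.
Proof. by rewrite dotDl dotNl. Qed.

Lemma dotZl c u v : dot (c *: u) v = c * dot u v.
Proof. by rewrite dotC dotZr dotC. Qed.

(** The factor 3 is the number of coordinates, the norm being the sup norm. *)
Lemma dot_norm_le u v : `|dot u v| <= 3 * `|u| * `|v|.
Proof.
rewrite dotE; have h i : `|u 0 i * v 0 i| <= `|u| * `|v|.
  by rewrite normrM ler_pM // norm_coord_le.
rewrite (le_trans (ler_normD _ _)) // (le_trans (lerD (ler_normD _ _) (lexx _))) //.
have := h 0; have := h 1; have := h 2%:R; lra.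
Qed.

Lemma is_derive_dot u (f df : R -> V) (t : R) :
  (forall i, is_derive t 1 (fun s => f s 0 i) (df t 0 i)) ->
  is_derive t 1 (fun s => dot u (f s)) (dot u (df t)).
Proof.
move=> hf.
have -> : (fun s => dot u (f s)) =
    \sum_(i < 3) (fun s : R => u 0 i * f s 0 i).
  by apply/funext => s; rewrite fct_sumE.
by apply: is_derive_sum => i; exact: is_derive_scaleE.
Qed.

Lemma vector_derive_norm_le (f df : R -> V) (a b k : R) : a <= b ->
  (forall (t : R) i, is_derive t 1 (fun s => f s 0 i) (df t 0 i)) ->
  (forall t, a <= t <= b -> `|df t| <= k) -> `|f b - f a| <= k * (b - a).
Proof.
move=> ab hf hk; apply: norm_le_coord => i; rewrite !mxE.
apply: (derive_norm_le ab (fun t => hf t i)) => t tab.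
exact: le_trans (norm_coord_le _ _) (hk t tab).
Qed.

End Vectors.

(** * Motions close to a uniform rotation *)

(* [x] is a curve on the sphere with rescaled velocity [u]: [x' = m u] and
   [u' = du].  The linear forms [a] and [b] are coordinates in the tangent plane
   at [x 0], adapted to [u 0], in which the force is [w] times the rotation by a
   right angle, up to [O(|x t - x 0| + m)]. *)
Record larmor_trajectory (R : realType) (C w m : R) (x u du : R -> 'rV[R]_3)
    (a b : 'rV[R]_3) : Prop := LarmorTrajectory {
  traj_C : 1 <= C;
  traj_wlo : C^-1 <= w;
  traj_whi : w <= C;
  traj_m0 : 0 < m;
  traj_m1 : m <= 1;
  traj_x : forall (t : R) i, is_derive t 1 (fun s => x s 0 i) (m * u t 0 i);
  traj_u : forall (t : R) i, is_derive t 1 (fun s => u s 0 i) (du t 0 i);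
  traj_unorm : forall t, `|u t| <= C;
  traj_dunorm : forall t, `|du t| <= C;
  traj_lip : forall s t, `|du s - du t| <= C * (`|x s - x t| + `|u s - u t|);
  traj_sphere : forall t, dot (x t) (x t) = 1;
  traj_a : forall v, `|dot a v| <= C * `|v|;
  traj_b : forall v, `|dot b v| <= C * `|v|;
  traj_a0 : dot a (u 0) = 1;
  traj_b0 : dot b (u 0) = 0;
  traj_frame : forall v, `|v| <= C * (`|dot a v| + `|dot b v| + `|dot v (x 0)|);
  traj_rota : forall t, `|dot a (du t) + w * dot b (u t)| <= C * (`|x t - x 0| + m);
  traj_rotb : forall t, `|dot b (du t) - w * dot a (u t)| <= C * (`|x t - x 0| + m);
  traj_ret : forall t, dot b (u t) = 0 -> 0 < dot a (u t) ->
    `|u t - u 0| <= C * `|x t - x 0|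
}.

Section LarmorTrajectory.
Variables (R : realType) (C w m : R) (x u du : R -> 'rV[R]_3) (a b : 'rV[R]_3).
Hypothesis L : larmor_trajectory C w m x u du a b.
Variable W : R.
(** The window holds at least one turn: a turn has angle at most 2 pi + 1 <= 9, hence takes time at
    most 9 / w <= 9 C. *)
Hypothesis W_large : 9 * C <= W.

Let C1 := traj_C L.
Let m0 := traj_m0 L.

(** [m * rotation_error] is the bound [4 * k * W] of [rotation_estimate] for
    [k = C * (m * C * W + m)], since the curve moves by at most [m * C * W] in the window. *)
Definition rotation_error : R := 4 * C * (C * W + 1) * W.
Notation K := rotation_error.

Lemma larmor_Cgt0 : 0 < C. Proof. by have := C1; lra. Qed.
Let C0 := larmor_Cgt0.

Lemma larmor_wgt0 : 0 < w.
Proof. by apply: lt_le_trans (traj_wlo L); rewrite invr_gt0 C0. Qed.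
Let w0 := larmor_wgt0.

Lemma larmor_wV : w^-1 <= C.
Proof. by rewrite -[leRHS]invrK lef_pV2 ?posrE ?invr_gt0 ?C0 ?w0 // (traj_wlo L). Qed.

Lemma larmor_Wgt0 : 0 < W. Proof. by have := C1; have := W_large; lra. Qed.
Let W0 := larmor_Wgt0.

Lemma larmor_Kgt0 : 0 < K.
Proof.
have CW : 0 < C * W by rewrite mulr_gt0 ?C0 ?W0.
rewrite /rotation_error !mulr_gt0 ?C0 ?W0 //; lra.
Qed.
Let K0 := larmor_Kgt0.

Lemma larmor_mCge0 : 0 <= m * C.
Proof. by apply: mulr_ge0; apply: ltW; [exact: m0|exact: C0]. Qed.
Let mC0 := larmor_mCge0.

Lemma larmor_position (s t : R) : s <= t -> `|x t - x s| <= m * C * (t - s).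
Proof.
move=> st; apply: (@vector_derive_norm_le _ x (fun t => m *: u t)) => // [r i|r _].
  by rewrite mxE; exact: traj_x L r i.
by rewrite normrZ gtr0_norm ?m0 // ler_pM2l ?m0 // (traj_unorm L).
Qed.

Lemma larmor_dot_x v (t : R) : is_derive t 1 (fun s => dot v (x s)) (m * dot v (u t)).
Proof.
rewrite -dotZr; apply: (@is_derive_dot _ v x (fun t => m *: u t)) => i.
by rewrite mxE; exact: traj_x L t i.
Qed.

Lemma larmor_dot_u v (t : R) : is_derive t 1 (fun s => dot v (u s)) (dot v (du t)).
Proof. by apply: (@is_derive_dot _ v u du) => i; exact: traj_u L t i. Qed.

Lemma larmor_rotation (t : R) : 0 <= t <= W ->
  `|dot a (u t) - cos (w * t)| <= m * K /\ `|dot b (u t) - sin (w * t)| <= m * K.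
Proof.
have -> : m * K = 4 * (C * (m * C * W + m)) * W by rewrite /rotation_error; ring.
have near0 s : 0 <= s <= W -> C * (`|x s - x 0| + m) <= C * (m * C * W + m).
  move=> /andP[s0 sW]; rewrite ler_pM2l ?C0 // lerD2r.
  apply: le_trans (larmor_position s0) _.
  by rewrite subr0 ler_wpM2l // mC0.
apply: (rotation_estimate (larmor_dot_u a) (larmor_dot_u b)).
- exact: traj_a0 L.
- exact: traj_b0 L.
- by move=> s sW; apply: le_trans (traj_rota L s) (near0 s sW).
- by move=> s sW; apply: le_trans (traj_rotb L s) (near0 s sW).
Qed.

Hypothesis mK : m * K <= 1 / 64.

(** The rescaled coordinates [dot a x / m] and [dot b x / m] have velocity close to (cos, sin), and
    [mK] keeps the factor 1 / 4 - 2 m K of [chord_lower_bound] positive. *)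
Lemma larmor_chord_x (s h : R) : 0 <= s -> 0 < h -> s + h <= W -> w * h <= 4 ->
  x (s + h) != x s.
Proof.
move=> s0 h0 sh wh; apply/eqP => E.
have dxm v (t : R) : is_derive t 1 (fun s => m^-1 * dot v (x s)) (dot v (u t)).
  by have := is_derive_scaleE m^-1 (larmor_dot_x v t); rewrite mulKf ?gt_eqF ?m0.
have B1 t : s <= t <= s + h -> `|dot a (u t) - cos (w * t + 0)| <= m * K.
  by move=> ?; rewrite addr0; apply: (larmor_rotation _).1; lra.
have B2 t : s <= t <= s + h -> `|dot b (u t) - sin (w * t + 0)| <= m * K.
  by move=> ?; rewrite addr0; apply: (larmor_rotation _).2; lra.
have := chord_lower_bound (dxm a) (dxm b) w0 (ltW h0) wh B1 B2.
rewrite E !subrr !normr0 addr0.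
by rewrite pmulr_rle0 //; move: mK; lra.
Qed.

(** The velocity too runs along an almost circular curve, with speed about [w]. Hence, up to half a
    turn, elapsed time is controlled by the change of velocity; this is how nearly equal velocities
    are converted into nearly equal times. *)
Lemma larmor_chord_u (s h : R) : 0 <= s -> 0 <= h -> s + h <= W -> w * h <= 4 ->
  h <= 16 * C ^+ 2 * `|u (s + h) - u s|.
Proof.
move=> s0 h0 sh wh.
have near0 t : 0 <= t <= W -> w^-1 * (C * (`|x t - x 0| + m)) <= m * K.
  move=> /andP[t0 tW].
  have := larmor_position t0; rewrite subr0 => H1.
  have H2 : m * C * t <= m * C * W by rewrite ler_wpM2l // mC0.
  have H3 : w^-1 * (C * (`|x t - x 0| + m)) <= C * (C * (m * C * W + m)).
    apply: ler_pM.
    - by rewrite invr_ge0 ltW ?w0.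
    - by rewrite mulr_ge0 ?addr_ge0 // ltW // ?m0 ?C0.
    - exact: larmor_wV.
    - by rewrite ler_pM2l ?C0 //; lra.
  apply: le_trans H3 _.
  have -> : C * (C * (m * C * W + m)) = (m * C * (C * W + 1)) * C by ring.
  have -> : m * K = (m * C * (C * W + 1)) * (4 * W).
    by rewrite /rotation_error; ring.
  apply: ler_wpM2l; last by have := W_large; have := C1; lra.
  apply: mulr_ge0; first exact: mC0.
  by rewrite addr_ge0 // mulr_ge0 // ltW // ?C0 ?W0.
have wm1 : w^-1 * w = 1 by rewrite mulVf // gt_eqF ?w0.
have dbu (t : R) := is_derive_scaleE w^-1 (larmor_dot_u b t).
have dau (t : R) := is_derive_scaleE (- w^-1) (larmor_dot_u a t).
have B1 t : s <= t <= s + h -> `|w^-1 * dot b (du t) - cos (w * t + 0)| <= 2 * (m * K).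
  move=> ht; rewrite addr0; have tW : 0 <= t <= W by lra.
  have -> : w^-1 * dot b (du t) - cos (w * t) =
      w^-1 * (dot b (du t) - w * dot a (u t)) + (dot a (u t) - cos (w * t)).
    by rewrite mulrBr mulrA wm1; ring.
  apply: le_trans (ler_normD _ _) _.
  have [h1 _] := larmor_rotation tW.
  rewrite normrM gtr0_norm ?invr_gt0 ?w0 //.
  have : w^-1 * `|dot b (du t) - w * dot a (u t)| <= m * K.
    apply: le_trans (near0 t tW); rewrite ler_pM2l ?invr_gt0 ?w0 //.
    exact: traj_rotb L t.
  lra.
have B2 t : s <= t <= s + h -> `|- w^-1 * dot a (du t) - sin (w * t + 0)| <= 2 * (m * K).
  move=> ht; rewrite addr0; have tW : 0 <= t <= W by lra.
  have -> : - w^-1 * dot a (du t) - sin (w * t) =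
      w^-1 * - (dot a (du t) + w * dot b (u t)) + (dot b (u t) - sin (w * t)).
    by rewrite mulrN mulrDr mulrA wm1; ring.
  apply: le_trans (ler_normD _ _) _.
  have [_ h1] := larmor_rotation tW.
  rewrite normrM normrN gtr0_norm ?invr_gt0 ?w0 //.
  have : w^-1 * `|dot a (du t) + w * dot b (u t)| <= m * K.
    apply: le_trans (near0 t tW); rewrite ler_pM2l ?invr_gt0 ?w0 //.
    exact: traj_rota L t.
  lra.
have H := chord_lower_bound dbu dau w0 h0 wh B1 B2.
rewrite -!mulrBr -!dotBr !normrM normrN (gtr0_norm (x := w^-1)) ?invr_gt0 ?w0 // in H.
have ha := traj_a L (u (s + h) - u s); have hb := traj_b L (u (s + h) - u s).
have H4 : w^-1 * `|dot b (u (s + h) - u s)| <= C * (C * `|u (s + h) - u s|).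
  by apply: ler_pM => //; [rewrite invr_ge0 ltW ?w0|exact: larmor_wV].
have H5 : w^-1 * `|dot a (u (s + h) - u s)| <= C * (C * `|u (s + h) - u s|).
  by apply: ler_pM => //; [rewrite invr_ge0 ltW ?w0|exact: larmor_wV].
have : h * (1 / 8) <= h * (1 / 4 - 2 * (2 * (m * K))).
  by apply: ler_wpM2l => //; move: mK; lra.
lra.
Qed.

Lemma larmor_return_time : exists tau, [/\ `|w * tau - 2 * pi| <= 4 * (m * K),
  0 < tau <= W & `|u tau - u 0| <= C * `|x tau - x 0|].
Proof.
have mK0 : 0 < m * K by rewrite mulr_gt0 ?m0 ?K0.
(* With this choice sin eta >= eta / 2 = 2 m K exceeds the rotation error m K, so [dot b (u t)]
   changes sign between the angles 2 pi - eta and 2 pi + eta. *)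
pose eta := 4 * (m * K).
have eta0 : 0 < eta <= 1 by rewrite /eta; move: mK mK0; lra.
have wV := larmor_wV; have wV0 : 0 < w^-1 by rewrite invr_gt0 w0.
have wwV y : w * (w^-1 * y) = y by rewrite mulVKf // gt_eqF ?w0.
have pi2 := pi_ge2 R; have pi4 : pi < 4 :> R.
  by have := pihalf_lt2 R; lra.
have time_le y : 0 < y -> y <= 2 * pi + eta -> 0 < w^-1 * y <= W.
  move=> y0 y1; rewrite mulr_gt0 //=.
  have y9 : y <= 9 by move: y1 pi4 eta0; lra.
  apply: le_trans W_large; rewrite mulrC; apply: ler_pM => //; exact: ltW.
have sin2pi y : sin (2 * pi + y) = sin y :> R.
  have -> : 2 * pi + y = y + pi *+ 2 by rewrite mulr2n; ring.
  by rewrite sinD cos2pi (sin_mulr2n pi) sinpi; ring.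
have cos2pi y : cos (2 * pi + y) = cos y :> R.
  have -> : 2 * pi + y = y + pi *+ 2 by rewrite mulr2n; ring.
  by rewrite cosD cos2pi (sin_mulr2n pi) sinpi; ring.
have sin_eta : eta / 2 <= sin eta by apply: sin_ge_half; move: eta0; lra.
pose t1 := w^-1 * (2 * pi - eta); pose t2 := w^-1 * (2 * pi + eta).
have t12 : t1 <= t2 by rewrite ler_pM2l //; move: eta0; lra.
have cq : continuous (fun t => dot b (u t)).
  exact: is_derive_continuous (larmor_dot_u b).
have [] := @intermediate_value _ _ t1 t2 0 t12 cq.
  have T1 : 0 <= t1 <= W by have /andP[/ltW -> ->] : 0 < t1 <= W by
    apply: time_le; move: eta0 pi2; lra.
  have T2 : 0 <= t2 <= W by have /andP[/ltW -> ->] : 0 < t2 <= W by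
    apply: time_le; move: eta0 pi2; lra.
  have [_] := larmor_rotation T1; have [_] := larmor_rotation T2.
  rewrite /t1 /t2 !wwV !sin2pi sinN !ler_norml.
  move: sin_eta mK0; rewrite /eta; lra.
move=> tau /andP[tau1 tau2] q0; exists tau.
have wt1 : 2 * pi - eta <= w * tau by rewrite -[leLHS]wwV ler_pM2l ?w0.
have wt2 : w * tau <= 2 * pi + eta by rewrite -[leRHS]wwV ler_pM2l ?w0.
have tauE : tau = w^-1 * (w * tau) by rewrite mulKf // gt_eqF ?w0.
have tauW : 0 < tau <= W.
  rewrite tauE; apply: time_le => //; move: wt1 eta0 pi2; lra.
split => //.
  by rewrite ler_norml -/eta; move: wt1 wt2; lra.
apply: (traj_ret L) => //.
have tauW' : 0 <= tau <= W by have /andP[/ltW -> ->] := tauW.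
have [] := larmor_rotation tauW'; rewrite ler_norml => h _.
have : 1 / 2 <= cos (w * tau).
  have -> : w * tau = 2 * pi + (w * tau - 2 * pi) by ring.
  rewrite cos2pi; apply: cos_ge_half.
  by rewrite ler_norml; move: wt1 wt2 eta0; lra.
move: h mK; lra.
Qed.

(** Gronwall's lemma is applied to [S], the sum of the squares of the coordinates, which is
    differentiable where the norm may fail to be; its rate 16 C is halved by the final square root.
    The initial value is at most 9 D^2. *)
Lemma larmor_shift_gronwall (tau t : R) : 0 <= t ->
  (`|x (t + tau) - x t| <= 3 * expR (8 * C * t) *
    (`|x tau - x 0| + `|u tau - u 0|)) /\
  (`|u (t + tau) - u t| <= 3 * expR (8 * C * t) *
    (`|x tau - x 0| + `|u tau - u 0|)).
Proof.
move=> t0.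
pose X i s := x (s + tau) 0 i - x s 0 i; pose U i s := u (s + tau) 0 i - u s 0 i.
have dX i (s : R) : is_derive s 1 (X i) (m * U i s).
  rewrite mulrBr; apply: is_derive_subE; last exact: traj_x L s i.
  exact: (@is_derive_shiftE _ (fun s => x s 0 i)) (traj_x L _ i).
have dU i (s : R) : is_derive s 1 (U i) (du (s + tau) 0 i - du s 0 i).
  apply: is_derive_subE; last exact: traj_u L s i.
  exact: (@is_derive_shiftE _ (fun s => u s 0 i)) (traj_u L _ i).
pose S s := \sum_i (X i s ^+ 2 + U i s ^+ 2).
pose dS s := \sum_i (2 * (X i s * (m * U i s)) +
   2 * (U i s * (du (s + tau) 0 i - du s 0 i))).
have hS (s : R) : is_derive s 1 S (dS s).
  have -> : S = \sum_i (fun s => X i s ^+ 2 + U i s ^+ 2).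
    by apply/funext => r; rewrite fct_sumE.
  apply: is_derive_sum => i; apply: is_derive_addE.
    apply: (is_derive_eq (is_derive_mulE (dX i s) (dX i s))); ring.
  apply: (is_derive_eq (is_derive_mulE (dU i s) (dU i s))); ring.
have S_ge i s : X i s ^+ 2 + U i s ^+ 2 <= S s.
  rewrite /S (bigD1 i) //= lerDl; apply: sumr_ge0 => j _.
  by rewrite addr_ge0 ?sqr_ge0.
have S0 s : 0 <= S s by apply: sumr_ge0 => j _; rewrite addr_ge0 ?sqr_ge0.
have rX i s : `|X i s| <= Num.sqrt (S s).
  rewrite -sqrtr_sqr ler_sqrt //; apply: le_trans (S_ge i s).
  by rewrite lerDl sqr_ge0.
have rU i s : `|U i s| <= Num.sqrt (S s).
  rewrite -sqrtr_sqr ler_sqrt //; apply: le_trans (S_ge i s).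
  by rewrite lerDr sqr_ge0.
have nX s : `|x (s + tau) - x s| <= Num.sqrt (S s).
  by apply: norm_le_coord => i; rewrite !mxE; exact: rX.
have nU s : `|u (s + tau) - u s| <= Num.sqrt (S s).
  by apply: norm_le_coord => i; rewrite !mxE; exact: rU.
have dSle s : dS s <= 16 * C * S s.
  have -> : 16 * C * S s = \sum_(i < 3) (16 * C * S s / 3).
    by rewrite sumr_const card_ord -mulr_natr; field.
  apply: ler_sum => i _.
  have h1 : X i s * (m * U i s) <= S s / 2.
    have : 2 * `|X i s * (m * U i s)| <= S s.
      rewrite !normrM; have := S_ge i s.
      rewrite -(real_normK (num_real (X i s))) -(real_normK (num_real (U i s))).
      have := normr_ge0 (X i s); have := normr_ge0 (U i s).
      rewrite (gtr0_norm m0); have := traj_m1 L; have := m0.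
      move: `|X i s| `|U i s| (S s) => p q r; have := sqr_ge0 (p - q); nra.
    by have := ler_norm (X i s * (m * U i s)); lra.
  have h2 : U i s * (du (s + tau) 0 i - du s 0 i) <= 2 * C * S s.
    apply: le_trans (ler_norm _) _; rewrite normrM.
    have -> : 2 * C * S s = Num.sqrt (S s) * (C * (Num.sqrt (S s) + Num.sqrt (S s))).
      rewrite -{1}(sqr_sqrtr (S0 s)); ring.
    apply: ler_pM => //.
    have := norm_coord_le (du (s + tau) - du s) i; rewrite !mxE => h.
    apply: le_trans h _; apply: le_trans (traj_lip L _ _) _.
    by rewrite ler_pM2l ?C0 // lerD.
  have : S s <= C * S s by rewrite ler_peMl ?C1.
  move: h1 h2 (S0 s) C0; lra.
have := gronwall hS (fun s _ => dSle s) t0.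
set e := expR (8 * C * t).
have -> : expR (16 * C * t) = e ^+ 2.
  by rewrite /e expr2 -expRD; congr expR; ring.
set D := `|x tau - x 0| + `|u tau - u 0|.
have S0D : S 0 <= 9 * D ^+ 2.
  have -> : 9 * D ^+ 2 = \sum_(i < 3) (3 * D ^+ 2).
    by rewrite sumr_const card_ord -mulr_natr; ring.
  apply: ler_sum => i _.
  have hX : `|X i 0| <= D.
    have := norm_coord_le (x tau - x 0) i; rewrite !mxE /X add0r => h.
    by rewrite (le_trans h) // /D lerDl.
  have hU : `|U i 0| <= D.
    have := norm_coord_le (u tau - u 0) i; rewrite !mxE /U add0r => h.
    by rewrite (le_trans h) // /D lerDr.
  rewrite -(real_normK (num_real (X i 0))) -(real_normK (num_real (U i 0))).
  have := normr_ge0 (X i 0); have := normr_ge0 (U i 0).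
  move: hX hU; nra.
move=> St.
have D0 : 0 <= D by rewrite addr_ge0.
have e0 : 0 < e by exact: expR_gt0.
have sSt : Num.sqrt (S t) <= 3 * e * D.
  rewrite -(ger0_norm (x := 3 * e * D)); last first.
    by rewrite !mulr_ge0 // ltW.
  rewrite -sqrtr_sqr ler_sqrt ?sqr_ge0 //; apply: le_trans St _.
  have -> : (3 * e * D) ^+ 2 = 9 * D ^+ 2 * e ^+ 2 by ring.
  by rewrite ler_wpM2r // sqr_ge0.
by split; apply: le_trans sSt.
Qed.

(** The factor [1 + C] bounds the initial difference of positions and velocities by |d| alone; the
    last factor [W] comes from integrating the velocity difference over the window. *)
Definition shift_growth : R := 3 * expR (8 * C * W) * (1 + C) * W.
Notation E := shift_growth.

Section ReturnTime.
Variable tau : R.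
Hypothesis tau_bounds : 0 < tau <= W.
Hypothesis tau_return : `|u tau - u 0| <= C * `|x tau - x 0|.
Hypothesis tau_period : `|w * tau - 2 * pi| <= 4 * (m * K).
Let d := x tau - x 0.

(** The relative error [m * E] is small however small [d] is: the position is the integral of [m]
    times the velocity, and the velocities differ by O(|d|). *)
Lemma larmor_shift (t : R) : 0 <= t <= W ->
  `|x (t + tau) - x t - d| <= m * E * `|d| /\ `|u (t + tau) - u t| <= E * `|d|.
Proof.
move=> /andP[t0 tW].
have W1 : 1 <= W by move: W_large C1; lra.
have uE s : 0 <= s <= W -> `|u (s + tau) - u s| <= 3 * expR (8 * C * W) * (1 + C) * `|d|.
  move=> /andP[s0 sW]; apply: le_trans (larmor_shift_gronwall tau s0).2 _.
  rewrite -(mulrA _ (1 + C)); apply: ler_pM.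
  - by rewrite mulr_ge0 // ltW // expR_gt0.
  - by rewrite addr_ge0.
  - by rewrite ler_pM2l // ler_expR ler_pM2l // mulr_gt0 ?C0.
  - by rewrite mulrDl mul1r lerD.
have B0 : 0 <= 3 * expR (8 * C * W) * (1 + C) * `|d|.
  by rewrite !mulr_ge0 ?addr_ge0 ?(ltW C0) // ltW // expR_gt0.
split.
  pose f s := x (s + tau) - x s.
  have df i (s : R) : is_derive s 1 (fun s => f s 0 i) ((m *: (u (s + tau) - u s)) 0 i).
    rewrite !mxE mulrDr mulrN.
    have -> : (fun s => f s 0 i) = (fun s => x (s + tau) 0 i - x s 0 i).
      by apply/funext => r; rewrite !mxE.
    apply: is_derive_subE; last exact: traj_x L s i.
    exact: (@is_derive_shiftE _ (fun s => x s 0 i)) (traj_x L _ i).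
  have := vector_derive_norm_le t0 (fun s i => df i s).
  rewrite {2}/f add0r -/d subr0 => H.
  apply: le_trans (H (m * (3 * expR (8 * C * W) * (1 + C) * `|d|)) _) _.
    move=> s /andP[s0 st]; rewrite normrZ gtr0_norm ?m0 // ler_pM2l ?m0 // uE //.
    by rewrite s0 (le_trans st).
  have -> : m * E * `|d| = m * (3 * expR (8 * C * W) * (1 + C) * `|d|) * W.
    by rewrite /shift_growth; ring.
  by rewrite ler_wpM2l // mulr_ge0 // ltW ?m0.
have tW' : 0 <= t <= W by rewrite t0.
apply: le_trans (uE t tW') _.
have -> : E * `|d| = 3 * expR (8 * C * W) * (1 + C) * `|d| * W.
  by rewrite /shift_growth; ring.
by rewrite ler_peMr.
Qed.

(** A telescoping sum: each turn contributes [d] with the error of [larmor_shift]. *)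
Lemma larmor_iterated_shift (k : nat) : k%:R * tau <= W ->
  `|x (k%:R * tau) - x 0 - k%:R *: d| <= k%:R * (m * E * `|d|) /\
  `|u (k%:R * tau) - u 0| <= k%:R * (E * `|d|).
Proof.
have /andP[tau0 _] := tau_bounds.
elim: k => [_|k IH]; first by rewrite !mul0r scale0r !subrr ?subr0 normr0.
have kS : k.+1%:R * tau = k%:R * tau + tau by rewrite -natr1 mulrDl mul1r.
have E1 y : k.+1%:R * y = k%:R * y + y by rewrite -natr1 mulrDl mul1r.
have Ed : k.+1%:R *: d = k%:R *: d + d by rewrite -natr1 scalerDl scale1r.
rewrite kS !E1 Ed => kW.
have k0 : 0 <= k%:R * tau by rewrite mulr_ge0 // ltW.
have kW' : 0 <= k%:R * tau <= W by rewrite k0 /=; move: kW tau0; lra.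
have [|H1 H2] := IH; first by case/andP: kW'.
have [H3 H4] := larmor_shift kW'.
split.
  have -> : x (k%:R * tau + tau) - x 0 - (k%:R *: d + d) =
     (x (k%:R * tau) - x 0 - k%:R *: d) + (x (k%:R * tau + tau) - x (k%:R * tau) - d).
    by rewrite opprD !addrA; apply/rowP => i; rewrite !mxE; ring.
  by rewrite (le_trans (ler_normD _ _)) // lerD.
have -> : u (k%:R * tau + tau) - u 0 =
     (u (k%:R * tau) - u 0) + (u (k%:R * tau + tau) - u (k%:R * tau)).
  by apply/rowP => i; rewrite !mxE; ring.
by rewrite (le_trans (ler_normD _ _)) // lerD.
Qed.

(** A gap of at most half a turn is what the chord lemmas can handle. *)
Lemma nearest_multiple (T : R) (N : nat) : 0 <= T <= N%:R * tau ->
  exists2 k : nat, (k <= N)%N & `|T - k%:R * tau| <= tau / 2.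
Proof.
have /andP[tau0 _] := tau_bounds.
elim: N => [|N IH] /andP[T0 TN].
  exists 0%N => //; rewrite mul0r subr0 ger0_norm //.
  by move: TN; rewrite mul0r; lra.
have [TN'|TN'] := leP T (N%:R * tau).
  by have [|k kN ?] := IH; [rewrite T0|exists k => //; exact: leqW].
rewrite -natr1 mulrDl mul1r in TN.
have [h|h] := leP (T - N%:R * tau) (tau / 2).
  by exists N => //; rewrite ger0_norm //; lra.
exists N.+1 => //; rewrite -natr1 mulrDl mul1r ler0_norm; lra.
Qed.

(** Gronwall's estimate with zero initial difference, available only forward in time. *)
Lemma larmor_periodic : d = 0 -> forall t : R, 0 <= t ->
  x (t + tau) = x t /\ u (t + tau) = u t.
Proof.
move=> d0 t t0; have ud : u tau - u 0 = 0.
  apply/eqP; rewrite -normr_le0; apply: le_trans tau_return _.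
  by rewrite -/d d0 normr0 mulr0.
have [] := larmor_shift_gronwall tau t0.
rewrite -/d d0 ud normr0 addr0 mulr0 !normr_le0 !subr_eq0.
by move=> /eqP -> /eqP ->.
Qed.

Hypothesis pi_small : 2 * pi + 4 * (m * K) <= 8.

(** This is where the bound 4 of the chord lemmas and the bound 8 of [pi_small] meet. *)
Lemma larmor_half_period : w * (tau / 2) <= 4.
Proof.
move: tau_period; rewrite ler_norml => /andP[_].
by move: pi_small => h1 h2; lra.
Qed.

Lemma larmor_half_chord (h : R) : 0 <= h <= tau / 2 -> w * h <= 4.
Proof.
move=> /andP[h0 ht]; apply: le_trans larmor_half_period.
by rewrite ler_pM2l ?w0.
Qed.

(** Of the two arcs of the closed curve between [x s] and [x t], one takes at most half a period;
    the second case starts it at [t] and ends it at [s + tau]. *)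
Lemma larmor_simple : (forall t : R, 0 <= t -> x (t + tau) = x t) ->
  2 * tau <= W ->
  forall s t : R, 0 <= s -> s < t -> t < tau -> x s <> x t.
Proof.
move=> per tW s t s0 st tt E; have /andP[tau0 _] := tau_bounds.
have [h|h] := leP (t - s) (tau / 2).
  have := @larmor_chord_x s (t - s) s0; rewrite subrKC E eqxx => H.
  by suff : false by []; apply: H; [lra|lra|apply: larmor_half_chord; lra].
have t0 : 0 <= t by lra.
have := @larmor_chord_x t (s + tau - t) t0; rewrite subrKC per // E eqxx => H.
by suff : false by []; apply: H; [lra|lra|apply: larmor_half_chord; lra].
Qed.

(** The distance from [T] to the nearest multiple of [tau] is again a period of [u], and it is at
    most half a turn, so [larmor_chord_u] makes it vanish. *)
Lemma larmor_period_multiple (T : R) : 0 < T -> 2 * tau <= W ->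
  (forall t, x (t + tau) = x t /\ u (t + tau) = u t) ->
  (forall t, x (t + T) = x t /\ u (t + T) = u t) ->
  exists2 k : nat, (0 < k)%N & T = k%:R * tau.
Proof.
move=> T0 tW per perT; have /andP[tau0 _] := tau_bounds.
have perk (k : nat) t : u (t + k%:R * tau) = u t.
  elim: k t => [|k IH] t; first by rewrite mul0r addr0.
  by rewrite -natr1 mulrDl mul1r addrA (per _).2.
pose N := (Num.trunc (T / tau)).+1.
have [|k _ kT] := @nearest_multiple T N.
  rewrite ltW //= -ler_pdivrMr //; apply: ltW.
  by rewrite /N; exact: truncnS_gt.
have E : T = k%:R * tau.
  have [h|h] := leP (k%:R * tau) T.
    have uE : u (0 + (T - k%:R * tau)) = u 0.
      by rewrite -(perk k) add0r subrK -[in LHS](add0r T) (perT _).2.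
    have := @larmor_chord_u 0 (T - k%:R * tau) (lexx _).
    rewrite uE subrr normr0 mulr0 add0r subr_ge0 => H.
    rewrite ger0_norm ?subr_ge0 // in kT.
    have : T - k%:R * tau <= 0.
      by apply: H => //; [lra|apply: larmor_half_chord; rewrite subr_ge0 h].
    by move=> h'; apply/eqP; rewrite eq_le h -subr_le0 h'.
  have uE : u (0 + (k%:R * tau - T)) = u 0.
    by rewrite add0r -(perT _).2 subrK -[in LHS](add0r (_ * tau)) perk.
  have := @larmor_chord_u 0 (k%:R * tau - T) (lexx _).
  rewrite uE subrr normr0 mulr0 add0r subr_ge0 => H.
  rewrite ltr0_norm ?subr_lt0 // opprB in kT.
  have : k%:R * tau - T <= 0.
    apply: H => //; [exact: ltW|lra|apply: larmor_half_chord].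
    by rewrite subr_ge0 (ltW h).
  by move=> h'; lra.
exists k => //; case: k E {kT} => // E; move: T0; rewrite E mul0r ltxx //.
Qed.

(* After [k] turns the curve has drifted by [k d] up to [O(k m |d|)]; if it closed
   up near the time [k tau], the drift would be [O(k m |d|)] altogether. *)
Lemma larmor_no_return (N : nat) (T : R) : d != 0 ->
  m * (E * (1 + 16 * C ^+ 3)) < 1 -> N.+1%:R * tau <= W ->
  0 < T -> x T = x 0 -> u T = u 0 -> N%:R * tau < T.
Proof.
move=> dn0 small NW T0 xT uT; rewrite ltNge; apply/negP => TN.
have /andP[tau0 _] := tau_bounds.
have [|k kN kT] := @nearest_multiple T N; first by rewrite (ltW T0).
rewrite -natr1 mulrDl mul1r in NW.
have kW : k%:R * tau <= N%:R * tau by rewrite ler_pM2r // ler_nat.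
have kW' : k%:R * tau <= W by lra.
have k0 : 0 <= k%:R * tau by rewrite mulr_ge0 // ltW.
have [hx hu] := larmor_iterated_shift kW'.
have r1 : `|T - k%:R * tau| <= 16 * C ^+ 2 * `|u (k%:R * tau) - u 0|.
  have [h|h] := leP (k%:R * tau) T.
    rewrite ger0_norm ?subr_ge0 //; rewrite ger0_norm ?subr_ge0 // in kT.
    have := @larmor_chord_u (k%:R * tau) (T - k%:R * tau) k0.
    rewrite subrKC uT (distrC (u 0)) subr_ge0; apply => //; first lra.
    by apply: larmor_half_chord; rewrite subr_ge0 h.
  rewrite ltr0_norm ?subr_lt0 // opprB; rewrite ltr0_norm ?subr_lt0 // opprB in kT.
  have := @larmor_chord_u T (k%:R * tau - T) (ltW T0).
  rewrite subrKC uT subr_ge0; apply => //; first exact: ltW.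
  by apply: larmor_half_chord; rewrite subr_ge0 (ltW h).
have nd : 0 < `|d| by rewrite normr_gt0.
have E0 : 0 <= E.
  by rewrite /shift_growth !mulr_ge0 ?addr_ge0 ?(ltW C0) ?(ltW W0) // ltW // expR_gt0.
have r2 : `|T - k%:R * tau| <= 16 * C ^+ 2 * (k%:R * (E * `|d|)).
  by apply: le_trans r1 _; rewrite ler_wpM2l // mulr_ge0 // sqr_ge0.
have r3 : `|x T - x (k%:R * tau)| <= m * C * `|T - k%:R * tau|.
  have [h|h] := leP (k%:R * tau) T.
    by rewrite [X in _ <= _ * X]ger0_norm ?subr_ge0 // larmor_position.
  rewrite distrC [X in _ <= _ * X]ltr0_norm ?subr_lt0 // opprB.
  by rewrite larmor_position // ltW.
have r4 : k%:R * `|d| <= k%:R * (m * E * `|d|) +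
    m * C * (16 * C ^+ 2 * (k%:R * (E * `|d|))).
  have -> : k%:R * `|d| = `|k%:R *: d| by rewrite normrZ ger0_norm.
  have -> : k%:R *: d = - (x (k%:R * tau) - x 0 - k%:R *: d) - (x T - x (k%:R * tau)).
    by rewrite xT; apply/rowP => i; rewrite !mxE; ring.
  apply: le_trans (ler_normB _ _) _; rewrite normrN lerD //.
  by apply: le_trans r3 _; rewrite ler_wpM2l // mC0.
have {}r4 : k%:R * `|d| <= k%:R * `|d| * (m * (E * (1 + 16 * C ^+ 3))).
  by apply: le_trans r4 _; rewrite le_eqVlt; apply/orP; left; apply/eqP; ring.
(* For k = 0 there is no drift to contradict, but [r2] already gives T = 0. *)
case: k kN kT kW kW' k0 hx hu r1 r2 r3 r4 => [|k] _ _ _ _ _ _ _ _ r2 _ r4.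
  by move: r2; rewrite !mul0r mulr0 normr_le0 subr0 gt_eqF.
have : 0 < k.+1%:R * `|d| by rewrite mulr_gt0.
move: r4 small; set y := k.+1%:R * `|d|; set z := m * _; nra.
Qed.

(* A chord of the sphere is orthogonal to the radius through its midpoint, so its
   component along [x 0] is negligible. *)
Lemma larmor_planar_inj (s t : R) : 0 <= s <= W -> 0 <= t <= W ->
  m * (6 * C ^+ 2 * W) <= 1 ->
  dot a (x s) = dot a (x t) -> dot b (x s) = dot b (x t) -> x s = x t.
Proof.
move=> /andP[s0 sW] /andP[t0 tW] small ha hb.
apply/eqP; rewrite -subr_eq0 -normr_le0; set v := x s - x t.
have := traj_frame L v; rewrite !dotBr ha hb !subrr normr0 !add0r => hv.
have E1 : dot v (x 0) = dot v (x 0 - 2^-1 *: (x s + x t)).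
  have h : dot v (x s + x t) = 0.
    by rewrite dotBl !dotDr !(traj_sphere L) (dotC (x t)); ring.
  by rewrite dotBr dotZr h; ring.
have near0 r : 0 <= r -> r <= W -> `|x r - x 0| <= m * C * W.
  move=> r0 rW; apply: le_trans (larmor_position r0) _.
  by rewrite subr0 ler_wpM2l // mC0.
have h1 : `|x 0 - 2^-1 *: (x s + x t)| <= m * C * W.
  have -> : x 0 - 2^-1 *: (x s + x t) = - 2^-1 *: (x s - x 0) + - 2^-1 *: (x t - x 0).
    by apply/rowP => i; rewrite !mxE; field.
  apply: le_trans (ler_normD _ _) _; rewrite !normrZ normrN ger0_norm ?invr_ge0 //.
  by have := near0 _ s0 sW; have := near0 _ t0 tW; lra.
have h2 : `|dot v (x 0)| <= 3 * `|v| * (m * C * W).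
  rewrite E1; apply: le_trans (dot_norm_le _ _) _.
  by rewrite ler_wpM2l // mulr_ge0.
have : `|v| <= C * (3 * `|v| * (m * C * W)) by rewrite (le_trans hv) // ler_pM2l ?C0.
have -> : C * (3 * `|v| * (m * C * W)) = `|v| * (m * (6 * C ^+ 2 * W)) / 2 by field.
have := normr_ge0 v; move: small; set y := `|v|; set z := m * _; nra.
Qed.

(** The drift divided by [m] is the integral of the velocity over one turn. The ideal rotation
    contributes sin (w tau) / w and (1 - cos (w tau)) / w, both small as [w * tau] is close to 2 pi;
    the rotation error contributes at most [m * K * W]. *)
Lemma larmor_drift_small : `|dot a d / m| <= m * K * (W + 4 * C) /\
  `|dot b d / m| <= m * K * (W + 4 * C).
Proof.
have /andP[tau0 tauW] := tau_bounds.
have mK0 : 0 < m * K by rewrite mulr_gt0 ?m0 ?K0.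
have wV := larmor_wV; have wV0 : 0 < w^-1 by rewrite invr_gt0 w0.
have wn0 : w != 0 by rewrite gt_eqF ?w0.
have mn0 : m != 0 by rewrite gt_eqF ?m0.
pose y := w * tau - 2 * pi.
have wtE : w * tau = y + pi *+ 2 by rewrite /y mulr2n; ring.
have sE : sin (w * tau) = sin y.
  by rewrite wtE sinD cos2pi (sin_mulr2n pi) sinpi; ring.
have cE : cos (w * tau) = cos y.
  by rewrite wtE cosD cos2pi (sin_mulr2n pi) sinpi; ring.
have yK : `|y| <= 4 * (m * K) by [].
have sy : `|sin y| <= 4 * (m * K) by rewrite (le_trans (sin_norm_le _)).
have cy : `|1 - cos y| <= 4 * (m * K).
  have -> : 1 - cos y = 2 * sin (y / 2) ^+ 2.
    have -> : cos y = cos (y / 2 *+ 2) by congr cos; rewrite -mulr_natr; field.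
    have := cos2Dsin2 (y / 2); rewrite cos_mulr2n -(mulr_natr (cos _ ^+ 2)); lra.
  rewrite ger0_norm; last by apply: mulr_ge0 => //; exact: sqr_ge0.
  have : `|sin (y / 2)| <= 2 * (m * K).
    apply: le_trans (sin_norm_le _) _.
    by rewrite normrM (ger0_norm (x := 2^-1)) ?invr_ge0 //; lra.
  rewrite ler_norml; move: mK mK0; set k := m * K; set z := sin _ => k1 k0 /andP[z1 z2].
  have : 0 <= (2 * k - z) * (2 * k + z) by apply: mulr_ge0; lra.
  have : k * k <= k * (1 / 64) by rewrite ler_wpM2l // ltW.
  by rewrite expr2; lra.
have dxm v (t : R) : is_derive t 1 (fun s => m^-1 * dot v (x s)) (dot v (u t)).
  by have := is_derive_scaleE m^-1 (larmor_dot_x v t); rewrite mulKf.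
have dsw (t : R) : is_derive t 1 (fun s => w^-1 * sin (w * s + 0)) (cos (w * t)).
  by have := is_derive_scaleE w^-1 (is_derive_sin_affine w 0 t); rewrite mulKf // addr0.
have dcw (t : R) : is_derive t 1 (fun s => w^-1 * cos (w * s + 0)) (- sin (w * t)).
  have := is_derive_scaleE w^-1 (is_derive_cos_affine w 0 t).
  by rewrite mulrN mulKf // addr0.
have tW t : 0 <= t <= tau -> 0 <= t <= W by move=> ?; lra.
have KW : m * K * tau <= m * K * W by rewrite ler_pM2l.
have wVb z : `|z| <= 4 * (m * K) -> `|w^-1 * z| <= m * K * (4 * C).
  move=> hz; rewrite normrM gtr0_norm //.
  have -> : m * K * (4 * C) = C * (4 * (m * K)) by ring.
  by apply: ler_pM => //; exact: ltW.
split.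
  have H := derive_norm_le (k := m * K) (ltW tau0)
    (fun t => is_derive_subE (dxm a t) (dsw t)).
  have {}H := H (fun t ht => (larmor_rotation (tW t ht)).1).
  rewrite mulr0 !addr0 sin0 mulr0 !subr0 sE in H.
  have -> : dot a d / m = (m^-1 * dot a (x tau) - w^-1 * sin y - m^-1 * dot a (x 0))
      + w^-1 * sin y by rewrite /d dotBr; ring.
  apply: le_trans (ler_normD _ _) _; have := wVb _ sy; lra.
have H := derive_norm_le (k := m * K) (ltW tau0)
  (fun t => is_derive_addE (dxm b t) (dcw t)).
have {}H := H (fun t ht => (larmor_rotation (tW t ht)).2).
rewrite mulr0 !addr0 cos0 mulr1 !subr0 cE in H.
have -> : dot b d / m = (m^-1 * dot b (x tau) + w^-1 * cos y -
    (m^-1 * dot b (x 0) + w^-1)) + w^-1 * (1 - cos y) by rewrite /d dotBr; ring.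
apply: le_trans (ler_normD _ _) _; have := wVb _ cy; lra.
Qed.

(** Both ends of [d] lie on the sphere, so its component along [x 0] is - dot d d / 2, of second
    order; it is absorbed into the left-hand side of [traj_frame]. *)
Lemma larmor_drift_planar : m * (6 * C ^+ 2 * W) <= 1 ->
  `|d| <= 2 * C * (`|dot a d| + `|dot b d|).
Proof.
move=> small; have /andP[tau0 tauW] := tau_bounds.
have dx0 : 2 * dot d (x 0) = - dot d d.
  have := traj_sphere L tau; have -> : x tau = x 0 + d.
    by rewrite /d subrKC.
  rewrite (dotDl (x 0) d) (dotDr (x 0) (x 0) d) (dotDr d (x 0) d) (traj_sphere L).
  by rewrite (dotC (x 0) d); lra.
have dW : `|d| <= m * C * W.
  apply: le_trans (larmor_position (ltW tau0)) _.
  by rewrite subr0 ler_wpM2l // mC0.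
have h : `|dot d (x 0)| <= 3 / 2 * (m * C * W) * `|d|.
  have -> : dot d (x 0) = - dot d d / 2 by rewrite -dx0; field.
  rewrite normrM normrN (ger0_norm (x := 2^-1)) ?invr_ge0 //.
  have := dot_norm_le d d; have := normr_ge0 d.
  by move: dW; set q := m * C * W; set z := `|d|; nra.
have := traj_frame L d.
have : C * `|dot d (x 0)| <= C * (3 / 2 * (m * C * W) * `|d|) by rewrite ler_pM2l ?C0.
have -> : C * (3 / 2 * (m * C * W) * `|d|) = m * (6 * C ^+ 2 * W) * `|d| / 4 by field.
have : m * (6 * C ^+ 2 * W) * `|d| <= `|d| by rewrite ler_piMl.
have : 0 <= C * (`|dot a d| + `|dot b d|) by rewrite mulr_ge0 ?addr_ge0 // ltW.
lra.
Qed.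

(** In turn [j], [ph] is the time at which the velocity has direction [al]. The additional 2 pi in
    it keeps the window around [ph] at positive times. Since w tau >= 2 pi - 1, the windows of [n]
    turns and their shifts by [tau] fit generously into [2 * n + 4] turns. *)
Lemma larmor_turn_window (n j : nat) (al : R) : 0 <= al <= 2 * pi -> (j < n)%N ->
  let ph := (al + 2 * pi) / w + j%:R * (2 * pi / w) in
  [/\ w * ph = al + 2 * pi + j%:R * (2 * pi), w^-1 <= ph,
      ph + w^-1 + tau <= (2 * n + 4)%:R * tau & w^-1 < tau].
Proof.
move=> /andP[al0 al2] jn ph; have pi2 := pi_ge2 R.
have wn0 : w != 0 by rewrite gt_eqF ?w0.
have jn1 : j%:R + 1 <= n%:R :> R by rewrite natr1 ler_nat.
have wph : w * ph = al + 2 * pi + j%:R * (2 * pi) by rewrite /ph; field.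
have wtau : 2 * pi - 1 <= w * tau.
  by move: tau_period mK; rewrite ler_norml => /andP[? ?]; lra.
move: ph wph => ph wph; split => //.
- rewrite -(ler_pM2l w0) mulfV // wph.
  have : 0 <= j%:R * (2 * pi) :> R by rewrite mulr_ge0 // mulr_ge0 ?pi_ge0.
  lra.
- rewrite -(ler_pM2l w0) (mulrDr w (ph + w^-1)) (mulrDr w ph) mulfV // wph.
  have -> : w * ((2 * n + 4)%:R * tau) = (2 * n%:R + 4) * (w * tau).
    by rewrite natrD natrM; ring.
  have : (2 * n%:R + 3) * (2 * pi - 1) <= (2 * n%:R + 3) * (w * tau).
    by rewrite ler_wpM2l // addr_ge0 // mulr_ge0.
  have : (j%:R + 1) * (2 * pi) <= n%:R * (2 * pi) :> R.
    by rewrite ler_wpM2r // mulr_ge0 ?pi_ge0.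
  have : n%:R * 2 <= n%:R * pi :> R by rewrite ler_wpM2l.
  have : 1 <= n%:R :> R by rewrite ler1n (leq_ltn_trans _ jn).
  by move: al2 pi2; lra.
- by rewrite -(ltr_pM2l w0) mulfV //; lra.
Qed.

(** In each turn the curve and its shift by [tau] cross near the point where the velocity is
    parallel to the drift. [displaced_arcs_cross] is applied to the planar projections divided by
    [m], and [larmor_planar_inj] lifts the crossing to the sphere. [small2] bounds the relative
    error of the displacement, [small3] its size. *)
Lemma larmor_crossings (n : nat) : d != 0 ->
  m * (6 * C ^+ 2 * W) <= 1 -> 32 * (32 * (4 * C ^+ 2 * E * m)) <= 1 ->
  64 * (2 * C * (m * K * (W + 4 * C))) <= 1 ->
  (2 * n + 4)%:R * tau <= W ->
  exists phi : R, forall j, (j < n)%N -> exists s t : R,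
    [/\ `|s - (phi + j%:R * (2 * pi / w))| <= w^-1 / 2,
        0 <= s, s < t, t <= (2 * n + 4)%:R * tau & x s = x t].
Proof.
move=> dn0 small1 small2 small3 nW; have /andP[tau0 tauW] := tau_bounds.
have mK0 : 0 < m * K by rewrite mulr_gt0 ?m0 ?K0.
have wV := larmor_wV; have wV0 : 0 < w^-1 by rewrite invr_gt0 w0.
have wn0 : w != 0 by rewrite gt_eqF ?w0.
have mn0 : m != 0 by rewrite gt_eqF ?m0.
have pi2 := pi_ge2 R.
have nd : 0 < `|d| by rewrite normr_gt0.
have [p pdef] : exists p, p = dot a d / m by exists (dot a d / m).
have [q qdef] : exists q, q = dot b d / m by exists (dot b d / m).
have [de dedef] : exists de, de = Num.sqrt (p ^+ 2 + q ^+ 2).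
  by exists (Num.sqrt (p ^+ 2 + q ^+ 2)).
have pq0 : 0 <= p ^+ 2 + q ^+ 2 by rewrite addr_ge0 ?sqr_ge0.
have hp : `|p| <= de by rewrite dedef -sqrtr_sqr ler_sqrt // lerDl sqr_ge0.
have hq : `|q| <= de by rewrite dedef -sqrtr_sqr ler_sqrt // lerDr sqr_ge0.
have de2 : de ^+ 2 = p ^+ 2 + q ^+ 2 by rewrite dedef sqr_sqrtr.
have ddm : `|d| <= 4 * C * m * de.
  apply: le_trans (larmor_drift_planar small1) _.
  have ea : `|dot a d| = m * `|p|.
    by rewrite pdef normrM normfV (gtr0_norm m0) mulrC divfK.
  have eb : `|dot b d| = m * `|q|.
    by rewrite qdef normrM normfV (gtr0_norm m0) mulrC divfK.
  rewrite ea eb -mulrDr.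
  have -> : 4 * C * m * de = 2 * C * (m * (de + de)) by ring.
  by rewrite ler_pM2l ?mulr_gt0 ?C0 // ler_pM2l ?m0 // lerD.
have de0 : 0 < de.
  have : 0 < 4 * C * m * de by apply: lt_le_trans ddm.
  by rewrite pmulr_rgt0 // !mulr_gt0 ?C0 ?m0.
have de_le : de <= `|p| + `|q|.
  rewrite -(ger0_norm (x := `|p| + `|q|)) ?addr_ge0 //.
  rewrite dedef -sqrtr_sqr ler_sqrt ?sqr_ge0 //.
  rewrite sqrrD !real_normK ?num_real //.
  have : 0 <= `|p| * `|q| by rewrite mulr_ge0.
  by rewrite mulr2n; lra.
(* [al] is the direction of the drift in the frame, [de] its length there divided by [m]. *)
have [al /andP[al0 al2] [cal sal]] : exists2 al, 0 <= al <= 2 * pi &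
    p / de = cos al /\ q / de = sin al.
  apply: polar_angle; rewrite (expr_div_n p) (expr_div_n q) -mulrDl -de2 divff //.
  by rewrite expf_neq0 // gt_eqF.
have pE : p = de * cos al by rewrite -cal mulrC divfK // gt_eqF.
have qE : q = de * sin al by rewrite -sal mulrC divfK // gt_eqF.
have wde : 64 * w * de <= 1.
  have [h1 h2] := larmor_drift_small; rewrite -pdef in h1; rewrite -qdef in h2.
  apply: le_trans small3.
  have -> : 64 * (2 * C * (m * K * (W + 4 * C))) =
    64 * C * (m * K * (W + 4 * C) + m * K * (W + 4 * C)) by ring.
  apply: ler_pM; [by rewrite mulr_ge0 // ltW ?w0|exact: ltW| |].
    by rewrite ler_pM2l // (traj_whi L).
  by apply: le_trans de_le _; exact: lerD.
clear small3; exists ((al + 2 * pi) / w) => j jn.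
have al02 : 0 <= al <= 2 * pi by rewrite al0.
have [] := larmor_turn_window al02 jn.
set ph := _ + j%:R * _; move: ph => ph wph ph1 phT wt1.
have perj (f : R -> R) : (forall y, f (y + pi *+ 2) = f y) ->
    forall y, f (y - al) = f (y - w * ph).
  move=> hf y.
  have hk (k : nat) z : f (z + k%:R * (2 * pi)) = f z.
    elim: k z => [|k IH] z; first by rewrite mul0r addr0.
    have -> : z + k.+1%:R * (2 * pi) = z + k%:R * (2 * pi) + pi *+ 2.
      by rewrite -natr1 mulr2n; ring.
    by rewrite hf IH.
  rewrite -(hk j.+1 (y - w * ph)) wph; congr f; rewrite -natr1; ring.
have cper y : cos (y + pi *+ 2) = cos y :> R.
  by rewrite cosD cos2pi (sin_mulr2n pi) sinpi; ring.
have sper y : sin (y + pi *+ 2) = sin y :> R.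
  by rewrite sinD cos2pi (sin_mulr2n pi) sinpi; ring.
have dxm v (t : R) : is_derive t 1 (fun s => m^-1 * dot v (x s)) (dot v (u t)).
  by have := is_derive_scaleE m^-1 (larmor_dot_x v t); rewrite mulKf.
have cxm v : continuous (fun t : R => m^-1 * dot v (x (t + tau))).
  apply: (@is_derive_continuous _ _ (fun t => dot v (u (t + tau)))) => t.
  exact: (@is_derive_shiftE _ (fun s => m^-1 * dot v (x s))).
have tW t : `|t - ph| <= w^-1 -> 0 <= t <= W /\ 0 <= t + tau <= W.
  by rewrite ler_norml => /andP[? ?]; split; apply/andP; split; lra.
have disp v t : (forall z, `|dot v z| <= C * `|z|) -> `|t - ph| <= w^-1 ->
    `|m^-1 * dot v (x (t + tau)) - m^-1 * dot v (x t) - dot v d / m|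
      <= 4 * C ^+ 2 * E * m * de.
  move=> hv /tW [tW1 _].
  have -> : m^-1 * dot v (x (t + tau)) - m^-1 * dot v (x t) - dot v d / m =
    m^-1 * dot v (x (t + tau) - x t - d) by rewrite !dotBr; ring.
  rewrite normrM gtr0_norm ?invr_gt0 ?m0 //.
  have := (larmor_shift tW1).1 => h1; rewrite -(ler_pM2l m0) mulrA mulfV // mul1r.
  apply: le_trans (hv _) _; apply: (@le_trans _ _ (C * (m * E * `|d|))).
    by rewrite ler_pM2l ?C0.
  have -> : m * (4 * C ^+ 2 * E * m * de) = C * (m * E * (4 * C * m * de)) by ring.
  rewrite ler_pM2l ?C0 // ler_wpM2l // mulr_ge0 // ?(ltW m0) //.
  by rewrite /shift_growth !mulr_ge0 ?addr_ge0 ?(ltW C0) ?(ltW W0) // ltW // expR_gt0.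
have [] := @displaced_arcs_cross _ (fun t => m^-1 * dot a (x t)) (fun t => m^-1 * dot b (x t))
  (fun t => dot a (u t)) (fun t => dot b (u t))
  (fun t => m^-1 * dot a (x (t + tau))) (fun t => m^-1 * dot b (x (t + tau)))
  w al ph (m * K) de (4 * C ^+ 2 * E * m).
- exact: cxm.
- exact: cxm.
- exact: w0.
- exact: de0.
- exact: wde.
- exact: mK.
- exact: small2.
- by move=> t; rewrite mulrBr; apply: (perj cos).
- by move=> t; rewrite mulrBr; apply: (perj sin).
- move=> t ht; have [tW1 _] := tW t ht; have [r1 r2] := larmor_rotation tW1.
  split => //.
    by rewrite -pE pdef; apply: disp => //; exact: traj_a L.
  by rewrite -qE qdef; apply: disp => //; exact: traj_b L.
move=> s [t [hs ht e1 e2]].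
have [|tW1 _] := tW t; first lra.
have [|sW1 sW2] := tW s; first lra.
(* The two times are distinct: |s - t| <= 1 / w < tau. *)
exists t, (s + tau).
move: (hs) (ht); rewrite !ler_norml => /andP[? ?] /andP[? ?].
split; [lra|by case/andP: tW1|lra|lra|].
apply: larmor_planar_inj => //.
  by apply: (mulfI (invr_neq0 mn0)).
by apply: (mulfI (invr_neq0 mn0)).
Qed.

End ReturnTime.

End LarmorTrajectory.

Lemma periodic_nat (R : realType) (X : Type) (f : R -> X) (T : R) (k : nat) (t : R) :
  (forall t, f (t + T) = f t) -> f (t + k%:R * T) = f t.
Proof.
move=> fT; elim: k t => [|k IH] t; first by rewrite mul0r addr0.
by rewrite -natr1 mulrDl mul1r addrA fT IH.
Qed.

(** The alternative is whether the displacement of one turn vanishes. The times [s] of the crossings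
    are localized turn by turn so that they can be counted. *)
Lemma larmor_dichotomy (R : realType) (C eta : R) (n : nat) : 1 <= C -> 0 < eta ->
  exists2 m1 : R, 0 < m1 & forall m w x u du a b, m < m1 ->
    larmor_trajectory C w m x u du a b ->
    forall T, 0 < T -> (forall t, x (t + T) = x t /\ u (t + T) = u t) ->
  (exists tau k, [/\ 0 < tau, `|w * tau - 2 * pi| < eta, (0 < k)%N & T = k%:R * tau] /\
     (forall t, x (t + tau) = x t /\ u (t + tau) = u t) /\
     (forall s t, 0 <= s -> s < t -> t < tau -> x s <> x t)) \/
  (n%:R < w * T /\ exists phi : R, forall j, (j < n)%N -> exists s t : R,
    [/\ `|s - (phi + j%:R * (2 * pi / w))| <= w^-1 / 2,
        0 <= s, s < t, t < T & x s = x t]).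
Proof.
move=> C1 eta0; have C0 : 0 < C by lra.
(* Each turn takes time at most 9 C; [larmor_no_return] asks for one turn more than the 2 n + 4 that
   it rules out. *)
pose W := (2 * n + 5)%:R * (9 * C); pose K := rotation_error C W.
pose E := shift_growth C W.
have W1 : 9 * C <= W by rewrite /W ler_peMl ?ler1n ?addn_gt0 ?orbT // mulr_ge0 // ltW.
have W0 : 0 < W by lra.
have K0 : 0 < K.
  have CW : 0 < C * W by rewrite mulr_gt0.
  by rewrite /K /rotation_error !mulr_gt0 //; lra.
have E0 : 0 < E.
  by rewrite /E /shift_growth !mulr_gt0 ?expR_gt0 //; lra.
have pi4 : pi < 4 :> R by have := pihalf_lt2 R; lra.
have p0 : 0 < 8 - 2 * pi :> R by lra.
have pi2 := pi_ge2 R.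
(* Each smallness condition on [m] has the form m q <= 1, and [Q] dominates all the coefficients.
   The conditions from [q2] and [q4] have to be strict, whence a spare factor 2 in each. *)
pose q1 := 64 * K; pose q2 := 8 * K / eta; pose q3 := 4 * K / (8 - 2 * pi).
pose q4 := 2 * (E * (1 + 16 * C ^+ 3)); pose q5 := 6 * C ^+ 2 * W.
pose q6 := 32 * (32 * (4 * C ^+ 2 * E)); pose q7 := 64 * (2 * C * (K * (W + 4 * C))).
have q10 : 0 <= q1 by rewrite ltW // mulr_gt0.
have q20 : 0 <= q2 by rewrite ltW // divr_gt0 // mulr_gt0.
have q30 : 0 <= q3 by rewrite ltW // divr_gt0 // mulr_gt0.
have q40 : 0 <= q4.
  have c3 : 0 <= C ^+ 3 by rewrite exprn_ge0 // ltW.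
  by rewrite mulr_ge0 // mulr_ge0 ?(ltW E0) //; lra.
have c2 : 0 <= C ^+ 2 by rewrite exprn_ge0 // ltW.
have q50 : 0 <= q5 by rewrite mulr_ge0 ?(ltW W0) //; lra.
have q60 : 0 <= q6.
  by do 2 (apply: mulr_ge0 => //); apply: mulr_ge0; [lra|exact: ltW].
have q70 : 0 <= q7.
  apply: mulr_ge0 => //; apply: mulr_ge0; first lra.
  by apply: mulr_ge0; [exact: ltW|lra].
pose Q := 1 + q1 + q2 + q3 + q4 + q5 + q6 + q7.
have Q0 : 0 < Q by rewrite /Q; lra.
exists Q^-1; first by rewrite invr_gt0.
move=> m w x u du a b mQ L T T0 per.
have m0 := traj_m0 L.
have small q : 0 <= q -> q <= Q -> m * q <= 1.
  move=> q0 qQ; rewrite -(mulVf (lt0r_neq0 Q0)); apply: ler_pM => //; exact: ltW.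
have s1 : m * q1 <= 1 by apply: small => //; rewrite /Q; lra.
have s2 : m * q2 <= 1 by apply: small => //; rewrite /Q; lra.
have s3 : m * q3 <= 1 by apply: small => //; rewrite /Q; lra.
have s4 : m * q4 <= 1 by apply: small => //; rewrite /Q; lra.
have s5 : m * q5 <= 1 by apply: small => //; rewrite /Q; lra.
have s6 : m * q6 <= 1 by apply: small => //; rewrite /Q; lra.
have s7 : m * q7 <= 1 by apply: small => //; rewrite /Q; lra.
have h1 : m * K <= 1 / 64.
  by rewrite -(ler_pM2l (x := 64)) //; move: s1; rewrite /q1 mulrCA; lra.
have h2 : 4 * (m * K) < eta.
  move: s2; rewrite /q2 (mulrA m) ler_pdivrMr // mul1r.
  have : 0 < m * K by rewrite mulr_gt0.
  lra.
have h3 : 2 * pi + 4 * (m * K) <= 8.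
  by move: s3; rewrite /q3 (mulrA m) ler_pdivrMr // mul1r; lra.
have h4 : m * (E * (1 + 16 * C ^+ 3)) < 1.
  by move: s4; rewrite /q4 mulrCA; lra.
have h6 : 32 * (32 * (4 * C ^+ 2 * E * m)) <= 1.
  by apply: le_trans s6; rewrite /q6 le_eqVlt; apply/orP; left; apply/eqP; ring.
have h7 : 64 * (2 * C * (m * K * (W + 4 * C))) <= 1.
  by apply: le_trans s7; rewrite /q7 le_eqVlt; apply/orP; left; apply/eqP; ring.
have w0 := larmor_wgt0 L.
have [tau [taup tauW ret]] := larmor_return_time L W1 h1.
have /andP[tau0 _] := tauW.
have tau2pi : w * tau <= 2 * pi + 4 * (m * K).
  by move: taup; rewrite ler_norml => /andP[_]; rewrite -/K; lra.
have wtau1 : 1 <= w * tau.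
  by move: taup; rewrite ler_norml => /andP[+ _]; rewrite -/K; lra.
have tauC : tau <= 9 * C.
  have wt8 : w * tau <= 9.
    by apply: (le_trans tau2pi); apply: (le_trans h3); rewrite ler_nat.
  rewrite -[tau](mulKf (lt0r_neq0 w0)) mulrC; apply: ler_pM => //.
  - by rewrite mulr_ge0 // ltW.
  - by rewrite invr_ge0 ltW.
  - exact: larmor_wV L.
have NW : (2 * n + 4).+1%:R * tau <= W by rewrite /W (addnS (2 * n) 4) ler_wpM2l.
have dW : 2 * tau <= W.
  by apply: le_trans NW; rewrite ler_pM2r // ler_nat (addnC (2 * n)%N).
have [d0|dn0] := eqVneq (x tau - x 0) 0.
  left; exists tau.
  have pos := larmor_periodic L ret d0.
  (* Negative times are reached by adding a large multiple of the period [T]. *)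
  have pr t : x (t + tau) = x t /\ u (t + tau) = u t.
    pose k := (Num.trunc (`|t| / T)).+1.
    have kT : 0 <= t + k%:R * T.
      have : `|t| <= k%:R * T.
        by rewrite -ler_pdivrMr //; apply: ltW; exact: truncnS_gt.
      have := ler_norm (- t); rewrite normrN; lra.
    have [e1 e2] := pos _ kT.
    have hx := fun s => (per s).1; have hu := fun s => (per s).2.
    rewrite -(periodic_nat k (t + tau) hx) -(periodic_nat k (t + tau) hu).
    by rewrite addrAC e1 e2 !periodic_nat.
  have [k k0 kT] := larmor_period_multiple L W1 h1 tauW taup h3 T0 dW pr per.
  exists k; split; first by split => //; apply: le_lt_trans taup h2.
  split => //; apply: (larmor_simple L h1 tauW taup h3) => // t t0.
  by have [] := pos t t0.
right.
have [xT uT] : x T = x 0 /\ u T = u 0 by have := per 0; rewrite add0r.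
have TN := larmor_no_return L W1 h1 tauW ret taup h3 dn0 h4 NW T0 xT uT.
have nW : (2 * n + 4)%:R * tau <= W.
  by apply: le_trans NW; rewrite ler_pM2r // ler_nat.
split.
  have : (2 * n + 4)%:R * 1 <= (2 * n + 4)%:R * (w * tau).
    by rewrite ler_wpM2l.
  have : w * ((2 * n + 4)%:R * tau) < w * T by rewrite ltr_pM2l.
  rewrite mulrCA mulr1.
  have : n%:R <= (2 * n + 4)%:R :> R by rewrite ler_nat mul2n -addnn -addnA leq_addr.
  lra.
have [phi hphi] := larmor_crossings L W1 h1 tauW ret taup dn0 s5 h6 h7 nW.
exists phi => j /hphi [s [t [? ? ? tN ?]]]; exists s, t; split => //.
exact: le_lt_trans TN.
Qed.

(** * Functions on the sphere *)

Section SphereLipschitz.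
Variable R : realType.
Notation V := 'rV[R]_3.
Notation S2 := (@sphere2 R).

Lemma sphere2_norm_le (x : V) : S2 x -> `|x| <= 1.
Proof.
rewrite /sphere2 /= dotE => h; apply: norm_le_coord => i; rewrite ler_norml.
have := sqr_ge0 (x 0 0); have := sqr_ge0 (x 0 1); have := sqr_ge0 (x 0 2%:R).
rewrite !expr2 => h2 h1 h0.
have [->|[->|->]] : i = 0 \/ i = 1 \/ i = 2%:R.
- case: i => [[|[|[|//]]]] p; [left|right; left|right; right]; exact/val_inj.
- by apply/andP; split; nra.
- by apply/andP; split; nra.
- by apply/andP; split; nra.
Qed.

Lemma dot_continuous : continuous (fun x : V => dot x x).
Proof.
have -> : (fun x : V => dot x x) = (fun x => x 0 0 * x 0 0 + x 0 1 * x 0 1 + x 0 2%:R * x 0 2%:R).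
  by apply/funext => x; rewrite dotE.
have cM (i : 'I_3) x : x 0 i * x 0 i @[x --> (x : V)] --> x 0 i * x 0 i.
  by apply: cvgM; exact: coord_continuous.
by move=> x; exact: (cvgD (cvgD (cM 0 x) (cM 1 x)) (cM 2%:R x)).
Qed.

Lemma sphere2_compact : compact S2.
Proof.
apply: bounded_closed_compact.
  exists 1; split => // M M1 x /sphere2_norm_le h; exact: le_trans h (ltW M1).
have -> : S2 = (fun x : V => dot x x) @^-1` [set 1] by [].
apply: closed_comp; last exact: closed_eq.
by move=> x _; exact: dot_continuous.
Qed.

Lemma sphere2_nonempty : S2 !=set0.
Proof. by exists (delta_mx 0 0); rewrite /sphere2 /= dotE !mxE /=; ring. Qed.

Lemma continuous_sphere2_bounded (h : V -> R) :
  (forall x, S2 x -> {for x, continuous h}) ->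
  exists2 C : R, 0 <= C & forall x, S2 x -> `|h x| <= C.
Proof.
move=> ch.
have cn : {within S2, continuous (fun x => `|h x|)}.
  apply: continuous_in_subspaceT => x /set_mem Sx.
  exact: (cvg_norm (ch x Sx)).
have [c _ hc] := EVT_max_rV sphere2_nonempty sphere2_compact cn.
by exists `|h c| => // x Sx; apply: hc; exact/mem_set.
Qed.

Lemma continuous_sphere2_pos (h : V -> R) :
  (forall x, S2 x -> {for x, continuous h}) -> (forall x, S2 x -> 0 < h x) ->
  exists2 c, 0 < c & forall x, S2 x -> c <= h x.
Proof.
move=> ch h0.
have cn : {within S2, continuous h}.
  by apply: continuous_in_subspaceT => x /set_mem Sx; exact: ch.
have [c /set_mem Sc hc] := EVT_min_rV sphere2_nonempty sphere2_compact cn.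
by exists (h c); [exact: h0|move=> x Sx; apply: hc; exact/mem_set].
Qed.

Lemma diff_coord (h : V -> R^o) (x u : V) : differentiable h x ->
  'd h x u = \sum_i u 0 i * 'D_(delta_mx 0 i) h x.
Proof.
move=> dh; rewrite {1}(row_sum_delta u) linear_sum.
by apply: eq_bigr => i _; rewrite linearZ -deriveE.
Qed.

Lemma is_derive_along (h : V -> R^o) (c dc : R -> V) (s : R) :
  differentiable h (c s) ->
  (forall i, is_derive s 1 (fun r => c r 0 i) (dc s 0 i)) ->
  is_derive s 1 (fun r => h (c r)) (\sum_i dc s 0 i * 'D_(delta_mx 0 i) h (c s)).
Proof.
move=> dh dcs.
have der : derivable c s 1.
  by apply/derivable_mxP => i j; rewrite ord1; have [+ _] := dcs j.
have dif : differentiable c s by exact/derivable1_diffP.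
have difc : differentiable (h \o c) s by exact: differentiable_comp.
apply: DeriveDef; first exact/derivable1_diffP.
have -> : (fun r => h (c r)) = h \o c by [].
rewrite deriveE // diff_comp //= diff_coord //.
apply: eq_bigr => i _; congr (_ * _).
by rewrite -deriveE // derive_mx // mxE; have [_ <-] := dcs i.
Qed.

Lemma sphere2_lipschitz (h : V -> R^o) :
  (forall x, S2 x -> differentiable h x) ->
  (forall i x, S2 x -> {for x, continuous (fun y => 'D_(delta_mx 0 i) h y)}) ->
  exists2 C : R, 0 <= C & forall x y, S2 x -> S2 y -> `|h x - h y| <= C * `|x - y|.
Proof.
move=> dh cd.
have [B B0 hB] : exists2 B : R, 0 <= B & forall i x, S2 x -> `|'D_(delta_mx 0 i) h x| <= B.
  have /choice [B hB] : forall i, exists B : R, 0 <= B /\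
      forall x, S2 x -> `|'D_(delta_mx 0 i) h x| <= B.
    by move=> i; have [B B0 hB] := continuous_sphere2_bounded (cd i); exists B.
  exists (\sum_i B i); first by apply: sumr_ge0 => i _; have [] := hB i.
  move=> i x Sx; apply: le_trans ((hB i).2 x Sx) _.
  by rewrite (bigD1 i) //= lerDl; apply: sumr_ge0 => j _; have [] := hB j.
have [A A0 hA] := continuous_sphere2_bounded (fun x Sx => differentiable_continuous (dh x Sx)).
(* [2 * A] serves points at distance more than 1. For the others, 26 |v| bounds the speed of the
   joining curve (2 |v| + 8 * 3 |v|), and there are 3 partial derivatives. *)
exists (2 * A + 3 * (26 * B)); first by rewrite addr_ge0 ?mulr_ge0.
move=> x y Sx Sy; have [xy1|xy1] := leP `|x - y| 1; last first.
  apply: (@le_trans _ _ (2 * A)).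
    by rewrite (le_trans (ler_normB _ _)) // mulr2n mulrDl mul1r lerD ?hA.
  rewrite -[leLHS]mulr1; apply: ler_pM => //; [exact: mulr_ge0| |exact: ltW].
  by rewrite lerDl !mulr_ge0.
(* The derivatives are only bounded on the sphere: join [y] to [x] by the
   normalization [c] of the segment [z]. *)
have [v vE] : exists v, v = x - y by exists (x - y).
pose z (s : R) := y + s *: v.
pose q s := dot (z s) (z s).
have yv : dot y v = - dot v v / 2.
  move: Sx Sy; rewrite /sphere2 /= vE !dotBr !dotBl (dotC x y) => -> ->.
  by field.
have qE s : q s = 1 - s * (1 - s) * dot v v.
  rewrite /q /z dotDl !dotDr !dotZl !dotZr (dotC v y) yv.
  by move: Sy; rewrite /sphere2 /= => ->; field.
have vv : 0 <= dot v v <= 3.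
  apply/andP; split; first by rewrite dotE; have := sqr_ge0 (v 0 0);
    have := sqr_ge0 (v 0 1); have := sqr_ge0 (v 0 2%:R); rewrite !expr2; lra.
  apply: le_trans (ler_norm _) _; apply: le_trans (dot_norm_le _ _) _.
  by have := normr_ge0 v; move: xy1; rewrite -vE; nra.
(* The segment between two points at sup distance at most 1 avoids the origin, so it can be
   normalized: 1 - 3 / 4 is left of the squared length. *)
have q4 s : 0 <= s <= 1 -> 1 / 4 <= q s.
  rewrite qE => /andP[s0 s1]; case/andP: vv => v0 v3.
  have h0 : 0 <= s * (1 - s) by rewrite mulr_ge0 // subr_ge0.
  have h1 : s * (1 - s) <= 1 / 4 by have := sqr_ge0 (s - 1 / 2); rewrite expr2; lra.
  have := ler_pM h0 v0 h1 v3; lra.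
have z1 s : 0 <= s <= 1 -> `|z s| <= 1.
  move=> /andP[s0 s1]; have -> : z s = (1 - s) *: y + s *: x.
    by rewrite /z vE; apply/rowP => i; rewrite !mxE; ring.
  apply: le_trans (ler_normD _ _) _; rewrite !normrZ !ger0_norm ?subr_ge0 //.
  have := sphere2_norm_le Sx; have := sphere2_norm_le Sy.
  have := normr_ge0 x; have := normr_ge0 y; nra.
have dz i (s : R) : is_derive s 1 (fun s => z s 0 i) (v 0 i).
  have -> : (fun s => z s 0 i) = (fun s => v 0 i * s + y 0 i).
    by apply/funext => t; rewrite /z !mxE addrC mulrC.
  exact: is_derive_affine.
have dq (s : R) : is_derive s 1 q (2 * dot v (z s)).
  have -> : q = (fun s => z s 0 0 * z s 0 0 + z s 0 1 * z s 0 1 + z s 0 2%:R * z s 0 2%:R).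
    by apply/funext => t; rewrite /q dotE.
  have hh i := is_derive_mulE (dz i s) (dz i s).
  apply: (is_derive_eq (is_derive_addE (is_derive_addE (hh 0) (hh 1)) (hh 2%:R))).
  by rewrite dotE; ring.
pose g s := (Num.sqrt (q s))^-1.
pose c s := g s *: z s.
pose dg s := - (Num.sqrt (q s)) ^- 2 * ((2 * Num.sqrt (q s))^-1 * (2 * dot v (z s))).
pose dc s := g s *: v + dg s *: z s.
have sq s : 0 <= s <= 1 -> 1 / 2 <= Num.sqrt (q s).
  move=> s01; rewrite -[leLHS]ger0_norm ?divr_ge0 // -sqrtr_sqr ler_sqrt.
    by apply: le_trans (q4 s s01); lra.
  by have := q4 s s01; lra.
have dgP (s : R) : 0 <= s <= 1 -> is_derive s 1 g (dg s).
  move=> s01; have q0 : 0 < q s by have := q4 s s01; lra.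
  have sn0 : Num.sqrt (q s) != 0 by rewrite gt_eqF // sqrtr_gt0.
  apply: (is_derive_eq (@is_deriveV _ (Num.sqrt \o q) s _ 1 sn0
    (is_derive1_comp (is_derive1_sqrt q0) (dq s)))).
  by [].
have dcP i (s : R) : 0 <= s <= 1 -> is_derive s 1 (fun s => c s 0 i) (dc s 0 i).
  move=> s01; have -> : (fun s => c s 0 i) = (fun s => g s * z s 0 i).
    by apply/funext => t; rewrite /c mxE.
  apply: (is_derive_eq (is_derive_mulE (dgP s s01) (dz i s))).
  by rewrite /dc !mxE; ring.
have cS s : 0 <= s <= 1 -> S2 (c s).
  move=> s01; have q0 : 0 <= q s by have := q4 s s01; lra.
  rewrite /sphere2 /= /c dotZl dotZr -/(q s) mulrA -[X in _ * X](sqr_sqrtr q0) /g.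
  by rewrite expr2 mulrACA mulVf ?mulr1 // gt_eqF //; have := sq s s01; lra.
have dcB s : 0 <= s <= 1 -> `|dc s| <= 26 * `|v|.
  move=> s01; have g2 : 0 <= g s <= 2.
    rewrite invr_ge0 sqrtr_ge0 /= -[leRHS]invrK lef_pV2 ?posrE ?invr_gt0 //.
    - by have := sq s s01; rewrite mul1r.
    - by have := sq s s01; lra.
  have -> : dc s = g s *: v - (g s ^+ 3 * dot v (z s)) *: z s.
    rewrite /dc; congr (_ + _); rewrite -scaleNr; congr (_ *: _).
    rewrite /dg /g; have : Num.sqrt (q s) != 0 by rewrite gt_eqF //; have := sq s s01; lra.
    by move=> ?; field.
  apply: le_trans (ler_normB _ _) _; rewrite (normrZ (g s)) (normrZ (_ * _)) normrM normrX.
  have /andP[g0 _] := g2; rewrite (ger0_norm g0).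
  have h1 : `|dot v (z s)| <= 3 * `|v|.
    apply: le_trans (dot_norm_le _ _) _; have := z1 s s01.
    by have := normr_ge0 v; nra.
  have h2 : g s ^+ 3 <= 8.
    have -> : 8 = 2 ^+ 3 :> R by ring.
    by rewrite lerXn2r ?nnegrE //; case/andP: g2.
  have h3 : g s ^+ 3 * `|dot v (z s)| * `|z s| <= 8 * (3 * `|v|) * 1.
    apply: ler_pM => //; [by rewrite mulr_ge0 // exprn_ge0| |exact: z1].
    by apply: ler_pM => //; rewrite exprn_ge0.
  have : g s * `|v| <= 2 * `|v| by rewrite ler_wpM2r //; case/andP: g2.
  lra.
have hc (s : R) : 0 <= s <= 1 ->
    is_derive s 1 (fun r => h (c r)) (\sum_i dc s 0 i * 'D_(delta_mx 0 i) h (c s)).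
  by move=> s01; apply: is_derive_along => // [|i]; [exact/dh/cS|exact: dcP].
have c0 : c 0 = y.
  by rewrite /c /g qE mul0r mul0r subr0 sqrtr1 invr1 scale1r /z scale0r addr0.
have c1 : c 1 = x.
  rewrite /c /g qE subrr mulr0 mul0r subr0 sqrtr1 invr1 scale1r /z scale1r.
  by rewrite vE subrKC.
have [||r] := @MVT_segment _ (fun r => h (c r))
  (fun s => \sum_i dc s 0 i * 'D_(delta_mx 0 i) h (c s)) 0 1 ler01.
- by move=> s; rewrite in_itv /= => /andP[/ltW s0 /ltW s1]; apply: hc; rewrite s0.
- apply: continuous_in_subspaceT => s /set_mem /=; rewrite in_itv /= => s01.
  apply: differentiable_continuous; apply/derivable1_diffP.
  by have [+ _] := hc s s01.
rewrite in_itv /= c0 c1 subr0 mulr1 => r01 ->.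
apply: (@le_trans _ _ (\sum_(i < 3) (26 * `|v| * B))).
  apply: le_trans (ler_norm_sum _ _ _) _; apply: ler_sum => i _.
  rewrite normrM; apply: ler_pM => //; last exact: hB (cS r r01).
  exact: le_trans (norm_coord_le _ _) (dcB r r01).
rewrite sumr_const card_ord -[leLHS]mulr_natl.
have : 0 <= A * `|v| by rewrite mulr_ge0.
by rewrite -vE; lra.
Qed.

End SphereLipschitz.

(** * Linear algebra in the tangent planes *)

Section Cross.
Variable R : realType.
Notation V := 'rV[R]_3.
Implicit Types (u v w x : V) (G : 'M[R]_3).

Definition cross u v : V := \row_i nth 0
  [:: u 0 1 * v 0 2%:R - u 0 2%:R * v 0 1;
      u 0 2%:R * v 0 0 - u 0 0 * v 0 2%:R;
      u 0 0 * v 0 1 - u 0 1 * v 0 0] i.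

(* [u] times the symmetric part of [G]: a metric is only required to be symmetric
   on tangent vectors. *)
Definition sym_mul G u : V := \row_j \sum_i (G i j + G j i) / 2 * u 0 i.

Lemma row3P u v : u 0 0 = v 0 0 -> u 0 1 = v 0 1 -> u 0 2%:R = v 0 2%:R -> u = v.
Proof.
move=> e0 e1 e2; apply/rowP => -[[|[|[|//]]] p].
- by rewrite (_ : Ordinal p = 0) //; exact/val_inj.
- by rewrite (_ : Ordinal p = 1) //; exact/val_inj.
- by rewrite (_ : Ordinal p = 2%:R) //; exact/val_inj.
Qed.

Lemma rowDE u v i : (u + v) 0 i = u 0 i + v 0 i. Proof. by rewrite mxE. Qed.
Lemma rowZE c u i : (c *: u) 0 i = c * u 0 i. Proof. by rewrite mxE. Qed.
Lemma rowNE u i : (- u) 0 i = - u 0 i. Proof. by rewrite mxE. Qed.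
Definition rowE := (rowDE, rowZE, rowNE).

Lemma cross0 u v : cross u v 0 0 = u 0 1 * v 0 2%:R - u 0 2%:R * v 0 1.
Proof. by rewrite mxE. Qed.
Lemma cross1 u v : cross u v 0 1 = u 0 2%:R * v 0 0 - u 0 0 * v 0 2%:R.
Proof. by rewrite mxE. Qed.
Lemma cross2 u v : cross u v 0 2%:R = u 0 0 * v 0 1 - u 0 1 * v 0 0.
Proof. by rewrite mxE. Qed.
Definition crossE := (cross0, cross1, cross2).

Lemma sum3E (F : 'I_3 -> R) : \sum_i F i = F 0 + F 1 + F 2%:R.
Proof.
rewrite !big_ord_recl big_ord0 addr0 addrA.
by congr (_ + _ + _); congr F; apply/val_inj.
Qed.

Lemma sym_mulE G u j : sym_mul G u 0 j = (G 0 j + G j 0) / 2 * u 0 0 +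
  (G 1 j + G j 1) / 2 * u 0 1 + (G 2%:R j + G j 2%:R) / 2 * u 0 2%:R.
Proof. by rewrite mxE sum3E. Qed.

Lemma bilinE G u w : bilin G u w = \sum_j \sum_i u 0 i * G i j * w 0 j.
Proof.
rewrite /bilin mxE; apply: eq_bigr => j _.
by rewrite !mxE mulr_suml.
Qed.

Lemma bilinDl G u v w : bilin G (u + v) w = bilin G u w + bilin G v w.
Proof. by rewrite /bilin !mulmxDl mxE. Qed.

Lemma bilinDr G u v w : bilin G u (v + w) = bilin G u v + bilin G u w.
Proof. by rewrite /bilin linearD mulmxDr mxE. Qed.

Lemma bilinZl G c u v : bilin G (c *: u) v = c * bilin G u v.
Proof. by rewrite /bilin -!scalemxAl mxE. Qed.

Lemma bilinZr G c u v : bilin G u (c *: v) = c * bilin G u v.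
Proof. by rewrite /bilin linearZ /= -scalemxAr mxE. Qed.

Lemma bilinNl G u v : bilin G (- u) v = - bilin G u v.
Proof. by rewrite -scaleN1r bilinZl mulN1r. Qed.

Lemma bilinNr G u v : bilin G u (- v) = - bilin G u v.
Proof. by rewrite -scaleN1r bilinZr mulN1r. Qed.

Lemma dot_sym_mul G u w : 2 * dot (sym_mul G u) w = bilin G u w + bilin G w u.
Proof. rewrite dotE !sym_mulE !bilinE !sum3E; by field. Qed.

(* [x adj(S) x^T], where [S] is the symmetric part of [G]; for a unit vector [x]
   it is the Gram determinant of [S] on the plane orthogonal to [x]. *)
Definition cofactor_form G x : R :=
  x 0 0 ^+ 2 * (G 1 1 * G 2%:R 2%:R - ((G 1 2%:R + G 2%:R 1) / 2) ^+ 2)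
  + x 0 1 ^+ 2 * (G 0 0 * G 2%:R 2%:R - ((G 0 2%:R + G 2%:R 0) / 2) ^+ 2)
  + x 0 2%:R ^+ 2 * (G 0 0 * G 1 1 - ((G 0 1 + G 1 0) / 2) ^+ 2)
  + 2 * x 0 0 * x 0 1 * ((G 0 2%:R + G 2%:R 0) / 2 * ((G 1 2%:R + G 2%:R 1) / 2)
      - (G 0 1 + G 1 0) / 2 * G 2%:R 2%:R)
  + 2 * x 0 0 * x 0 2%:R * ((G 0 1 + G 1 0) / 2 * ((G 1 2%:R + G 2%:R 1) / 2)
      - (G 0 2%:R + G 2%:R 0) / 2 * G 1 1)
  + 2 * x 0 1 * x 0 2%:R * ((G 0 1 + G 1 0) / 2 * ((G 0 2%:R + G 2%:R 0) / 2)
      - (G 1 2%:R + G 2%:R 1) / 2 * G 0 0).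

Lemma cofactor_formZ G c x : cofactor_form G (c *: x) = c ^+ 2 * cofactor_form G x.
Proof. by rewrite /cofactor_form !mxE; ring. Qed.

(** The Cauchy-Binet formula: [cross u v] lists the minors of the pair (u, v). *)
Lemma gram_cofactor_form G u v :
  dot (sym_mul G u) u * dot (sym_mul G v) v - dot (sym_mul G u) v ^+ 2
  = cofactor_form G (cross u v).
Proof. rewrite /cofactor_form !dotE !sym_mulE !crossE; by field. Qed.

(** Writing a tangent vector as [cross x t] frees it of the constraint [dot x u = 0], so that the
    identities below become polynomial identities that [ring] and [field] can prove. *)
Lemma cross_tangent x u : dot x x = 1 -> dot x u = 0 -> u = cross x (cross u x).
Proof.
move=> xx xu; rewrite -[u in LHS]scale1r -xx -[RHS]addr0 -[X in _ + X](scale0r x) -xu.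
by apply: row3P; rewrite !rowE !crossE !dotE; ring.
Qed.

Lemma dot_cross_l x u : dot x (cross x u) = 0.
Proof. by rewrite dotE !crossE; ring. Qed.

Lemma crossC u v : cross u v = - cross v u.
Proof. by apply: row3P; rewrite [in RHS]mxE !crossE; ring. Qed.

Lemma cross_cross_tangent x u v : dot x x = 1 -> dot x u = 0 -> dot x v = 0 ->
  cross u v = dot x (cross u v) *: x.
Proof.
move=> xx xu xv; rewrite (cross_tangent xx xu) (cross_tangent xx xv).
set p := cross u x; set q := cross v x.
have -> : dot x (cross (cross x p) (cross x q)) = dot x (cross p q).
  transitivity (dot x x * dot x (cross p q)); last by rewrite xx mul1r.
  by rewrite !dotE !crossE; ring.
by apply: row3P; rewrite [in RHS]mxE dotE !crossE; ring.
Qed.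

Lemma gram_tangent G x u v : dot x x = 1 -> dot x u = 0 -> dot x v = 0 ->
  dot (sym_mul G u) u * dot (sym_mul G v) v - dot (sym_mul G u) v ^+ 2
  = dot x (cross u v) ^+ 2 * cofactor_form G x.
Proof.
move=> xx xu xv; rewrite gram_cofactor_form (cross_cross_tangent xx xu xv).
by rewrite cofactor_formZ -(cross_cross_tangent xx xu xv).
Qed.

(** On the tangent plane of a metric [G], the map sending [u] to [cross x (sym_mul G u)] is the
    rotation by a right angle up to the factor sqrt (cofactor_form G x). *)
Lemma rotation_square G x u : dot x x = 1 -> dot x u = 0 ->
  cross x (sym_mul G (cross x (sym_mul G u))) = - cofactor_form G x *: u.
Proof.
move=> xx xu; rewrite (cross_tangent xx xu); set t := cross u x.
apply: row3P; rewrite [in RHS]mxE /cofactor_form !(crossE, sym_mulE); by field.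
Qed.

Lemma rotation_adjoint G x u v : dot x x = 1 -> dot x u = 0 -> dot x v = 0 ->
  dot (sym_mul G u) (cross x (sym_mul G v)) =
  - cofactor_form G x * dot x (cross u v).
Proof.
move=> xx xu xv.
have -> : dot (sym_mul G u) (cross x (sym_mul G v)) =
    - dot x (cross (sym_mul G u) (sym_mul G v)).
  by rewrite !dotE !crossE; ring.
rewrite (cross_tangent xx xu) (cross_tangent xx xv).
set p := cross u x; set q := cross v x.
have -> : dot x (cross (cross x p) (cross x q)) = dot x (cross p q).
  transitivity (dot x x * dot x (cross p q)); last by rewrite xx mul1r.
  by rewrite !dotE !crossE; ring.
rewrite /cofactor_form !dotE !(crossE, sym_mulE); by field.
Qed.

Lemma frame_decomposition G x e t : dot x x = 1 -> dot x e = 0 -> dot x t = 0 ->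
  dot (sym_mul G e) e *: t =
  dot (sym_mul G e) t *: e + dot x (cross e t) *: cross x (sym_mul G e).
Proof.
move=> xx xe xt; rewrite (cross_tangent xx xe) (cross_tangent xx xt).
set p := cross e x; set q := cross t x.
have -> : dot x (cross (cross x p) (cross x q)) = dot x (cross p q).
  transitivity (dot x x * dot x (cross p q)); last by rewrite xx mul1r.
  by rewrite !dotE !crossE; ring.
apply: row3P; rewrite !rowE !dotE !(crossE, sym_mulE); by field.
Qed.

Lemma det_rows x u v :
  \det (\matrix_(i < 3) nth 0 [:: x; u; v] i) = dot x (cross u v).
Proof.
rewrite (expand_det_row _ 0) sum3E /cofactor.
rewrite !(expand_det_row _ ord0) !big_ord_recl !big_ord0 /cofactor !det_mx11 !mxE /=.
rewrite dotE !crossE.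
have -> : lift (0 : 'I_3) (ord0 : 'I_2) = 1 by exact/val_inj.
have -> : lift (0 : 'I_3) (lift (ord0 : 'I_2) (0 : 'I_1)) = 2%:R by exact/val_inj.
have -> : lift (0 : 'I_3) (lift (lift (ord0 : 'I_2) (ord0 : 'I_1)) (0 : 'I_1)) = 1
  by exact/val_inj.
have -> : lift (1 : 'I_3) (ord0 : 'I_2) = 0 by exact/val_inj.
have -> : lift (1 : 'I_3) (lift (ord0 : 'I_2) (0 : 'I_1)) = 2%:R by exact/val_inj.
have -> : lift (1 : 'I_3) (lift (lift (ord0 : 'I_2) (ord0 : 'I_1)) (0 : 'I_1)) = 0
  by exact/val_inj.
have -> : lift (2%:R : 'I_3) (ord0 : 'I_2) = 0 by exact/val_inj.
have -> : lift (2%:R : 'I_3) (lift (ord0 : 'I_2) (0 : 'I_1)) = 1 by exact/val_inj.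
have -> : lift (2%:R : 'I_3) (lift (lift (ord0 : 'I_2) (ord0 : 'I_1)) (0 : 'I_1)) = 0
  by exact/val_inj.
rewrite (_ : (0 + bump 0 0)%N = 1%N) //.
rewrite (_ : (0 + (1 %% 3 + 1 %% 3) %% 3)%N = 2%N) // addn0 expr0 expr1 sqrrN expr1n.
by ring.
Qed.

End Cross.

(** * Bounded Lipschitz functions and their stability under algebraic operations *)

Section BoundedLipschitz.
Variables (R : realType) (T : Type) (dist : T -> T -> R) (A : set T).
Hypothesis dist_ge0 : forall p q, 0 <= dist p q.
Implicit Types phi psi : T -> R.

(* Bounded and Lipschitz on [A]. *)
Definition blip phi : Prop := exists2 C : R, 0 <= C & forall p q, A p -> A q ->
  `|phi p| <= C /\ `|phi p - phi q| <= C * dist p q.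

Lemma blip_cst c : blip (fun=> c).
Proof.
exists `|c| => // p q _ _; split => //.
by rewrite subrr normr0 mulr_ge0.
Qed.

Lemma blipD phi psi : blip phi -> blip psi -> blip (fun p => phi p + psi p).
Proof.
move=> [C C0 h] [D D0 k]; exists (C + D); first exact: addr_ge0.
move=> p q Ap Aq; have [h1 h2] := h p q Ap Aq; have [k1 k2] := k p q Ap Aq.
split; first by rewrite (le_trans (ler_normD _ _)) // lerD.
by rewrite opprD addrACA (le_trans (ler_normD _ _)) // mulrDl lerD.
Qed.

Lemma blipN phi : blip phi -> blip (fun p => - phi p).
Proof.
move=> [C C0 h]; exists C => // p q Ap Aq; have [h1 h2] := h p q Ap Aq.
by rewrite -opprD !normrN.
Qed.

Lemma blipB phi psi : blip phi -> blip psi -> blip (fun p => phi p - psi p).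
Proof. by move=> h k; apply: blipD => //; exact: blipN. Qed.

Lemma blipM phi psi : blip phi -> blip psi -> blip (fun p => phi p * psi p).
Proof.
move=> [C C0 h] [D D0 k]; exists (2 * (C * D)); first by rewrite !mulr_ge0.
move=> p q Ap Aq; have [h1 h2] := h p q Ap Aq; have [k1 k2] := k p q Ap Aq.
have [h3 _] := h q q Aq Aq.
split.
  rewrite normrM; have : `|phi p| * `|psi p| <= C * D by apply: ler_pM.
  have : 0 <= C * D by rewrite mulr_ge0.
  lra.
have -> : phi p * psi p - phi q * psi q =
    (phi p - phi q) * psi p + phi q * (psi p - psi q) by ring.
apply: le_trans (ler_normD _ _) _; rewrite !normrM.
have : `|phi p - phi q| * `|psi p| <= C * dist p q * D by apply: ler_pM.
have : `|phi q| * `|psi p - psi q| <= C * (D * dist p q) by apply: ler_pM.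
lra.
Qed.

Lemma blipV phi c : 0 < c -> (forall p, A p -> c <= phi p) -> blip phi ->
  blip (fun p => (phi p)^-1).
Proof.
move=> c0 hc [C C0 h]; exists (c^-1 + C * c^-1 ^+ 2).
  by rewrite addr_ge0 ?mulr_ge0 ?exprn_ge0 ?invr_ge0 // ltW.
move=> p q Ap Aq; have [_ h2] := h p q Ap Aq.
have hp := hc p Ap; have hq := hc q Aq.
have p0 : 0 < phi p by exact: lt_le_trans hp.
have q0 : 0 < phi q by exact: lt_le_trans hq.
have ip : (phi p)^-1 <= c^-1 by rewrite lef_pV2 ?posrE.
have iq : (phi q)^-1 <= c^-1 by rewrite lef_pV2 ?posrE.
have cc : 0 <= C * c^-1 ^+ 2 by rewrite mulr_ge0 // exprn_ge0 // invr_ge0 ltW.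
split; first by rewrite gtr0_norm ?invr_gt0 //; lra.
have -> : (phi p)^-1 - (phi q)^-1 = - (phi p - phi q) * ((phi p)^-1 * (phi q)^-1).
  by field; rewrite !gt_eqF.
rewrite normrM normrN (gtr0_norm (x := _^-1 * _)) ?mulr_gt0 ?invr_gt0 //.
have : `|phi p - phi q| * ((phi p)^-1 * (phi q)^-1) <= C * dist p q * (c^-1 * c^-1).
  apply: ler_pM => //; first by rewrite mulr_ge0 ?invr_ge0 // ltW.
  by apply: ler_pM => //; rewrite invr_ge0 ltW.
have : 0 <= c^-1 * dist p q by rewrite mulr_ge0 // invr_ge0 ltW.
rewrite expr2; lra.
Qed.

Lemma blip_sqrt phi c : 0 < c -> (forall p, A p -> c <= phi p) -> blip phi ->
  blip (fun p => Num.sqrt (phi p)).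
Proof.
move=> c0 hc [C C0 h]; pose s := Num.sqrt c.
have s0 : 0 < s by rewrite sqrtr_gt0.
exists (1 + C + C * s^-1); first by rewrite !addr_ge0 ?mulr_ge0 ?invr_ge0 // ltW.
move=> p q Ap Aq; have [h1 h2] := h p q Ap Aq.
have hp := hc p Ap; have hq := hc q Aq.
have p0 : 0 < phi p by exact: lt_le_trans hp.
have q0 : 0 < phi q by exact: lt_le_trans hq.
have Cs : 0 <= C * s^-1 by rewrite mulr_ge0 // invr_ge0 ltW.
split.
  rewrite ger0_norm ?sqrtr_ge0 //; have := sqr_sqrtr (ltW p0).
  have := sqrtr_ge0 (phi p); move: h1; rewrite (gtr0_norm p0).
  set r := Num.sqrt _ => r1 r2 r3.
  have : r <= 1 + r ^+ 2 by have := sqr_ge0 (r - 1); rewrite !expr2; lra.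
  lra.
have sp : s <= Num.sqrt (phi p) by rewrite ler_sqrt // ltW.
have sq : s <= Num.sqrt (phi q) by rewrite ler_sqrt // ltW.
have E : Num.sqrt (phi p) - Num.sqrt (phi q) =
    (phi p - phi q) * (Num.sqrt (phi p) + Num.sqrt (phi q))^-1.
  rewrite -[in phi p - _](sqr_sqrtr (ltW p0)) -[in _ - phi q](sqr_sqrtr (ltW q0)).
  by field; rewrite gt_eqF //; lra.
rewrite E normrM (gtr0_norm (x := _^-1)); last by rewrite invr_gt0; lra.
have : `|phi p - phi q| * (Num.sqrt (phi p) + Num.sqrt (phi q))^-1 <= C * dist p q * s^-1.
  apply: ler_pM => //.
  by rewrite lef_pV2 ?posrE //; lra.
have : 0 <= C * dist p q by rewrite mulr_ge0.
have := dist_ge0 p q; lra.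
Qed.

Lemma blip_sum (F : 'I_3 -> T -> R) : (forall i, blip (F i)) ->
  blip (fun p => \sum_i F i p).
Proof.
move=> h; have -> : (fun p => \sum_i F i p) = (fun p => F 0 p + F 1 p + F 2%:R p).
  by apply/funext => p; rewrite sum3E.
by apply: blipD => //; apply: blipD.
Qed.

Definition blip_vec (F : T -> 'rV[R]_3) := forall i, blip (fun p => F p 0 i).

Lemma blip_vecP (F : T -> 'rV[R]_3) : blip (fun p => F p 0 0) ->
  blip (fun p => F p 0 1) -> blip (fun p => F p 0 2%:R) -> blip_vec F.
Proof.
move=> h0 h1 h2 -[[|[|[|//]]] p].
- by rewrite (_ : Ordinal p = 0) //; exact/val_inj.
- by rewrite (_ : Ordinal p = 1) //; exact/val_inj.
- by rewrite (_ : Ordinal p = 2%:R) //; exact/val_inj.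
Qed.

Lemma blip_eq phi psi : (forall p, phi p = psi p) -> blip phi -> blip psi.
Proof. by move=> e; rewrite (_ : phi = psi) //; exact/funext. Qed.

Lemma blip_cross F1 F2 : blip_vec F1 -> blip_vec F2 ->
  blip_vec (fun p => cross (F1 p) (F2 p)).
Proof.
move=> h k; apply: blip_vecP.
- apply: (@blip_eq (fun p => F1 p 0 1 * F2 p 0 2%:R - F1 p 0 2%:R * F2 p 0 1)).
    by move=> p; rewrite crossE.
  by apply: blipB; apply: blipM.
- apply: (@blip_eq (fun p => F1 p 0 2%:R * F2 p 0 0 - F1 p 0 0 * F2 p 0 2%:R)).
    by move=> p; rewrite crossE.
  by apply: blipB; apply: blipM.
- apply: (@blip_eq (fun p => F1 p 0 0 * F2 p 0 1 - F1 p 0 1 * F2 p 0 0)).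
    by move=> p; rewrite crossE.
  by apply: blipB; apply: blipM.
Qed.

Lemma blip_dot F1 F2 : blip_vec F1 -> blip_vec F2 -> blip (fun p => dot (F1 p) (F2 p)).
Proof. by move=> h k; apply: blip_sum => i; apply: blipM. Qed.

Lemma blip_vecZ phi F : blip phi -> blip_vec F -> blip_vec (fun p => phi p *: F p).
Proof.
move=> h k i; apply: (@blip_eq (fun p => phi p * F p 0 i)); last exact: blipM.
by move=> p; rewrite mxE.
Qed.

Lemma blip_vecD F1 F2 : blip_vec F1 -> blip_vec F2 -> blip_vec (fun p => F1 p + F2 p).
Proof.
move=> h k i; apply: (@blip_eq (fun p => F1 p 0 i + F2 p 0 i)); last exact: blipD.
by move=> p; rewrite mxE.
Qed.

Lemma blip_vecN F : blip_vec F -> blip_vec (fun p => - F p).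
Proof.
move=> h i; apply: (@blip_eq (fun p => - F p 0 i)); last exact: blipN.
by move=> p; rewrite mxE.
Qed.

Lemma blip_sym_mul (G : T -> 'M[R]_3) F : (forall i j, blip (fun p => G p i j)) ->
  blip_vec F -> blip_vec (fun p => sym_mul (G p) (F p)).
Proof.
move=> h k j.
apply: (@blip_eq (fun p => \sum_i (G p i j + G p j i) / 2 * F p 0 i)).
  by move=> p; rewrite mxE.
apply: blip_sum => i; apply: blipM => //; apply: blipM; last exact: blip_cst.
exact: blipD.
Qed.

Lemma blip_bilin (G : T -> 'M[R]_3) F1 F2 : (forall i j, blip (fun p => G p i j)) ->
  blip_vec F1 -> blip_vec F2 -> blip (fun p => bilin (G p) (F1 p) (F2 p)).
Proof.
move=> h k l.
apply: (@blip_eq (fun p => \sum_j \sum_i F1 p 0 i * G p i j * F2 p 0 j)).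
  by move=> p; rewrite bilinE.
by apply: blip_sum => j; apply: blip_sum => i; apply: blipM => //; apply: blipM.
Qed.

Lemma blip_cofactor_form (G : T -> 'M[R]_3) F : (forall i j, blip (fun p => G p i j)) ->
  blip_vec F -> blip (fun p => cofactor_form (G p) (F p)).
Proof.
move=> h k; have hc := blip_cst.
have hX phi : blip phi -> blip (fun p => phi p ^+ 2) by move=> ?; apply: blipM.
by rewrite /cofactor_form; repeat (first [exact: h|exact: k|exact: hc|apply: blipB|
  apply: blipD|apply: hX|apply: blipM]).
Qed.

Lemma blip_vec_bound F : blip_vec F -> exists2 C : R, 0 <= C & forall p q, A p -> A q ->
  `|F p| <= C /\ `|F p - F q| <= C * dist p q.
Proof.
move=> h; have [C0 c0 h0] := h 0; have [C1 c1 h1] := h 1; have [C2 c2 h2] := h 2%:R.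
exists (C0 + C1 + C2); first by rewrite !addr_ge0.
move=> p q Ap Aq.
have [h01 h02] := h0 p q Ap Aq; have [h11 h12] := h1 p q Ap Aq.
have [h21 h22] := h2 p q Ap Aq; have d0 := dist_ge0 p q.
have e0 : 0 <= C0 * dist p q by rewrite mulr_ge0.
have e1 : 0 <= C1 * dist p q by rewrite mulr_ge0.
have e2 : 0 <= C2 * dist p q by rewrite mulr_ge0.
split; apply: norm_le_coord => -[[|[|[|//]]] pi].
- by rewrite (_ : Ordinal pi = 0); [lra|exact/val_inj].
- by rewrite (_ : Ordinal pi = 1); [lra|exact/val_inj].
- by rewrite (_ : Ordinal pi = 2%:R); [lra|exact/val_inj].
- by rewrite (_ : Ordinal pi = 0) ?mxE; [lra|exact/val_inj].
- by rewrite (_ : Ordinal pi = 1) ?mxE; [lra|exact/val_inj].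
- by rewrite (_ : Ordinal pi = 2%:R) ?mxE; [lra|exact/val_inj].
Qed.

End BoundedLipschitz.

(** * The equation of motion *)

Section SmoothEntries.
Variable R : realType.
Notation V := 'rV[R]_3.
Notation S2 := (@sphere2 R).

(** [dh] stands for the partial derivatives but has to agree with them only on [U], as do the
    entries of the next iterated derivative. As [U] is open, continuity carries over. *)
Lemma smooth_scalar_lipschitz (U : set V) (h : V -> R^o) (dh : 'I_3 -> V -> R^o) :
  open U -> S2 `<=` U -> (forall x, U x -> differentiable h x) ->
  (forall i x, U x -> 'D_(delta_mx 0 i) h x = dh i x) ->
  (forall i x, U x -> differentiable (dh i) x) ->
  exists2 C : R, 0 <= C & forall x y, S2 x -> S2 y ->
    `|h x| <= C /\ `|h x - h y| <= C * `|x - y|.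
Proof.
move=> oU SU dh0 Dh ddh.
have [C C0 hC] : exists2 C : R, 0 <= C & forall x y, S2 x -> S2 y ->
    `|h x - h y| <= C * `|x - y|.
  apply: sphere2_lipschitz => [x /SU|i x /SU Ux]; first exact: dh0.
  have e : {near x, dh i =1 'D_(delta_mx 0 i) h}.
    have := open_nbhs_nbhs (conj oU Ux); apply: filterS => y Uy.
    by rewrite Dh.
  apply: cvg_trans (near_eq_cvg e) _.
  rewrite Dh //; exact: differentiable_continuous (ddh i x Ux).
have [B B0 hB] : exists2 B : R, 0 <= B & forall x, S2 x -> `|h x| <= B.
  apply: continuous_sphere2_bounded => x /SU Ux.
  exact: differentiable_continuous (dh0 x Ux).
exists (B + C); first exact: addr_ge0.
move=> x y Sx Sy; have := hB x Sx; have := hC x y Sx Sy.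
have : 0 <= B * `|x - y| by rewrite mulr_ge0.
by split; lra.
Qed.

Lemma smooth_entry (U : set V) (F : V -> 'M[R]_3) (vs : seq V) (x v : V) i j :
  smooth_on U F -> U x ->
  differentiable (fun y => iter_derive F vs y i j : R^o) x /\
  'D_v (fun y => iter_derive F vs y i j : R^o) x = iter_derive F (v :: vs) x i j.
Proof.
move=> sF Ux; have d := sF vs x Ux.
split; first exact: (differentiable_comp d (differentiable_coord _ _ _)).
by rewrite /= (derive_mx (diff_derivable d)) mxE.
Qed.

Lemma smooth_entry_lipschitz (F : V -> 'M[R]_3) (vs : seq V) i j :
  smooth_near_sphere2 F ->
  exists2 C : R, 0 <= C & forall x y, S2 x -> S2 y ->
    `|iter_derive F vs x i j| <= C /\
    `|iter_derive F vs x i j - iter_derive F vs y i j| <= C * `|x - y|.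
Proof.
move=> [U [oU SU sF]].
apply: (@smooth_scalar_lipschitz U _
  (fun k y => iter_derive F (delta_mx 0 k :: vs) y i j)) => //.
- by move=> x Ux; exact: (smooth_entry vs 0 i j sF Ux).1.
- by move=> k x Ux; exact: (smooth_entry vs _ i j sF Ux).2.
- by move=> k x Ux; exact: (smooth_entry (_ :: vs) 0 i j sF Ux).1.
Qed.

Lemma smooth_function_lipschitz (f : V -> R) : smooth_near_sphere2 (W := R^o) f ->
  exists2 C : R, 0 <= C & forall x y, S2 x -> S2 y ->
    `|f x| <= C /\ `|f x - f y| <= C * `|x - y|.
Proof.
move=> [U [oU SU sf]].
apply: (@smooth_scalar_lipschitz U f
  (fun k y => iter_derive (f : V -> R^o) [:: delta_mx 0 k] y)) => //.
- by move=> x Ux; exact: (sf [::] x Ux).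
- by move=> k x Ux; exact: (sf [:: _] x Ux).
Qed.

End SmoothEntries.

Section Force.
Variables (R : realType) (M : symplectic_magnetic_system R).
Notation V := 'rV[R]_3.
Notation G := (ms_metric M).
Notation f := (ms_f M).
Notation S2 := (@sphere2 R).

Definition dmetric (k : 'I_3) (x : V) : 'M[R]_3 := 'D_(delta_mx 0 k) G x.

Definition metric_derivative (x z u w : V) : R :=
  \sum_k z 0 k * bilin (dmetric k x) u w.

Lemma metric_sym x u w : S2 x -> dot x u = 0 -> dot x w = 0 ->
  metric M x u w = metric M x w u.
Proof. by move=> Sx xu xw; have [_ + _] := ms_metricP M; exact. Qed.

Lemma metric_pos x u : S2 x -> dot x u = 0 -> u != 0 -> 0 < metric M x u u.
Proof. by move=> Sx xu u0; have [_ _ +] := ms_metricP M; exact. Qed.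

Lemma metric_sym_mul x u w : S2 x -> dot x u = 0 -> dot x w = 0 ->
  metric M x u w = dot (sym_mul (G x) u) w.
Proof.
move=> Sx xu xw; have := dot_sym_mul (G x) u w.
by have := metric_sym Sx xu xw; rewrite /metric => ->; lra.
Qed.

(** By [gram_tangent], the square of the ratio of [g]-area to Euclidean area on the sphere. *)
Definition area_density_sq (x : V) : R := cofactor_form (G x) x.

Lemma area_density_sq_gt0 x : S2 x -> 0 < area_density_sq x.
Proof.
move=> Sx; have xx : dot x x = 1 by [].
have [u xu u0] : exists2 u : V, dot x u = 0 & u != 0.
  have [e|] := eqVneq (cross x (delta_mx 0 0)) 0; last first.
    by exists (cross x (delta_mx 0 0)) => //; exact: dot_cross_l.
  have [e'|] := eqVneq (cross x (delta_mx 0 1)) 0; last first.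
    by exists (cross x (delta_mx 0 1)) => //; exact: dot_cross_l.
  exfalso.
  have h (i j : 'I_3) : cross x (delta_mx 0 0) 0 i = 0 /\ cross x (delta_mx 0 1) 0 j = 0.
    by rewrite e e' !mxE.
  have [+ _] := h 1 0; have [+ _] := h 2%:R 0; have [_ +] := h 0 2%:R.
  rewrite !crossE !mxE /= !mulr1 !mulr0 !subr0 !sub0r => /eqP.
  rewrite ?oppr_eq0 => /eqP x0 /eqP; rewrite ?oppr_eq0 => /eqP x1 /eqP.
  rewrite ?oppr_eq0 => /eqP x2.
  by have := xx; rewrite dotE x0 x1 x2 !mulr0 !addr0 => /esym/eqP; rewrite oner_eq0.
pose v := cross x u; have xv : dot x v = 0 by exact: dot_cross_l.
have uv : dot u v = 0 by rewrite /v dotE !crossE; ring.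
have vn0 : v != 0.
  apply: contraNneq u0 => v0; rewrite (cross_tangent xx xu) (crossC u x) -/v v0.
  by apply/eqP; apply: row3P; rewrite !crossE !mxE; ring.
have muu := metric_pos Sx xu u0.
(* Gram-Schmidt: [w] is orthogonal to [u], and its squared length is the Gram determinant of (u, v)
   times that of [u]. *)
pose w := metric M x u u *: v - metric M x u v *: u.
have xw : dot x w = 0 by rewrite /w dotBr !dotZr xu xv; ring.
have wn0 : w != 0.
  apply: contraNneq vn0 => w0.
  have : dot v w = 0 by rewrite w0 dotE !mxE; ring.
  rewrite /w dotBr !dotZr (dotC v u) uv mulr0 subr0 => /eqP.
  rewrite mulf_eq0 gt_eqF //= => /eqP vv.
  apply/eqP; apply: row3P; rewrite [RHS]mxE; move: vv; rewrite dotE;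
    have := sqr_ge0 (v 0 0); have := sqr_ge0 (v 0 1); have := sqr_ge0 (v 0 2%:R);
    rewrite !expr2 => h1 h2 h3 h4.
  - have /eqP : v 0 0 * v 0 0 = 0 by lra.
    by rewrite mulf_eq0 orbb => /eqP.
  - have /eqP : v 0 1 * v 0 1 = 0 by lra.
    by rewrite mulf_eq0 orbb => /eqP.
  - have /eqP : v 0 2%:R * v 0 2%:R = 0 by lra.
    by rewrite mulf_eq0 orbb => /eqP.
have := metric_pos Sx xw wn0.
have -> : metric M x w w = metric M x u u *
   (metric M x u u * metric M x v v - metric M x u v ^+ 2).
  rewrite /w /metric !(bilinDl, bilinDr, bilinNl, bilinNr, bilinZl, bilinZr).
  have := metric_sym Sx xv xu; rewrite /metric => ->; ring.
rewrite pmulr_rgt0 //.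
rewrite (metric_sym_mul Sx xu xu) (metric_sym_mul Sx xv xv) (metric_sym_mul Sx xu xv).
rewrite (gram_tangent (G x) xx xu xv) /area_density_sq => h.
have : 0 <= dot x (cross u v) ^+ 2 by exact: sqr_ge0.
by move: h; set a := _ ^+ 2; set b := cofactor_form _ _ => ab a0;
  rewrite ltNge; apply/negP => b0; move: ab; rewrite ltNge mulr_ge0_le0.
Qed.

Definition orientation_sign : R := (-1) ^+ ms_orient M.

Definition area_density (x : V) : R := Num.sqrt (area_density_sq x).

(** The sign of the determinant and the square root of its square recombine into the determinant, so
    the area form is visibly bilinear. *)
Lemma area_formE x u v : S2 x -> dot x u = 0 -> dot x v = 0 ->
  area_form M x u v = orientation_sign * area_density x * dot x (cross u v).
Proof.
move=> Sx xu xv; rewrite /area_form det_rows.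
rewrite (metric_sym_mul Sx xu xu) (metric_sym_mul Sx xv xv) (metric_sym_mul Sx xu xv).
rewrite (gram_tangent (G x) Sx xu xv) sqrtrM ?sqr_ge0 // sqrtr_sqr.
rewrite -/(area_density_sq x) -/(area_density x) -/orientation_sign.
rewrite [X in _ = _ * X]numEsg; ring.
Qed.

Lemma is_derive_comp_fst (g : V -> R^o) (p xi : V * V) (dg : R) :
  is_derive p.1 xi.1 g dg -> is_derive p xi (fun q : V * V => g q.1 : R^o) dg.
Proof. by move=> [d e]; split; [move: d|move: e]; rewrite /derivable /derive /=. Qed.

Lemma is_derive_comp_snd (g : V -> R^o) (p xi : V * V) (dg : R) :
  is_derive p.2 xi.2 g dg -> is_derive p xi (fun q : V * V => g q.2 : R^o) dg.
Proof. by move=> [d e]; split; [move: d|move: e]; rewrite /derivable /derive /=. Qed.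

Lemma is_derive_vcoord (p xi : V * V) (i : 'I_3) :
  is_derive p xi (fun q : V * V => q.2 0 i : R^o) (xi.2 0 i).
Proof.
have d : derivable (fun v : V => v 0 i : R^o) p.2 xi.2.
  exact: diff_derivable (differentiable_coord _ _ _).
have e : 'D_(xi.2) (fun v : V => v 0 i : R^o) p.2 = xi.2 0 i.
  have := derive_mx (@derivable_id _ _ p.2 xi.2).
  by rewrite derive_id => /(congr1 (fun N : V => N 0 i)); rewrite mxE.
by apply: (@is_derive_comp_snd (fun v => v 0 i)); split.
Qed.

Lemma metric_entry_differentiable x i j : S2 x ->
  differentiable (fun y => G y i j : R^o) x.
Proof.
move=> Sx; have [[U [oU SU sG]] _ _] := ms_metricP M.
exact: (smooth_entry [::] 0 i j sG (SU x Sx)).1.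
Qed.

Lemma metric_entry_derive x z i j : S2 x ->
  'D_z (fun y => G y i j : R^o) x = \sum_k z 0 k * dmetric k x i j.
Proof.
move=> Sx; have d := metric_entry_differentiable i j Sx.
rewrite deriveE // diff_coord //; apply: eq_bigr => k _; congr (_ * _).
have [[U [oU SU sG]] _ _] := ms_metricP M.
exact: (smooth_entry [::] (delta_mx 0 k) i j sG (SU x Sx)).2.
Qed.

Lemma is_derive_metric_entry (p xi : V * V) i j : S2 p.1 ->
  is_derive p xi (fun q : V * V => G q.1 i j : R^o)
    (\sum_k xi.1 0 k * dmetric k p.1 i j).
Proof.
move=> Sp; rewrite -(metric_entry_derive _ _ _ Sp).
have d : derivable (fun y => G y i j : R^o) p.1 xi.1.
  exact: diff_derivable (metric_entry_differentiable _ _ Sp).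
by apply: (@is_derive_comp_fst (fun y => G y i j)); split.
Qed.

Lemma metric_derivativeE x z u w : metric_derivative x z u w =
  \sum_j \sum_i u 0 i * (\sum_k z 0 k * dmetric k x i j) * w 0 j.
Proof.
rewrite /metric_derivative; under eq_bigr do rewrite bilinE mulr_sumr.
rewrite exchange_big; apply: eq_bigr => j _.
under eq_bigr do rewrite mulr_sumr.
rewrite exchange_big; apply: eq_bigr => i _.
rewrite mulr_sumr mulr_suml; apply: eq_bigr => k _; ring.
Qed.

Lemma is_derive_lambda (p xi eta : V * V) : S2 p.1 ->
  is_derive p xi (fun q : V * V => lambda M q eta : R^o)
    (metric_derivative p.1 xi.1 p.2 eta.1 + metric M p.1 xi.2 eta.1).
Proof.
move=> Sp.
have -> : (fun q : V * V => lambda M q eta : R^o) =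
   \sum_j \sum_i (fun q : V * V => (q.2 0 i : R^o) * (G q.1 i j) * (eta.1 0 j)).
  apply/funext => q; rewrite /lambda /metric bilinE fct_sumE; apply: eq_bigr => j _.
  by rewrite fct_sumE.
apply: is_derive_eq.
  apply: is_derive_sum => j; apply: is_derive_sum => i.
  exact: (is_deriveM (is_deriveM (is_derive_vcoord p xi i)
    (is_derive_metric_entry xi i j Sp)) (is_derive_cst (eta.1 0 j : R^o) p xi)).
rewrite metric_derivativeE /metric bilinE -big_split; apply: eq_bigr => j _.
rewrite -big_split; apply: eq_bigr => i _.
by rewrite /GRing.scale /=; ring.
Qed.

Lemma derive_energy (p eta : V * V) : S2 p.1 ->
  'D_eta (energy M : V * V -> R^o) p =
  (metric_derivative p.1 eta.1 p.2 p.2 + metric M p.1 eta.2 p.2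
    + metric M p.1 p.2 eta.2) / 2.
Proof.
move=> Sp.
have E : (energy M : V * V -> R^o) = \sum_j \sum_i
    (fun q : V * V => (q.2 0 i : R^o) * (G q.1 i j) * (q.2 0 j) * (2^-1)).
  apply/funext => q; rewrite /energy /metric bilinE fct_sumE mulr_suml.
  by apply: eq_bigr => j _; rewrite fct_sumE mulr_suml.
rewrite E; apply: derive_val.
apply: is_derive_eq.
  apply: is_derive_sum => j; apply: is_derive_sum => i.
  exact: (is_deriveM (is_deriveM (is_deriveM (is_derive_vcoord p eta i)
    (is_derive_metric_entry eta i j Sp)) (is_derive_vcoord p eta j))
    (is_derive_cst (2^-1 : R^o) p eta)).
rewrite metric_derivativeE /metric !bilinE -!big_split /= mulr_suml; apply: eq_bigr => j _.
rewrite -!big_split /= mulr_suml; apply: eq_bigr => i _.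
by rewrite !fctE /GRing.scale /=; ring.
Qed.

Lemma metric_derivative0 x u w : metric_derivative x 0 u w = 0.
Proof. by apply: big1 => k _; rewrite mxE mul0r. Qed.

Lemma metric_derivativeZ c1 c2 c3 x z u w :
  metric_derivative x (c1 *: z) (c2 *: u) (c3 *: w) =
  c1 * c2 * c3 * metric_derivative x z u w.
Proof.
rewrite mulr_sumr; apply: eq_bigr => k _; rewrite bilinZl bilinZr mxE; ring.
Qed.

Lemma omega_sigmaE (p xi eta : V * V) : S2 p.1 ->
  omega_sigma M p xi eta =
  metric_derivative p.1 xi.1 p.2 eta.1 + metric M p.1 xi.2 eta.1
  - (metric_derivative p.1 eta.1 p.2 xi.1 + metric M p.1 eta.2 xi.1)
  - sigma M p.1 xi.1 eta.1.
Proof.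
move=> Sp; rewrite /omega_sigma /dlambda.
rewrite (@derive_val _ _ _ _ _ _ _ (is_derive_lambda xi eta Sp)).
by rewrite (@derive_val _ _ _ _ _ _ _ (is_derive_lambda eta xi Sp)).
Qed.

Lemma metricBr x u v w : metric M x u (v - w) = metric M x u v - metric M x u w.
Proof. by rewrite /metric bilinDr bilinNr. Qed.

Lemma metric0r x u : metric M x u 0 = 0.
Proof. by rewrite /metric -(scale0r 0) bilinZr mul0r. Qed.

(** On a vertical vector (0, z) the Hamiltonian equation reads g (z, xi.1) = g (z, v), with no
    contribution of sigma; z = xi.1 - v and positivity conclude. *)
Lemma hamiltonian_base (p xi : V * V) : tangent_bundle p ->
  is_hamiltonian_vector M p xi -> xi.1 = p.2.
Proof.
case: p xi => x v [y a] [/= Sx xv] [[/= xy _] ham].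
apply/eqP; rewrite -subr_eq0; apply: contraT => n0.
have t0 : dot x (y - v) = 0 by rewrite dotBr xy xv subrr.
have := metric_pos Sx t0 n0; have /= := ham (0, y - v).
have tt : tangent_TS (x, v) (0, y - v).
  by split => /=; rewrite ?t0 dotE !mxE ?addr0; ring.
move=> /(_ tt); rewrite omega_sigmaE //= derive_energy //= !metric_derivative0.
rewrite /sigma area_formE //; last by rewrite dotE !mxE; ring.
have -> : dot x (cross y 0) = 0 by rewrite dotE !crossE !mxE; ring.
have -> : metric_derivative x y v 0 = 0.
  by rewrite -[y]scale1r -[v]scale1r -(scale0r 0) metric_derivativeZ; ring.
rewrite metric0r (metric_sym Sx xv t0) metricBr => h; lra.
Qed.

(* The first line is minus the Christoffel symbols of the first kind; the others come
   from second derivatives along [x], where the metric is neither symmetric nor 0. *)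
Definition coriolis (x w eta : V) : R :=
  metric_derivative x eta w w / 2 - metric_derivative x w w eta
  - dot eta w / 2 * (metric M x x w - metric M x w x)
  + dot w w * metric M x x eta.

(** This is the equation of motion tested against tangent vectors, after division by [m]. The term
    [(m * dot w w) *: p.1] cancels the normal acceleration imposed by the sphere, so that the metric
    is evaluated on tangent vectors. *)
Lemma hamiltonian_fiber m (p xi : V * V) w u eta : m != 0 -> tangent_bundle p ->
  is_hamiltonian_vector M p xi -> p.2 = m *: w -> xi.2 = m *: u ->
  dot p.1 eta = 0 ->
  metric M p.1 (u + (m * dot w w) *: p.1) eta =
  f p.1 * area_form M p.1 w eta + m * coriolis p.1 w eta.
Proof.
move=> m0 tp hp; have := hamiltonian_base tp hp.
case: p xi tp hp => x v [y a] [/= Sx xv] [[/= xy _] ham] yv vE aE xe; rewrite yv in xy ham.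
(* The choice of [e2] makes (eta, e2) tangent to TS^2: dot eta v + dot x e2 = 0. *)
pose e2 := - dot eta v *: x.
have tt : tangent_TS (x, v) (eta, e2).
  split => //=; rewrite /e2 dotZr; move: Sx; rewrite /sphere2 /= => ->; ring.
have /= := ham _ tt; rewrite omega_sigmaE //= derive_energy //= /sigma.
have xw : dot x w = 0.
  by have : dot x v = 0 := xv; rewrite vE dotZr => /eqP; rewrite mulf_eq0 (negbTE m0) => /eqP.
have xew : dot x (cross v eta) = m * dot x (cross w eta).
  by rewrite vE !dotE !crossE !rowE; ring.
rewrite (area_formE Sx xv xe) (area_formE Sx xw xe) xew.
have D1 : metric_derivative x v v eta = m * m * metric_derivative x w w eta.
  by rewrite vE -[eta in LHS]scale1r metric_derivativeZ; ring.
have D2 : metric_derivative x eta v v = m * m * metric_derivative x eta w w.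
  by rewrite vE -[eta in LHS]scale1r metric_derivativeZ; ring.
rewrite D1 D2 /e2 vE aE /coriolis /metric !(bilinDl, bilinZl, bilinZr, dotZr) => h.
apply: (mulfI m0); lra.
Qed.

(** Coordinates of [cross x y] are pairings of [y] with tangent vectors, so equations tested on
    tangent vectors determine them. *)
Lemma cross_row (x y : V) l : cross x y 0 l = dot y (cross (delta_mx 0 l) x).
Proof.
case: l => [[|[|[|//]]] p].
- rewrite (_ : Ordinal p = 0); last exact/val_inj.
  by rewrite dotE !crossE !mxE /=; ring.
- rewrite (_ : Ordinal p = 1); last exact/val_inj.
  by rewrite dotE !crossE !mxE /=; ring.
- rewrite (_ : Ordinal p = 2%:R); last exact/val_inj.
  by rewrite dotE !crossE !mxE /=; ring.
Qed.

Lemma dot_delta (w : V) l : dot w (delta_mx 0 l) = w 0 l.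
Proof.
rewrite /dot (bigD1 l) //= big1 ?addr0 => [|i il]; rewrite mxE !eqxx /=.
  by rewrite mulr1.
by rewrite (negbTE il) mulr0.
Qed.

Lemma sym_mulDr (N : 'M[R]_3) u v : sym_mul N (u + v) = sym_mul N u + sym_mul N v.
Proof. by apply/rowP => j; rewrite rowDE !sym_mulE !rowE; ring. Qed.

Lemma sym_mulZr (N : 'M[R]_3) c u : sym_mul N (c *: u) = c *: sym_mul N u.
Proof. by apply/rowP => j; rewrite rowZE !sym_mulE !rowE; ring. Qed.

Lemma crossDr (u v w : V) : cross u (v + w) = cross u v + cross u w.
Proof. by apply: row3P; rewrite rowDE !crossE !rowE; ring. Qed.

Lemma crossZr c (u v : V) : cross u (c *: v) = c *: cross u v.
Proof. by apply: row3P; rewrite rowZE !crossE !rowE; ring. Qed.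

(** By [cross_row], this is the cross product of [x] with any vector representing the linear form
    [coriolis x w]. *)
Definition coriolis_row (x w : V) : V := \row_l coriolis x w (cross (delta_mx 0 l) x).

(* For velocity [m w] and acceleration [m u] on the sphere, the Hamiltonian equation
   is [u = lorentz_force x w - m *: geodesic_force x w]. *)
Definition lorentz_force (x w : V) : V :=
  (orientation_sign * f x / area_density x) *: cross x (sym_mul (G x) w).

Definition geodesic_force (x w : V) : V :=
  (area_density_sq x)^-1 *: cross x (sym_mul (G x) (coriolis_row x w)) + dot w w *: x.

Lemma area_density_gt0 x : S2 x -> 0 < area_density x.
Proof. by move=> Sx; rewrite sqrtr_gt0 area_density_sq_gt0. Qed.

Lemma area_densityE x : S2 x -> area_density x ^+ 2 = area_density_sq x.
Proof. by move=> Sx; rewrite sqr_sqrtr // ltW // area_density_sq_gt0. Qed.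

(** Testing with the vectors [cross (delta_mx 0 l) x] gives [cross x (sym_mul (G x) uT)] for the
    tangential part [uT] of [u]; applying the same map again recovers [uT] by [rotation_square]. *)
Lemma hamiltonian_force m (p xi : V * V) w u : m != 0 -> tangent_bundle p ->
  is_hamiltonian_vector M p xi -> p.2 = m *: w -> xi.2 = m *: u ->
  u = lorentz_force p.1 w - m *: geodesic_force p.1 w.
Proof.
move=> m0 tp hp pw xu.
have F eta := hamiltonian_fiber (eta := eta) m0 tp hp pw xu.
have b := hamiltonian_base tp hp; have [[_ t2] _] := hp; have [Sx xv] := tp.
move: p.1 F Sx xv t2 => x F Sx xv t2.
have xw : dot x w = 0.
  by have : dot x p.2 = 0 := xv; rewrite pw dotZr => /eqP; rewrite mulf_eq0 (negbTE m0) => /eqP.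
have xuE : dot x u = - (m * dot w w).
  apply: (mulfI m0); move: t2; rewrite b pw xu !dotZl !dotZr; lra.
set uT := u + (m * dot w w) *: x in F.
have xuT : dot x uT = 0.
  by rewrite /uT dotDr dotZr xuE; move: Sx; rewrite /sphere2 /= => ->; ring.
have k0 := area_density_sq_gt0 Sx; have d0 := area_density_gt0 Sx.
have E : cross x (sym_mul (G x) uT) =
    (- (orientation_sign * area_density x * f x)) *: w + m *: coriolis_row x w.
  apply/rowP => l; rewrite cross_row rowDE !rowZE [coriolis_row _ _ _ _]mxE.
  have xe : dot x (cross (delta_mx 0 l) x) = 0.
    by rewrite crossC dotNr dot_cross_l oppr0.
  rewrite -(metric_sym_mul Sx xuT xe) (F _ xe) (area_formE Sx xw xe).
  have -> : dot x (cross w (cross (delta_mx 0 l) x)) =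
     dot x (delta_mx 0 l) * dot x w - dot x x * dot w (delta_mx 0 l).
    by rewrite !dotE !crossE; ring.
  by rewrite xw !dot_delta; move: Sx; rewrite /sphere2 /= => ->; ring.
have := rotation_square (G x) Sx xuT.
rewrite E sym_mulDr !sym_mulZr crossDr !crossZr -/(area_density_sq x) => /esym H.
have -> : u = uT - (m * dot w w) *: x by rewrite /uT addrK.
have -> : uT = - (area_density_sq x)^-1 *: (- area_density_sq x *: uT).
  by rewrite scalerA mulrNN mulVf ?scale1r // gt_eqF.
rewrite H /lorentz_force /geodesic_force.
apply/rowP => j; rewrite !rowE -(area_densityE Sx); field.
by rewrite gt_eqF.
Qed.

(* [(e, frame_normal x e)] is a positive [g]-orthonormal basis of the tangent
   plane; [frame_along] and [frame_across] represent the coordinates in this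
   basis, extended by 0 to the normal line. *)
Definition frame_normal (x e : V) : V :=
  (orientation_sign / area_density x) *: cross x (sym_mul (G x) e).

Definition frame_along (x e : V) : V :=
  sym_mul (G x) e - dot x (sym_mul (G x) e) *: x.

Definition frame_across (x e : V) : V :=
  (orientation_sign * area_density x) *: cross x e.

Lemma lorentz_frame (x e v : V) : S2 x -> dot x e = 0 -> metric M x e e = 1 ->
  [/\ v = dot (frame_along x e) v *: e + dot (frame_across x e) v *: frame_normal x e
          + dot v x *: x,
    dot (frame_along x e) e = 1, dot (frame_across x e) e = 0,
    dot (frame_along x e) (lorentz_force x (v - dot v x *: x))
      = - (f x * dot (frame_across x e) v)
    & dot (frame_across x e) (lorentz_force x (v - dot v x *: x))
      = f x * dot (frame_along x e) v].
Proof.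
move=> Sx xe ee.
set a := frame_along x e; set b := frame_across x e; set j := frame_normal x e.
have xx : dot x x = 1 by [].
have d0 := area_density_gt0 Sx.
have dn0 : area_density x != 0 by rewrite gt_eqF.
have ss : orientation_sign * orientation_sign = 1.
  by rewrite /orientation_sign; case: ms_orient; rewrite ?expr1 ?expr0; ring.
pose t := v - dot v x *: x.
have xt : dot x t = 0 by rewrite /t dotBr dotZr xx dotC; ring.
have aE w : dot a w = dot (sym_mul (G x) e) w - dot x (sym_mul (G x) e) * dot x w.
  by rewrite /a /frame_along dotBl dotZl.
have at_ : dot a v = dot (sym_mul (G x) e) t.
  by rewrite aE /t dotBr dotZr (dotC v x) (dotC x (sym_mul _ _)); ring.
have bE w : dot b w = orientation_sign * area_density x * dot x (cross e w).
  by rewrite /b /frame_across dotZl !dotE !crossE; ring.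
have bt : dot b v = orientation_sign * area_density x * dot x (cross e t).
  by rewrite bE; congr (_ * _); rewrite /t !dotE !crossE !rowE; ring.
have See : dot (sym_mul (G x) e) e = 1 by rewrite -(metric_sym_mul Sx xe xe).
split.
- have := frame_decomposition (G x) xx xe xt; rewrite See scale1r => tE.
  rewrite at_ bt /j /frame_normal scalerA.
  have -> : orientation_sign * area_density x * dot x (cross e t) *
     (orientation_sign / area_density x) = dot x (cross e t).
    transitivity (orientation_sign * orientation_sign * dot x (cross e t)).
      by field.
    by rewrite ss mul1r.
  by rewrite -tE /t subrK.
- by rewrite aE See xe; ring.
- by rewrite bE dotE !crossE; ring.
- rewrite -/t aE /lorentz_force !dotZr dot_cross_l bt (rotation_adjoint (G x) xx xe xt).
  rewrite -/(area_density_sq x) -(area_densityE Sx); field.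
  exact: dn0.
- rewrite -/t bE /lorentz_force crossZr dotZr at_.
  have -> : dot x (cross e (cross x (sym_mul (G x) t))) =
    dot x x * dot e (sym_mul (G x) t) - dot x e * dot x (sym_mul (G x) t).
    by rewrite !dotE !crossE; ring.
  have -> : dot e (sym_mul (G x) t) = dot (sym_mul (G x) e) t.
    by rewrite !dotE !sym_mulE; ring.
  rewrite xx xe; transitivity (orientation_sign * orientation_sign * f x *
     dot (sym_mul (G x) e) t); last by rewrite ss; ring.
  by field.
Qed.

End Force.

(** * Uniform bounds on the unit tangent bundle *)

Section BoundedGeometry.
Variables (R : realType) (M : symplectic_magnetic_system R).
Notation V := 'rV[R]_3.
Notation G := (ms_metric M).
Notation f := (ms_f M).
Notation S2 := (@sphere2 R).

Definition state_dist (p q : V * V) : R := `|p.1 - q.1| + `|p.2 - q.2|.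

Lemma state_dist_ge0 p q : 0 <= state_dist p q.
Proof. exact: addr_ge0. Qed.

(** Larger than a set of unit vectors: it also has to contain velocities projected from another base
    point, whose length is not 1. *)
Definition state_set (B : R) : set (V * V) := [set p | S2 p.1 /\ `|p.2| <= B].

Section Closure.
Variable B : R.
Hypothesis B0 : 0 <= B.
Notation bl := (blip state_dist (state_set B)).
Notation blv := (blip_vec state_dist (state_set B)).
Let d0 := state_dist_ge0.

Lemma blip_base : blv (fun p => p.1).
Proof.
move=> i; exists 1 => // p q [Sp _] _; split.
  exact: le_trans (norm_coord_le _ _) (sphere2_norm_le Sp).
have := norm_coord_le (p.1 - q.1) i; rewrite !mxE mul1r => h.
by rewrite (le_trans h) // lerDl.
Qed.

Lemma blip_fiber : blv (fun p => p.2).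
Proof.
move=> i; exists (B + 1); first exact: addr_ge0.
move=> p q [_ hp] _; split.
  by rewrite (le_trans (norm_coord_le _ _)) // (le_trans hp) // lerDl.
have := norm_coord_le (p.2 - q.2) i; rewrite !mxE => h.
rewrite (le_trans h) // (@le_trans _ _ (1 * state_dist p q)) //.
  by rewrite mul1r lerDr.
by rewrite ler_wpM2r // lerDr.
Qed.

Lemma blip_of_base (h : V -> R) :
  (exists2 C : R, 0 <= C & forall x y, S2 x -> S2 y ->
    `|h x| <= C /\ `|h x - h y| <= C * `|x - y|) -> bl (fun p => h p.1).
Proof.
move=> [C C0 hC]; exists C => // p q [Sp _] [Sq _]; have [h1 h2] := hC _ _ Sp Sq.
split => //; apply: le_trans h2 _.
by rewrite ler_wpM2l // lerDl.
Qed.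

Lemma blip_metric i j : bl (fun p => G p.1 i j).
Proof.
apply: (@blip_of_base (fun x => G x i j)); have [sG _ _] := ms_metricP M.
exact: (smooth_entry_lipschitz [::] i j sG).
Qed.

Lemma blip_dmetric k i j : bl (fun p => dmetric M k p.1 i j).
Proof.
apply: (@blip_of_base (fun x => dmetric M k x i j)); have [sG _ _] := ms_metricP M.
exact: (smooth_entry_lipschitz [:: delta_mx 0 k] i j sG).
Qed.

Lemma blip_f : bl (fun p => f p.1).
Proof. exact/blip_of_base/smooth_function_lipschitz/ms_f_smooth. Qed.

Lemma metric_entry_continuous x i j : S2 x -> {for x, continuous (fun y => G y i j)}.
Proof. by move=> Sx; exact: differentiable_continuous (metric_entry_differentiable M i j Sx). Qed.

Lemma area_density_sq_lower :
  exists2 c : R, 0 < c & forall x, S2 x -> c <= area_density_sq M x.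
Proof.
apply: continuous_sphere2_pos => [x Sx|]; last exact: area_density_sq_gt0.
pose ct (h : V -> R) := h y @[y --> x] --> h x.
have cx i : ct (fun y => y 0 i) by exact: coord_continuous.
have cG i j : ct (fun y => G y i j) by exact: metric_entry_continuous.
have cc c : ct (fun=> c) by exact: (@cst_continuous V R c x).
have cD h k : ct h -> ct k -> ct (fun y => h y + k y).
  by move=> h1 h2; exact: (@continuousD R R^o V h k x h1 h2).
have cN h : ct h -> ct (fun y => - h y) by move=> h1; exact: (@continuousN R R^o V h x h1).
have cM h k : ct h -> ct k -> ct (fun y => h y * k y).
  by move=> h1 h2; exact: (@continuousM R V h k x h1 h2).
have cX h : ct h -> ct (fun y => h y ^+ 2) by move=> ch; exact: cM.
change (ct (fun x => area_density_sq M x)).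
rewrite /area_density_sq /cofactor_form.
repeat match goal with
| |- ct (fun y => @?h y + @?k y) => refine (cD h k _ _)
| |- ct (fun y => - @?h y) => refine (cN h _)
| |- ct (fun y => @?h y ^+ 2) => refine (cX h _)
| |- ct (fun y => @?h y * @?k y) => refine (cM h k _ _)
| |- ct (fun=> ?c) => exact (cc c)
end; first [exact: cx|exact: cG].
Qed.

Lemma blip_area_density_sq : bl (fun p => area_density_sq M p.1).
Proof. by apply: blip_cofactor_form => //; [exact: blip_metric|exact: blip_base]. Qed.

Lemma blip_area_density_sqV : bl (fun p => (area_density_sq M p.1)^-1).
Proof.
have [c c0 hc] := area_density_sq_lower.
by apply: (blipV d0 c0 _ blip_area_density_sq) => p [Sp _]; exact: hc.
Qed.

Lemma blip_area_density : bl (fun p => area_density M p.1).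
Proof.
have [c c0 hc] := area_density_sq_lower.
by apply: (blip_sqrt d0 c0 _ blip_area_density_sq) => p [Sp _]; exact: hc.
Qed.

Lemma blip_area_densityV : bl (fun p => (area_density M p.1)^-1).
Proof.
have [c c0 hc] := area_density_sq_lower.
have sc0 : 0 < Num.sqrt c by rewrite sqrtr_gt0.
apply: (blipV d0 sc0 _ blip_area_density) => p [Sp _].
by rewrite ler_sqrt ?hc // ltW // area_density_sq_gt0.
Qed.

Lemma blip_metric_derivative F1 F2 F3 : blv F1 -> blv F2 -> blv F3 ->
  bl (fun p => metric_derivative M p.1 (F1 p) (F2 p) (F3 p)).
Proof.
move=> h1 h2 h3; apply: blip_sum => // k; apply: blipM => //.
by apply: blip_bilin => // i j; exact: blip_dmetric.
Qed.

Lemma blip_metric_form F1 F2 : blv F1 -> blv F2 ->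
  bl (fun p => metric M p.1 (F1 p) (F2 p)).
Proof. by move=> h1 h2; apply: blip_bilin => //; exact: blip_metric. Qed.

Lemma blip_vec_cst (v : V) : blv (fun=> v).
Proof. by move=> i; exact: blip_cst. Qed.

Lemma blip_symm F : blv F -> blv (fun p => sym_mul (G p.1) (F p)).
Proof. by move=> h; apply: blip_sym_mul => // i j; exact: blip_metric. Qed.

Lemma blip_lorentz_force : blv (fun p => lorentz_force M p.1 p.2).
Proof.
apply: blip_vecZ => //.
  apply: blipM => //; last exact: blip_area_densityV.
  by apply: blipM => //; [exact: blip_cst|exact: blip_f].
by apply: blip_cross => //; [exact: blip_base|apply: blip_symm; exact: blip_fiber].
Qed.

Lemma blip_coriolis F : blv F -> bl (fun p => coriolis M p.1 p.2 (F p)).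
Proof.
move=> hF; have hb := blip_base; have hf := blip_fiber.
have c2 : bl (fun=> 2^-1) by exact: blip_cst.
apply: blipD => //; last by apply: blipM => //; [exact: blip_dot|exact: blip_metric_form].
apply: blipB => //.
  apply: blipB => //; last exact: blip_metric_derivative.
  by apply: blipM => //; exact: blip_metric_derivative.
apply: blipM => //; first by apply: blipM => //; exact: blip_dot.
by apply: blipB => //; exact: blip_metric_form.
Qed.

Lemma blip_geodesic_force : blv (fun p => geodesic_force M p.1 p.2).
Proof.
have hb := blip_base; have hf := blip_fiber.
apply: blip_vecD => //; apply: blip_vecZ => //; last exact: blip_dot.
  exact: blip_area_density_sqV.
apply: blip_cross => //; apply: blip_symm => l.
apply: (@blip_eq _ _ _ _ (fun p => coriolis M p.1 p.2 (cross (delta_mx 0 l) p.1))).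
  by move=> p; rewrite mxE.
by apply: blip_coriolis; apply: blip_cross => //; exact: blip_vec_cst.
Qed.

End Closure.

Definition unit_vector (x w : V) : Prop := [/\ S2 x, dot x w = 0 & metric M x w w = 1].

Lemma unit_vector_bounded : exists2 B : R, 1 <= B & forall x w, unit_vector x w -> `|w| <= B.
Proof.
pose eta (l : 'I_3) (p : V * V) := cross (delta_mx 0 l) p.1.
have d0 := state_dist_ge0.
have he l : blip_vec state_dist (state_set 1) (eta l).
  by apply: blip_cross => //; [exact: blip_vec_cst|exact: blip_base].
have hm l := blip_metric_form (he l) (he l).
have /choice [c hc] : forall l, exists c : R, 0 <= c /\ forall x, S2 x ->
    metric M x (cross (delta_mx 0 l) x) (cross (delta_mx 0 l) x) <= c.
  move=> l; have [c c0 hc] := hm l; exists c; split => // x Sx.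
  have A0 : state_set 1 (x, 0) by split => //=; rewrite normr0.
  by have [+ _] := hc _ _ A0 A0; apply: le_trans; exact: ler_norm.
pose Y := 1 + \sum_l c l.
have cY l : c l <= \sum_l c l.
  by rewrite (bigD1 l) //= lerDl; apply: sumr_ge0 => j _; have [] := hc j.
have Y0 : 0 <= Y by rewrite addr_ge0 //; apply: sumr_ge0 => l _; have [] := hc l.
(* Up to sign, the map that recovers [w] from the vector [y] below. *)
have hF : blip_vec state_dist (state_set Y) (fun p => (area_density_sq M p.1)^-1 *:
    cross p.1 (sym_mul (G p.1) p.2)).
  apply: blip_vecZ => //; first exact: blip_area_density_sqV.
  apply: blip_cross => //; first exact: blip_base.
  by apply: blip_symm; exact: blip_fiber.
have [B B0 hB] := blip_vec_bound state_dist_ge0 hF.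
exists (B + 1); first by rewrite lerDr.
move=> x w [Sx xw ww]; pose y := cross x (sym_mul (G x) w).
have yY : `|y| <= Y.
  apply: norm_le_coord => l; rewrite /y cross_row.
  set e := cross (delta_mx 0 l) x.
  have xe : dot x e = 0 by rewrite /e crossC dotNr dot_cross_l oppr0.
  (* The Gram determinant is a square times a positive number, hence nonnegative: this is the
     Cauchy-Schwarz inequality. *)
  have := gram_tangent (G x) Sx xw xe.
  rewrite -(metric_sym_mul M Sx xw xw) -(metric_sym_mul M Sx xe xe) ww mul1r => gr.
  have : dot (sym_mul (G x) w) e ^+ 2 <= c l.
    have := (hc l).2 x Sx; rewrite -/e.
    have : 0 <= dot x (cross w e) ^+ 2 * cofactor_form (G x) x.
      by rewrite mulr_ge0 ?sqr_ge0 // ltW // (area_density_sq_gt0 M Sx).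
    by rewrite -gr; lra.
  have := cY l; have := normr_ge0 (dot (sym_mul (G x) w) e).
  rewrite -(real_normK (num_real (dot _ e))) /Y.
  set z := `|_|; set C := \sum_l _ => z0 h1 h2.
  have := sqr_ge0 (z - 1); have := sqr_ge0 z; rewrite !expr2 in h2 *; lra.
(* [w] is recovered from [y], which is bounded by the Cauchy-Schwarz inequality. *)
have Axy : state_set Y (x, y) by [].
have [h1 _] := hB _ _ Axy Axy; rewrite /= in h1.
have -> : w = - ((area_density_sq M x)^-1 *: cross x (sym_mul (G x) y)).
  rewrite /y (rotation_square (G x) Sx xw) -/(area_density_sq M x) scalerA mulrN.
  by rewrite mulVf ?gt_eqF ?area_density_sq_gt0 // scaleN1r opprK.
by rewrite normrN (le_trans h1) // lerDl.
Qed.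

End BoundedGeometry.

Section UniformConstants.
Variables (R : realType) (M : symplectic_magnetic_system R).
Notation V := 'rV[R]_3.
Notation G := (ms_metric M).
Notation f := (ms_f M).
Notation S2 := (@sphere2 R).

Definition magnetic_force (m : R) (x w : V) : V :=
  lorentz_force M x w - m *: geodesic_force M x w.

Lemma ms_f_bounded : exists2 C : R, 1 <= C & forall x, S2 x -> C^-1 <= f x <= C.
Proof.
have [c c0 hc] : exists2 c : R, 0 < c & forall x, S2 x -> c <= f x.
  apply: continuous_sphere2_pos => [x Sx|]; last exact: ms_f_gt0.
  have [U [_ SU sf]] := ms_f_smooth M.
  exact: differentiable_continuous (sf [::] x (SU x Sx)).
have [C C0 hC] := smooth_function_lipschitz (ms_f_smooth M).
have cV : 0 < c^-1 by rewrite invr_gt0.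
exists (1 + C + c^-1); first lra.
move=> x Sx; have [h _] := hC x x Sx Sx; apply/andP; split.
  apply: le_trans (hc x Sx); rewrite -[leRHS]invrK lef_pV2 ?posrE; lra.
by have := ler_norm (f x); lra.
Qed.

Lemma force_bounded : exists2 C : R, 0 <= C & forall m x w y v, 0 <= m <= 1 ->
  unit_vector M x w -> unit_vector M y v ->
  `|magnetic_force m x w| <= C /\
  `|magnetic_force m x w - magnetic_force m y v| <= C * (`|x - y| + `|w - v|).
Proof.
have [B B1 hB] := unit_vector_bounded M; have B0 : 0 <= B by lra.
have [cl cl0 hl] := blip_vec_bound (@state_dist_ge0 R) (blip_lorentz_force M B0).
have [cg cg0 hg] := blip_vec_bound (@state_dist_ge0 R) (blip_geodesic_force M B0).
exists (cl + cg); first exact: addr_ge0.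
move=> m x w y v /andP[m0 m1] uw uv.
have Sw : state_set B (x, w) by split => /=; [case: uw|exact: hB uw].
have Sv : state_set B (y, v) by split => /=; [case: uv|exact: hB uv].
have [l1 l2] := hl _ _ Sw Sv; have [g1 g2] := hg _ _ Sw Sv.
rewrite /= in l1 l2 g1 g2.
have mg (z : V) (k : R) : `|z| <= k -> `|m *: z| <= k.
  by move=> zk; rewrite normrZ (ger0_norm m0); apply: le_trans zk; rewrite ler_piMl.
split; first by rewrite (le_trans (ler_normB _ _)) // lerD // mg.
have -> : magnetic_force m x w - magnetic_force m y v =
    (lorentz_force M x w - lorentz_force M y v)
    - m *: (geodesic_force M x w - geodesic_force M y v).
  by rewrite scalerBr /magnetic_force; apply/rowP => i; rewrite !mxE; ring.
by rewrite (le_trans (ler_normB _ _)) // mulrDl lerD // mg.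
Qed.

Lemma frame_bounded : exists2 C : R, 0 <= C & forall x e, unit_vector M x e ->
  forall v, [/\ `|dot (frame_along M x e) v| <= C * `|v|,
    `|dot (frame_across M x e) v| <= C * `|v|
    & `|v| <= C * (`|dot (frame_along M x e) v| + `|dot (frame_across M x e) v|
        + `|dot v x|)].
Proof.
have [B B1 hB] := unit_vector_bounded M; have B0 : 0 <= B by lra.
have d0 := @state_dist_ge0 R.
have hb := @blip_base R B; have hf := @blip_fiber R B B0.
have hs := @blip_symm R M B _ hf.
have hc : blip_vec (@state_dist R) (state_set B) (fun p => cross p.1 p.2) by exact: blip_cross.
have ho : blip (@state_dist R) (state_set B) (fun=> orientation_sign M) by exact: blip_cst.
have bd F : blip_vec (@state_dist R) (state_set B) F ->
    exists2 c : R, 0 <= c & forall p, state_set B p -> `|F p| <= c.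
  by move=> /(blip_vec_bound d0)[c c0 h]; exists c => // p Sp; have [] := h p p Sp Sp.
have [ca ca0 ha] : exists2 c : R, 0 <= c & forall p, state_set B p -> `|frame_along M p.1 p.2| <= c.
  apply: bd; apply: blip_vecD => //; apply: blip_vecN => //.
  by apply: blip_vecZ => //; apply: blip_dot.
have [cb cb0 hcb] : exists2 c : R, 0 <= c & forall p, state_set B p ->
    `|frame_across M p.1 p.2| <= c.
  apply: bd; apply: blip_vecZ => //; apply: blipM => //.
  exact: blip_area_density.
have [cj cj0 hj] : exists2 c : R, 0 <= c & forall p, state_set B p ->
    `|frame_normal M p.1 p.2| <= c.
  apply: bd; apply: blip_vecZ => //; last exact: blip_cross.
  by apply: blipM => //; exact: blip_area_densityV.
pose C := 3 * ca + 3 * cb + B + cj + 1; exists C; first by rewrite /C; lra.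
move=> x e ue v; have [Sx xe ee] := ue.
have Se : state_set B (x, e) by split => /=; [|exact: hB ue].
have a1 := ha _ Se; have b1 := hcb _ Se; have j1 := hj _ Se.
rewrite /= in a1 b1 j1.
have v0 := normr_ge0 v.
have dle (z : V) (c : R) : `|z| <= c -> 3 * c <= C -> `|dot z v| <= C * `|v|.
  move=> zc cC; apply: le_trans (dot_norm_le _ _) _.
  by rewrite ler_wpM2r //; lra.
split; [by apply: dle a1 _; rewrite /C; lra|by apply: dle b1 _; rewrite /C; lra|].
have [vE _ _ _ _] := lorentz_frame v Sx xe ee.
rewrite [X in `|X| <= _]vE !mulrDr.
have sc (c : R) (z : V) : `|z| <= C -> `|c *: z| <= C * `|c|.
  by move=> zC; rewrite normrZ mulrC ler_wpM2r.
have e1 := hB _ _ ue; have x1 := sphere2_norm_le Sx.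
rewrite (le_trans (ler_normD _ _)) // lerD //; last by apply: sc; rewrite /C; lra.
by rewrite (le_trans (ler_normD _ _)) // lerD //; apply: sc; rewrite /C; lra.
Qed.

(** A vector tangent at [x] is almost tangent at [y], because dot w y = dot w (y - x). *)
Lemma tangential_part_close : exists2 B : R, 1 <= B & forall x w y e,
  unit_vector M x w -> unit_vector M y e ->
  [/\ `|e| <= B, `|dot w y| <= B * `|x - y|,
    state_set B (x, w), state_set B (y, w - dot w y *: y)
    & state_dist (x, w) (y, w - dot w y *: y) <= B * `|x - y|].
Proof.
have [B B1 hB] := unit_vector_bounded M; exists (4 * B); first lra.
move=> x w y e uw ue; have [Sx xw ww] := uw; have [Sy ye ee] := ue.
have eB := hB _ _ ue; have wB := hB _ _ uw; have y1 := sphere2_norm_le Sy.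
have wy : `|dot w y| <= 3 * B * `|x - y|.
  have -> : dot w y = dot w (y - x) by rewrite dotBr (dotC w x) xw subr0.
  rewrite (le_trans (dot_norm_le _ _)) // distrC ler_wpM2r //; lra.
have wy' : `|dot w y| <= 3 * B.
  rewrite (le_trans (dot_norm_le _ _)) // -[leRHS]mulr1.
  by apply: ler_pM => //; lra.
have xy0 := normr_ge0 (x - y).
have Byy : 0 <= B * `|x - y| by rewrite mulr_ge0 //; lra.
have wyy : `|dot w y *: y| <= `|dot w y|.
  by rewrite normrZ ler_piMr.
split => //=; [lra|lra|by split => //=; lra| |].
  split => //=; rewrite (le_trans (ler_normB _ _)) //; lra.
rewrite /state_dist /= opprB addrCA subrr addr0.
have : `|x - y| <= B * `|x - y| by rewrite ler_peMl.
lra.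
Qed.

(** The force at (x, w) is compared with the Lorentz force at [y] on the tangential part of [w], for
    which [lorentz_frame] is exact. The geodesic force accounts for the term [m]. *)
Lemma force_rotation : exists2 C : R, 0 <= C & forall m x w y e, 0 < m -> m <= 1 ->
  unit_vector M x w -> unit_vector M y e ->
  `|dot (frame_along M y e) (magnetic_force m x w) + f y * dot (frame_across M y e) w|
    <= C * (`|x - y| + m) /\
  `|dot (frame_across M y e) (magnetic_force m x w) - f y * dot (frame_along M y e) w|
    <= C * (`|x - y| + m).
Proof.
have [B B1 hB] := tangential_part_close; have B0 : 0 <= B by lra.
have [cf cf0 hf] := frame_bounded.
have [cl cl0 hl] := blip_vec_bound (@state_dist_ge0 R) (blip_lorentz_force M B0).
have [cg cg0 hg] := blip_vec_bound (@state_dist_ge0 R) (blip_geodesic_force M B0).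
have k0 : 0 <= cl * B by rewrite mulr_ge0.
exists (cf * (cl * B + cg)); first by rewrite mulr_ge0 //; lra.
move=> m x w y e m0 m1 uw ue.
have [_ _ S1 S2' dd] := hB _ _ _ _ uw ue.
have [_ l2] := hl _ _ S1 S2'; have [g1 _] := hg _ _ S1 S1; rewrite /= in l2 g1.
have [Sy ye ee] := ue; have [_ _ _ la lb] := lorentz_frame w Sy ye ee.
have F : `|magnetic_force m x w - lorentz_force M y (w - dot w y *: y)| <=
    (cl * B + cg) * (`|x - y| + m).
  rewrite /magnetic_force addrAC (le_trans (ler_normB _ _)) // normrZ (gtr0_norm m0).
  have h1 : cl * state_dist (x, w) (y, w - dot w y *: y) <= cl * B * `|x - y|.
    by rewrite -mulrA ler_wpM2l.
  have h2 : m * `|geodesic_force M x w| <= m * cg by rewrite ler_pM2l.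
  have h3 : 0 <= cl * B * m by rewrite mulr_ge0 // ltW.
  have h4 : 0 <= cg * `|x - y| by rewrite mulr_ge0.
  by rewrite !mulrDl; lra.
have [h1 h2 _] := hf _ _ ue (magnetic_force m x w - lorentz_force M y (w - dot w y *: y)).
have F' := ler_wpM2l cf0 F; rewrite mulrA in F'.
rewrite (@dotBr _ _ (magnetic_force m x w)) la opprK in h1.
rewrite (@dotBr _ _ (magnetic_force m x w)) lb in h2.
by split; [exact: le_trans h1 F'|exact: le_trans h2 F'].
Qed.

(** Here w = A e + z y, with z = O(|x - y|) by [tangential_part_close]. Both [w] and [e] have length
    1 for nearby metrics, so A^2 - 1 = O(|x - y|), and A > 0 excludes A near - 1. *)
Lemma direction_return : exists2 C : R, 0 <= C & forall x w y e,
  unit_vector M x w -> unit_vector M y e ->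
  dot (frame_across M y e) w = 0 -> 0 < dot (frame_along M y e) w ->
  `|w - e| <= C * `|x - y|.
Proof.
have [B B1 hB] := tangential_part_close; have B0 : 0 <= B by lra.
have hf := @blip_fiber R B B0.
have [c c0 hc] := @blip_metric_form R M B _ _ hf hf.
exists (B * (c * B) + B); first by rewrite addr_ge0 // !mulr_ge0.
move=> x w y e uw ue bw aw.
have [eB wy S1 S2' dd] := hB _ _ _ _ uw ue.
have [Sy ye ee] := ue; have [_ _ ww] := uw.
have [wE _ _ _ _] := lorentz_frame w Sy ye ee.
move: wE; rewrite bw scale0r addr0; set A := dot _ w in aw *; set z := dot w y => wE.
have tE : w - z *: y = A *: e by rewrite {1}wE addrK.
have [_] := hc _ _ S1 S2'; rewrite /= -/z tE ww.
rewrite [metric _ _ (A *: e) _]/metric bilinZl bilinZr -[bilin _ _ _]/(metric M y e e) ee.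
rewrite mulr1 => h.
have A1 : `|A - 1| <= `|1 - A * A|.
  have -> : 1 - A * A = - ((A - 1) * (A + 1)) by ring.
  rewrite normrN normrM ler_peMr // ger0_norm; lra.
have A2 : `|A - 1| <= c * B * `|x - y|.
  by rewrite (le_trans A1) // (le_trans h) // -mulrA ler_wpM2l // -tE.
have -> : w - e = (A - 1) *: e + z *: y.
  by rewrite {1}wE; apply/rowP => i; rewrite !mxE; ring.
rewrite (le_trans (ler_normD _ _)) // mulrDl lerD // normrZ.
  rewrite -mulrA mulrC; apply: ler_pM => //.
by apply: le_trans wy; rewrite ler_piMr // sphere2_norm_le.
Qed.

End UniformConstants.

(** * Solutions of the magnetic flow are Larmor trajectories *)

Section Trajectory.
Variables (R : realType) (M : symplectic_magnetic_system R).
Notation V := 'rV[R]_3.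

(** Linearity is stated in the form in which a difference quotient uses it. *)
Lemma is_derive_linear (W1 W2 : normedModType R) (g : R -> W1) (L : W1 -> W2) (t : R) :
  continuous L -> (forall (h : R) p q, L (h *: (p - q)) = h *: (L p - L q)) ->
  derivable g t 1 -> is_derive t 1 (fun s => L (g s)) (L (derive1 g t)).
Proof.
move=> cL linL dg; rewrite derive1E.
have lim : h^-1 *: (L (g (h *: (1 : R) + t)) - L (g t)) @[h --> 0^'] --> L ('D_1 g t).
  have hl : h^-1 *: (g (h *: (1 : R) + t) - g t) @[h --> 0^'] --> 'D_1 g t by exact: dg.
  have := cvg_comp _ _ hl (cL _); apply: cvg_trans.
  by apply: near_eq_cvg; near=> h; rewrite /= linL.
split; first by apply/cvg_ex; eexists; exact: lim.
exact: cvg_lim lim.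
Unshelve. all: by end_near.
Qed.

Lemma is_derive_base (gamma : R -> V * V) (t : R) i : derivable gamma t 1 ->
  is_derive t 1 (fun s => (gamma s).1 0 i) ((derive1 gamma t).1 0 i).
Proof.
apply: (@is_derive_linear _ R^o gamma (fun p : V * V => p.1 0 i)).
  move=> [p1 p2]; apply: (@cvg_comp _ _ _ fst (fun v : V => v 0 i) _ (nbhs p1)).
    exact: cvg_fst.
  exact: coord_continuous.
by move=> h p q; rewrite !mxE.
Qed.

Lemma is_derive_fiber (gamma : R -> V * V) (t : R) i : derivable gamma t 1 ->
  is_derive t 1 (fun s => (gamma s).2 0 i) ((derive1 gamma t).2 0 i).
Proof.
apply: (@is_derive_linear _ R^o gamma (fun p : V * V => p.2 0 i)).
  move=> [p1 p2]; apply: (@cvg_comp _ _ _ snd (fun v : V => v 0 i) _ (nbhs p2)).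
    exact: cvg_snd.
  exact: coord_continuous.
by move=> h p q; rewrite !mxE.
Qed.

Lemma energy_level_unit m (p : V * V) : 0 < m -> energy_level M m p ->
  unit_vector M p.1 (m^-1 *: p.2) /\ metric M p.1 p.2 p.2 = m ^+ 2.
Proof.
move=> m0 [[Sp tp] E]; have E2 : metric M p.1 p.2 p.2 = m ^+ 2.
  by move: E; rewrite /energy; lra.
split => //; split => //; first by rewrite dotZr [dot _ _]tp mulr0.
rewrite /metric bilinZl bilinZr -/(metric M p.1 p.2 p.2) E2 expr2.
by rewrite mulKf ?mulVf ?gt_eqF.
Qed.

Lemma magnetic_solution_trajectory : exists2 C : R, 1 <= C &
  forall m gamma, 0 < m -> m <= 1 -> magnetic_solution M m gamma ->
  exists a b, larmor_trajectory C (ms_f M (gamma 0).1) m (fun t => (gamma t).1)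
    (fun t => m^-1 *: (gamma t).2)
    (fun t => magnetic_force M m (gamma t).1 (m^-1 *: (gamma t).2)) a b.
Proof.
have [B B1 hB] := unit_vector_bounded M.
have [cf cf1 hf] := ms_f_bounded M.
have [c1 c10 h1] := force_bounded M.
have [c2 c20 h2] := frame_bounded M.
have [c3 c30 h3] := force_rotation M.
have [c4 c40 h4] := direction_return M.
have [C C1 [[CB Cf] [Cc1 Cc2] [Cc3 Cc4]]] : exists2 C : R, 1 <= C &
    [/\ B <= C /\ cf <= C, c1 <= C /\ c2 <= C & c3 <= C /\ c4 <= C].
  by exists (B + cf + c1 + c2 + c3 + c4); [lra|split; split; lra].
exists C => // m gamma m0 m1 sol; have mn0 : m != 0 by rewrite gt_eqF.
have un t : unit_vector M (gamma t).1 (m^-1 *: (gamma t).2).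
  by have [/(energy_level_unit m0)[]] := sol t.
have fo t : m^-1 *: (derive1 gamma t).2 = magnetic_force M m (gamma t).1 (m^-1 *: (gamma t).2).
  have [[tb _] _ ham] := sol t.
  by apply: (hamiltonian_force mn0 tb ham); rewrite scalerA mulfV ?scale1r.
have m01 : 0 <= m <= 1 by rewrite ltW.
have C_le (c z : R) : c <= C -> 0 <= z -> c * z <= C * z by move=> cC z0; rewrite ler_wpM2r.
have [_ _ u0] := un 0; have [S0 t0 _] := un 0.
exists (frame_along M (gamma 0).1 (m^-1 *: (gamma 0).2)).
exists (frame_across M (gamma 0).1 (m^-1 *: (gamma 0).2)).
split => //.
- have /andP[+ _] := hf _ S0; apply: le_trans.
  by rewrite lef_pV2 ?posrE //; lra.
- by have /andP[_ +] := hf _ S0; move/le_trans; apply.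
- move=> t i; have [[tb _] dg ham] := sol t.
  have := is_derive_base i dg; rewrite (hamiltonian_base tb ham).
  by rewrite mxE mulVKf.
- move=> t i; have [_ dg _] := sol t.
  have := is_derive_scaleE m^-1 (is_derive_fiber i dg); rewrite -fo.
  have -> : (fun s : R => (m^-1 *: (gamma s).2) 0 i) = (fun s => m^-1 * (gamma s).2 0 i).
    by apply/funext => s; rewrite mxE.
  by rewrite mxE.
- by move=> t; apply: le_trans (hB _ _ (un t)) _.
- by move=> t; have [+ _] := h1 _ _ _ _ _ m01 (un t) (un t); move/le_trans; apply.
- move=> s t; have [_ le1] := h1 _ _ _ _ _ m01 (un s) (un t).
  apply: (le_trans le1).
  apply: (ler_wpM2r _ Cc1).
  exact: addr_ge0.
- by move=> t; have [] := un t.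
- by move=> v; have [+ _ _] := h2 _ _ (un 0) v; move/le_trans; apply; exact: C_le.
- by move=> v; have [_ + _] := h2 _ _ (un 0) v; move/le_trans; apply; exact: C_le.
- by have [] := lorentz_frame 0 S0 t0 u0.
- by have [] := lorentz_frame 0 S0 t0 u0.
- move=> v; have [_ _ +] := h2 _ _ (un 0) v; move/le_trans; apply; apply: C_le => //.
- move=> t; have [+ _] := h3 _ _ _ _ _ m0 m1 (un t) (un 0).
  by move/le_trans; apply; apply: C_le => //; rewrite addr_ge0 // ltW.
- move=> t; have [_ +] := h3 _ _ _ _ _ m0 m1 (un t) (un 0).
  by move/le_trans; apply; apply: C_le => //; rewrite addr_ge0 // ltW.
- move=> t b0 a0; have := h4 _ _ _ _ (un t) (un 0) b0 a0.
  by move/le_trans; apply; exact: C_le.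
Qed.

End Trajectory.

(** * Lengths and self-intersections *)

Section Lengths.
Variables (R : realType) (M : symplectic_magnetic_system R).
Notation V := 'rV[R]_3.

Lemma derive1_proj_curve m (gamma : R -> V * V) (t : R) : magnetic_solution M m gamma ->
  derive1 (proj_curve gamma) t = (gamma t).2.
Proof.
move=> sol; have [[tb _] dg ham] := sol t.
rewrite -(hamiltonian_base tb ham) derive1E.
have h : is_derive t 1 (fun s => (gamma s).1) (derive1 gamma t).1.
  by apply: (@is_derive_linear _ _ V gamma fst) => // -[p1 p2]; exact: cvg_fst.
exact: (@derive_val _ _ _ _ _ _ _ h).
Qed.

Lemma curve_length_magnetic m (gamma : R -> V * V) (T : R) : 0 < m -> 0 < T ->
  magnetic_solution M m gamma -> curve_length M (proj_curve gamma) T = m * T.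
Proof.
move=> m0 T0 sol; rewrite /curve_length.
under eq_Rintegral => t _.
  rewrite (derive1_proj_curve _ sol) /proj_curve.
  have [el _ _] := sol t; have [_ ->] := energy_level_unit m0 el.
  rewrite sqrtr_sqr (gtr0_norm m0); over.
rewrite Rintegral_cst; last exact: measurable_itv.
have := @lebesgue_measure_itv R `[0, T]; rewrite /= lte_fin T0 sube0 => muT.
by transitivity (m * fine T%:E) => //; congr (m * fine _); exact: muT.
Qed.

Lemma min_max_f : 0 < min_f M /\
  forall x, @sphere2 R x -> min_f M <= ms_f M x <= max_f M.
Proof.
have [C C1 hC] := ms_f_bounded M.
have lb : lbound (ms_f M @` @sphere2 R) C^-1.
  by move=> _ [x Sx <-]; have /andP[] := hC x Sx.
have ub : ubound (ms_f M @` @sphere2 R) C.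
  by move=> _ [x Sx <-]; have /andP[] := hC x Sx.
split => [|x Sx].
  apply: (@lt_le_trans _ _ C^-1); first by rewrite invr_gt0; lra.
  apply: lb_le_inf lb; have [x Sx] := sphere2_nonempty R.
  by exists (ms_f M x), x.
apply/andP; split.
  by apply: ge_inf; [exists C^-1|exists x].
by apply: ub_le_sup; [exists C|exists x].
Qed.

End Lengths.

(** The first times lie in intervals of radius 1 / (2 w) whose centres are at least 4 / w apart, so
    different turns give different pairs. *)
Lemma crossings_card (R : realType) (X : Type) (c : R -> X) (T phi w : R) (n k : nat) :
  0 < w -> (n <= k)%N ->
  (forall j, (j < k)%N -> exists s t : R,
    [/\ `|s - (phi + j%:R * (2 * pi / w))| <= w^-1 / 2, 0 <= s, s < t, t < T & c s = c t]) ->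
  `I_n #<= self_intersections c T.
Proof.
move=> w0 nk H.
have /choice[F hF] : forall j, exists st : R * R, (j < n)%N ->
    `|st.1 - (phi + j%:R * (2 * pi / w))| <= w^-1 / 2 /\ self_intersections c T st.
  (* The pair (0, 0) is a default value for the irrelevant indices. *)
  move=> j; have [jn|] := ltnP j n; last by exists (0, 0).
  by have [s [t [? ? ? ? ?]]] := H j (leq_trans jn nk); exists (s, t).
have inj : {in `I_n &, injective F}.
  move=> i j /set_mem /= ni /set_mem /= nj E.
  have [h1 _] := hF _ ni; have [h2 _] := hF _ nj; rewrite E in h1.
  have wV : 0 < w^-1 by rewrite invr_gt0.
  have pi2 := pi_ge2 R.
  have step (a b : nat) : (a < b)%N ->
      `|(F j).1 - (phi + a%:R * (2 * pi / w))| <= w^-1 / 2 ->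
      `|(F j).1 - (phi + b%:R * (2 * pi / w))| <= w^-1 / 2 -> False.
    move=> ab; rewrite !ler_norml => /andP[a1 a2] /andP[b1 b2].
    have : (b%:R - a%:R) * (2 * pi / w) <= w^-1 by move: a1 a2 b1 b2; lra.
    have : 1 * (4 * w^-1) <= (b%:R - a%:R) * (2 * pi / w).
      apply: ler_pM => //; first by rewrite mulr_ge0 // ltW.
        by rewrite lerBrDr addrC natr1 ler_nat.
      by rewrite ler_pM2r //; lra.
    lra.
  case: (ltngtP i j) => // ij; first by case: (step i j).
  by case: (step j i).
have /card_eqPle[_ h] := inj_card_eq inj.
apply: card_le_trans h _; apply: subset_card_le => _ [j /= jn <-].
by have [] := hF j jn.
Qed.

Theorem theorem9 (R : realType) (M : symplectic_magnetic_system R)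
    (eps : R) (n : nat) (eps_gt0 : 0 < eps) (n_gt0 : (0 < n)%N) :
  exists2 m0 : R, 0 < m0 &
    forall m : R, 0 < m -> m < m0 ->
    forall (gamma : R -> 'rV[R]_3 * 'rV[R]_3) (T : R),
      prime_periodic_solution M m gamma T ->
      (simple_closed_curve (proj_curve gamma) T
       /\ (2 * pi - eps) / max_f M * m < curve_length M (proj_curve gamma) T
          < (2 * pi + eps) / min_f M * m)
      \/
      (`I_n #<= self_intersections (proj_curve gamma) T
       /\ m / eps < curve_length M (proj_curve gamma) T).
Proof.
have [C C1 traj] := magnetic_solution_trajectory M.
(* [k] serves two purposes: it is at least [n], and k > C / eps with w T > k and w <= C gives T > 1
   / eps. *)
pose k := (n + (Num.trunc (C / eps)).+1)%N.
have [m1 m10 dich] := larmor_dichotomy k C1 eps_gt0.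
exists (Num.min m1 1); first by rewrite lt_min m10 ltr01.
move=> m m0; rewrite lt_min => /andP[mm1 ml1] gamma T [[T0 sol per] prime].
have mn0 : m != 0 by rewrite gt_eqF.
have [a [b L]] := traj m gamma m0 (ltW ml1) sol.
rewrite (curve_length_magnetic m0 T0 sol).
have [f0 hf] := min_max_f M.
have S0 : sphere2 (gamma 0).1 by have [[[]]] := sol 0.
have /andP[flo fhi] := hf _ S0.
have perT t : (gamma (t + T)).1 = (gamma t).1 /\ m^-1 *: (gamma (t + T)).2 = m^-1 *: (gamma t).2.
  by rewrite per.
have w0 := larmor_wgt0 L; set w := ms_f M _ in flo fhi w0 L dich.
have [[tau [j [[tau0 tauw j0 TE] [pertau simple]]]]|[kT [phi cr]]] :=
    dich m w _ _ _ a b mm1 L T T0 perT.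
- left.
  (* Otherwise [gamma] with period T = j tau would be the j-th iterate of [gamma] with period
     [tau]. *)
  have j1 : j = 1%N.
    apply/eqP; rewrite eqn_leq j0 andbT leqNgt; apply/negP => j1; apply: prime.
    exists j, gamma, tau; split => //; split => // t.
    have [e1 e2] := pertau t; rewrite (surjective_pairing (gamma t)) -e1.
    rewrite (surjective_pairing (gamma (t + tau))); congr pair.
    exact: (scalerI (invr_neq0 mn0)) e2.
  move: TE; rewrite j1 mul1r => TE; rewrite TE; split.
    move=> s t; rewrite !in_itv /= => /andP[s0 st] /andP[t0 tt] E.
    case: (ltgtP s t) => // h; first by case: (simple s t s0 h tt).
    by case: (simple t s t0 h st).
  (* The length is m tau with w tau within eps of 2 pi, and [w] lies between the extrema of f. *)
  move: tauw; rewrite ltr_norml => /andP[lo hi].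
  have h1 : w * tau <= max_f M * tau by rewrite ler_pM2r.
  have h2 : min_f M * tau <= w * tau by rewrite ler_pM2r.
  rewrite [m * tau]mulrC !ltr_pM2r // ltr_pdivrMr ?(lt_le_trans w0 fhi) //.
  by rewrite ltr_pdivlMr //; apply/andP; split; lra.
- right; split; first by apply: crossings_card cr => //; exact: leq_addr.
  rewrite ltr_pM2l //.
  have wC : w <= C := traj_whi L.
  have h1 : C / eps < k%:R.
    apply: lt_le_trans (truncnS_gt (C / eps)) _; rewrite ler_nat; exact: leq_addl.
  have h2 : w * T <= C * T by rewrite ler_pM2r.
  have C0 : 0 < C by lra.
  by rewrite -(ltr_pM2l C0); lra.
Qed.
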